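(* Let $\alpha\in\mathbb{R}$, let $m\in\mathbb{N}_0$, and let $(s_j)_{j=0}^m$ be a sequence of Hermitian complex $q\times q$ matrices. Then $$\mathcal{S}[(s_j)_{j=0}^m]=\Bigl\{F\in\mathcal{S}:\ \lim_{y\to+\infty}(iy)^{m+1}\Bigl[F(iy)+\sum_{j=0}^m(iy)^{-(j+1)}s_j\Bigr]=0_{q\times q}\Bigr\}.$$
   Context: $q$ is a fixed positive integer; $\mathbb{C}^{q\times q}_{\geq}$ is the set of non-negative Hermitian $q\times q$ matrices; $\operatorname{Im}A=\frac1{2i}(A-A^* )$; $\|\cdot\|$ is the Euclidean (Frobenius) norm. A non-negative Hermitian $q\times q$ measure on $[\alpha,\infty)$ is a $\sigma$-additive map from the Borel subsets of $[\alpha,\infty)$ to $\mathbb{C}^{q\times q}_{\geq}$. $\mathcal{S}$ is the set of all holomorphic $F:\mathbb{C}\setminus[\alpha,\infty)\to\mathbb{C}^{q\times q}$ with $\operatorname{Im}F(w)\in\mathbb{C}^{q\times q}_{\geq}$ for all $w$ with $\operatorname{Im}w>0$ and $F(w)\in\mathbb{C}^{q\times q}_{\geq}$ for all $w\in(-\infty,\alpha)$. $\mathcal{S}_0$ is the set of $F\in\mathcal{S}$ with $\sup_{y\geq1}y\|F(iy)\|<\infty$; each $F\in\mathcal{S}_0$ has a unique representation $F(z)=\int_{[\alpha,\infty)}\frac{1}{t-z}\sigma_F(dt)$, $z\in\mathbb{C}\setminus[\alpha,\infty)$, with a non-negative Hermitian $q\times q$ measure $\sigma_F$ on $[\alpha,\infty)$.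 $\mathcal{S}[(s_j)_{j=0}^m]$ is the set of all $F\in\mathcal{S}_0$ such that, for all $0\le j\le m$, the integral $\int_{[\alpha,\infty)}t^j\sigma_F(dt)$ exists and equals $s_j$. *)

(* Defs.v *)
From HB Require Import structures.
From mathcomp Require Import all_boot all_order all_algebra.
From mathcomp Require Import all_classical all_reals all_analysis.
From mathcomp Require Import complex.

Set Implicit Arguments.
Unset Strict Implicit.
Unset Printing Implicit Defensive.

Import Order.TTheory GRing.Theory Num.Theory.
Import numFieldNormedType.Exports.

Local Open Scope classical_set_scope.
Local Open Scope ring_scope.
Local Open Scope complex_scope.
Local Open Scope sesquilinear_scope.

(* The topology and norm of R[i] are those that every [numFieldType] carries
   through its regular module. *)
HB.instance Definition _ (R : rcfType) := NormedModule.copy R[i] R[i]^o.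

Section Matrices.
Context {R : realType} {q : nat}.
Implicit Type A : 'M[R[i]]_q.

Definition nnhermitian A : Prop :=
  A \is hermsymmx /\ forall v : 'cV[R[i]]_q, 0 <= (v ^t* *m A *m v) 0 0.

Definition immx A : 'M[R[i]]_q := (2 * 'i)^-1 *: (A - A ^t*).

Definition frobenius A : R :=
  Num.sqrt (\sum_(i < q) \sum_(j < q) Normc.normc (A i j) ^+ 2).

End Matrices.

Section ComplexIntegral.
Context {d : measure_display} {T : measurableType d} {R : realType}.
Variables (mu : {measure set T -> \bar R}) (D : set T) (f : T -> R[i]).

Definition cintegrable : Prop :=
  mu.-integrable D (fun t => (complex.Re (f t))%:E) /\
  mu.-integrable D (fun t => (complex.Im (f t))%:E).

Definition cintegral : R[i] :=
  (\int[mu]_(t in D) complex.Re (f t)) +i* (\int[mu]_(t in D) complex.Im (f t)).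

End ComplexIntegral.

Section HermitianMeasures.
Context {R : realType} {q : nat}.
Variable alpha : R.

Definition halfline : set R := `[alpha, +oo[%classic.

(* The Borel subsets of [alpha, +oo) are the Borel subsets of R contained in
   it; the values of sigma on other sets are irrelevant.  Applied to empty
   sets, countable additivity forces [sigma set0 = 0]. *)
Definition nnhermitian_measure (sigma : set R -> 'M[R[i]]_q) : Prop :=
  (forall A, measurable A -> A `<=` halfline -> nnhermitian (sigma A)) /\
  (forall A : nat -> set R,
     (forall n, measurable (A n)) -> (forall n, A n `<=` halfline) ->
     trivIset setT A ->
     (fun n => \sum_(k < n) sigma (A k)) @ \oo --> sigma (\bigcup_n A n)).

(* tau is the trace measure of sigma and W a matrix-valued Radon-Nikodym
   derivative of sigma with respect to tau. *)
Definition trace_density (sigma : set R -> 'M[R[i]]_q)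
    (tau : {finite_measure set R -> \bar R})
    (W : R -> 'M[R[i]]_q) : Prop :=
  (forall A, measurable A -> A `<=` halfline ->
     tau A = (complex.Re (\tr (sigma A)))%:E) /\
  (forall i j, cintegrable tau halfline (fun t => W t i j)) /\
  (forall A, measurable A -> A `<=` halfline ->
     forall i j, sigma A i j = cintegral tau A (fun t => W t i j)).

(* The integral of f over [alpha, +oo) with respect to sigma exists and is M.
   As is standard for nonnegative Hermitian measures (Kats, Rosenberg), it is
   the entrywise integral of f * W with respect to the trace measure, where W
   is the trace density; neither integrability nor the value depends on the
   choice of W, which is unique almost everywhere. *)
Definition has_integral (sigma : set R -> 'M[R[i]]_q) (f : R -> R[i])
    (M : 'M[R[i]]_q) : Prop :=
  exists tau W, trace_density sigma tau W /\
    forall i j, cintegrable tau halfline (fun t => f t * W t i j) /\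
      M i j = cintegral tau halfline (fun t => f t * W t i j).

End HermitianMeasures.

Section StieltjesClasses.
Context {R : realType} {q : nat}.
Variable alpha : R.

Definition slit_plane : set R[i] := ~` [set t%:C | t in `[alpha, +oo[].

(* Functions on [slit_plane] are represented by total functions whose values
   on the cut are never inspected.  [derivable F z 1] is complex
   differentiability of F at z, the scalar field being R[i]. *)
Definition classS : set (R[i] -> 'M[R[i]]_q) :=
  [set F | [/\ forall z, slit_plane z -> derivable F z 1,
               forall w, 0 < complex.Im w -> nnhermitian (immx (F w)) &
               forall x : R, x < alpha -> nnhermitian (F x%:C)]].

Definition classS0 : set (R[i] -> 'M[R[i]]_q) :=
  [set F | classS F /\
    (ereal_sup [set (y * frobenius (F ('i * y%:C)))%:E | y in `[1%R, +oo[]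
       < +oo)%E].

(* sigma is the (unique) measure sigma_F representing F. *)
Definition stieltjes_measure (F : R[i] -> 'M[R[i]]_q)
    (sigma : set R -> 'M[R[i]]_q) : Prop :=
  nnhermitian_measure alpha sigma /\
  forall z, slit_plane z ->
    has_integral alpha sigma (fun t => 1 / (t%:C - z)) (F z).

Definition classS_moments (m : nat) (s : 'I_m.+1 -> 'M[R[i]]_q) :
    set (R[i] -> 'M[R[i]]_q) :=
  [set F | classS0 F /\
    exists2 sigma, stieltjes_measure F sigma &
      forall j : 'I_m.+1,
        has_integral alpha sigma (fun t => t%:C ^+ j) (s j)].

End StieltjesClasses.

(* Main.v *)
From HB Require Import structures.
Require Import Defs.
From mathcomp Require Import all_boot all_order all_algebra.
From mathcomp Require Import all_classical all_reals all_analysis.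
From mathcomp Require Import measurable_realfun complex.
From mathcomp Require Import ring lra.
Import Order.TTheory GRing.Theory Num.Theory.
Import numFieldNormedType.Exports.
Local Open Scope classical_set_scope.
Local Open Scope ring_scope.
Local Open Scope complex_scope.
Set Implicit Arguments. Unset Strict Implicit. Unset Printing Implicit Defensive.

(** Write [F_v(z) = v^* F(z) v]. Both sides of the equality are statements about
    these scalar functions, because a matrix is determined by its quadratic form
    through complex polarization.

    If [F] has a measure with moments [s_0, ..., s_m], the finite geometric
    expansion of [1 / (t - z)] at [z = i y] writes the bracketed error, times
    [z^(m+1)], as the integral of [t / (t - i y)] against [t^m] and the density of
    the measure ([cauchy_expansion]). The first factor is bounded by [1] and tends
    to [0], so dominated convergence gives the limit ([moments_expansion]).

    Conversely, let the limit be zero. Then [y F_v(i y)] is bounded, and [F_v] has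
    an integral representation. On the upper half-plane it comes from Schwarz's
    formula on circles in the disc, transported by the Cayley transform: the
    boundary densities have bounded mass and converge to a Herglotz measure, which
    has no mass at the point at infinity because of the bound on [y F_v(i y)]
    ([spectral_upper]). Since [F_v] is real below [alpha], the measure lives on the
    half-line, and the identity theorem extends the representation to the slit
    plane ([scalar_representation]). The limit is taken along a fixed ultrafilter,
    which makes the measure depend additively on the function; uniqueness of
    representing measures is never invoked.

    The moments of these scalar measures follow by induction
    ([hamburger_nevanlinna]): if the moments below order [k] are as required, the
    real part of the expansion says that the averages of [t^k] with weight
    [y^2 / (t^2 + y^2)] tend to [v^* s_k v]. Powers are bounded below on the
    half-line, so monotone convergence makes [t^k] integrable, and its integral is
    the limit.

    It remains to assemble the scalar measures. By additivity, every real linear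
    relation between the forms [v^* M v], valid for all matrices [M], passes from
    the functions [F_v] to their measures ([spectral_relation]); therefore the
    matrix obtained from the scalar measures by polarization has them as its
    quadratic form ([qform_matrix_measure]) and is a nonnegative Hermitian measure.
    Its trace is the measure of the trace of [F], and the Radon-Nikodym densities of
    the scalar measures with respect to it provide the matrix density. Integrals
    against the matrix measure then have the integrals against the scalar measures
    as quadratic forms ([has_integral_matrix_measure]), which yields the
    representation of [F] and the moments. *)

(** * Complex numbers: real-valued modulus and differentiability *)

Section ComplexBasics.
Variable R : realType.
Local Notation C := R[i].
Local Notation normc := (@Normc.normc R).
Implicit Types (z w : C) (f g : C -> C).

Lemma normcE' z : `|z| = (normc z)%:C.
Proof. by []. Qed.

Lemma normc_ge0 z : 0 <= normc z.
Proof. by rewrite -ler0c -normcE'. Qed.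

Lemma normc_eq0 z : (normc z == 0) = (z == 0).
Proof.
apply/eqP/eqP => [/Normc.eq0_normc //|->]; exact: Normc.normc0.
Qed.

Lemma normc_gt0 z : (0 < normc z) = (z != 0).
Proof. by rewrite lt_neqAle normc_ge0 andbT eq_sym normc_eq0. Qed.

Lemma normcN' z : normc (- z) = normc z.
Proof. by apply: complexI; rewrite -!normcE' normrN. Qed.

Lemma normcB z w : normc (z - w) = normc (w - z).
Proof. by rewrite -normcN' opprB. Qed.

Lemma normcD z w : normc (z + w) <= normc z + normc w.
Proof. exact: le_normcD. Qed.

Lemma normcR (x : R) : normc x%:C = `|x|.
Proof. by rewrite /= expr0n /= addr0 sqrtr_sqr. Qed.

Lemma normcJ' z : normc z^*%C = normc z.
Proof. by case: z => a b /=; rewrite sqrrN. Qed.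

Lemma normci : normc 'i%C = 1.
Proof. by rewrite /= expr0n /= add0r expr1n sqrtr1. Qed.

Lemma normcM z w : normc (z * w) = normc z * normc w.
Proof. exact: Normc.normcM. Qed.

Lemma normcV z : normc z^-1 = (normc z)^-1.
Proof. exact: Normc.normcV. Qed.

Lemma normc0 : normc 0 = 0.
Proof. exact: Normc.normc0. Qed.

Lemma normc1 : normc 1 = 1.
Proof. exact: Normc.normc1. Qed.

Lemma normcX z n : normc (z ^+ n) = normc z ^+ n.
Proof.
by elim: n => [|n IH]; rewrite ?expr0 ?normc1// !exprS normcM IH.
Qed.

Lemma Re_le_normc z : `|complex.Re z| <= normc z.
Proof. by rewrite -lecR -normcE'; exact: normc_ge_Re. Qed.

Lemma Im_le_normc z : `|complex.Im z| <= normc z.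
Proof.
by case: z => a b /=; rewrite -sqrtr_sqr ler_wsqrtr// lerDr sqr_ge0.
Qed.

Lemma normc_le_ReIm z : normc z <= `|complex.Re z| + `|complex.Im z|.
Proof.
rewrite [z in X in X <= _]complexE; apply: (le_trans (normcD _ _)).
by rewrite normcM normci mul1r !normcR.
Qed.

Lemma ReM z w : complex.Re (z * w) =
  complex.Re z * complex.Re w - complex.Im z * complex.Im w.
Proof. by case: z w => a b [c d]. Qed.

Lemma ImM z w : complex.Im (z * w) =
  complex.Re z * complex.Im w + complex.Im z * complex.Re w.
Proof. by case: z w => a b [c d]. Qed.

Lemma ReD z w : complex.Re (z + w) = complex.Re z + complex.Re w.
Proof. by case: z w => a b [c d]. Qed.

Lemma ImD z w : complex.Im (z + w) = complex.Im z + complex.Im w.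
Proof. by case: z w => a b [c d]. Qed.

Lemma ReN z : complex.Re (- z) = - complex.Re z.
Proof. by case: z. Qed.

Lemma ImN z : complex.Im (- z) = - complex.Im z.
Proof. by case: z. Qed.

Lemma eqC z w : complex.Re z = complex.Re w ->
  complex.Im z = complex.Im w -> z = w.
Proof. by case: z w => a b [c d] /= -> ->. Qed.

Lemma sqr_normc' z : normc z ^+ 2 = complex.Re z ^+ 2 + complex.Im z ^+ 2.
Proof. by case: z => a b /=; rewrite sqr_sqrtr// addr_ge0// sqr_ge0. Qed.

Lemma nbhs_normcP z (P : set C) : nbhs z P <->
  exists2 d : R, 0 < d & forall w, normc (w - z) < d -> P w.
Proof.
split=> [/nbhs_ballP[d /= d0 dP]|[d d0 dP]].
  exists (complex.Re d).
    by move: d0; rewrite ltcE /= => /andP[].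
  move=> w wz; apply: dP; rewrite -ball_normE /= distrC normcE'.
  rewrite ltcE /= wz andbT.
  by move: d0; rewrite ltcE /= => /andP[].
apply/nbhs_ballP; exists d%:C => /=; first by rewrite ltcR.
move=> w; rewrite -ball_normE /= distrC normcE' ltcR; exact: dP.
Qed.

(** Continuity at a point with a real modulus, which avoids the order of [R[i]]
    in epsilon arguments. *)
Definition ccont f z := forall e : R, 0 < e -> exists2 d : R, 0 < d &
  forall w, normc (w - z) < d -> normc (f w - f z) < e.

(** The little-o form of complex differentiability, with real epsilons; every
    estimate on holomorphic functions below starts from it. *)
Lemma derivable_normcP f z : derivable f z 1 <->
  exists c, forall e : R, 0 < e -> exists2 d : R, 0 < d &
    forall w, normc (w - z) < d ->
      normc (f w - f z - c * (w - z)) <= e * normc (w - z).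
Proof.
split=> [/derivableP[+ +]|[c hc]].
  move=> /cvg_ex[c /cvgrPdist_le hc] _; exists c => e e0.
  have /hc : 0 < e%:C by rewrite ltcR.
  rewrite /prop_near1/= /dnbhs /within/= => /nbhs_normcP[d d0 hd].
  exists d => // w wz; have [->|wnz] := eqVneq w z.
    by rewrite !subrr mulr0 subrr normc0 mulr0.
  have wz0 : w - z != 0 by rewrite subr_eq0.
  have := hd (w - z); rewrite subr0 => /(_ wz wz0).
  rewrite normcE' lecR.
  rewrite [_ *: 1](_ : _ = w - z); last by rewrite /GRing.scale /= mulr1.
  rewrite subrK /GRing.scale /= => h; rewrite normcB in h.
  have -> : f w - f z - c * (w - z) =
      ((w - z)^-1 * (f w - f z) - c) * (w - z).
    by rewrite mulrBl mulrAC mulVf// mul1r.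
  by rewrite normcM; apply: ler_wpM2r; rewrite ?normc_ge0.
apply/cvg_ex; exists c; apply/cvgrPdist_le => e e0.
have e0' : 0 < complex.Re e by move: e0; rewrite ltcE /= => /andP[].
have [d d0 hd] := hc _ e0'.
rewrite /prop_near1/= /dnbhs /within/=; apply/nbhs_normcP.
exists d => // h; rewrite subr0 => hdd h0.
have := hd (h + z); rewrite addrK => /(_ hdd) hh.
rewrite normcE' lecE /=; apply/andP; split.
  by move: e0; rewrite ltcE /= => /andP[].
rewrite [_ *: 1](_ : _ = h); last by rewrite /GRing.scale /= mulr1.
rewrite normcB /GRing.scale /= -(ler_pM2r (_ : 0 < normc h)) ?normc_gt0//.
by rewrite -normcM mulrBl mulrAC mulVf// mul1r.
Qed.

Lemma derivable_ccont f z : derivable f z 1 -> ccont f z.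
Proof.
move=> /derivable_normcP[c hc] e e0.
have [d d0 hd] := hc 1 ltr01.
have k0 : 0 < 1 + normc c by rewrite ltr_pwDl// normc_ge0.
exists (Num.min d (e / (1 + normc c))).
  by rewrite lt_min d0 divr_gt0.
move=> w; rewrite lt_min => /andP[wd we].
apply: (@le_lt_trans _ _ ((1 + normc c) * normc (w - z))).
  rewrite -[f w - f z](subrK (c * (w - z))) mulrDl.
  by apply: (le_trans (normcD _ _)); rewrite normcM lerD2r; exact: hd.
by rewrite mulrC -ltr_pdivlMr.
Qed.

Lemma holo_cst (c : C) z : derivable (fun=> c) z 1.
Proof. exact: derivable_cst. Qed.

Lemma holo_id z : derivable (fun w : C => w) z 1.
Proof. exact: derivable_id. Qed.

Lemma holoD f g z : derivable f z 1 -> derivable g z 1 ->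
  derivable (fun w => f w + g w) z 1.
Proof. exact: derivableD. Qed.

Lemma holoB f g z : derivable f z 1 -> derivable g z 1 ->
  derivable (fun w => f w - g w) z 1.
Proof. exact: derivableB. Qed.

Lemma holoM f g z : derivable f z 1 -> derivable g z 1 ->
  derivable (fun w => f w * g w) z 1.
Proof. exact: derivableM. Qed.

Lemma holoV f z : f z != 0 -> derivable f z 1 ->
  derivable (fun w => (f w)^-1) z 1.
Proof. exact: derivableV. Qed.

Lemma holo_comp f g z : derivable f (g z) 1 -> derivable g z 1 ->
  derivable (fun w => f (g w)) z 1.
Proof.
move=> /derivable1_diffP df /derivable1_diffP dg; apply/derivable1_diffP.
exact: (@differentiable_comp C C C C g f z dg df).
Qed.

Lemma holo_sum n (f : 'I_n -> C -> C) z : (forall i, derivable (f i) z 1) ->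
  derivable (fun w => \sum_(i < n) f i w) z 1.
Proof.
move=> df; rewrite [X in derivable X](_ : _ = \sum_(i < n) f i).
  exact: derivable_sum.
by apply/funext => w; rewrite fct_sumE.
Qed.

Lemma holoX f n z : derivable f z 1 -> derivable (fun w => f w ^+ n) z 1.
Proof.
move=> df; elim: n => [|n IH]; first exact: holo_cst.
rewrite [X in derivable X](_ : _ = fun w => f w * f w ^+ n); first exact: holoM.
by apply/funext => w; rewrite exprS.
Qed.

Lemma eq_holo f g z (d : R) : 0 < d ->
  (forall w, normc (w - z) < d -> f w = g w) ->
  derivable f z 1 -> derivable g z 1.
Proof.
move=> d0 fg /derivable_normcP[c hc]; apply/derivable_normcP; exists c => e e0.
have [d' d'0 hd] := hc _ e0; exists (Num.min d d').
  by rewrite lt_min d0.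
move=> w; rewrite lt_min => /andP[wd wd'].
by rewrite -!fg ?subrr ?normc0//; exact: hd.
Qed.

End ComplexBasics.

(** * Complex-valued integrals *)

Section ComplexIntegralTheory.
Context d (T : measurableType d) (R : realType).
Variable mu : {measure set T -> \bar R}.
Variable D : set T.
Hypothesis mD : measurable D.
Local Notation C := R[i].
Local Notation normc := (@Normc.normc R).
Implicit Types (f g : T -> C).

Definition cmeasurable f := measurable_fun D (fun t => complex.Re (f t)) /\
  measurable_fun D (fun t => complex.Im (f t)).

Lemma cintegrable_cmeasurable f : cintegrable mu D f -> cmeasurable f.
Proof.
by move=> [/measurable_int/measurable_EFinP ? /measurable_int/measurable_EFinP ?].
Qed.

Lemma cmeasurableM f g : cmeasurable f -> cmeasurable g ->
  cmeasurable (fun t => f t * g t).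
Proof.
move=> [fr fi] [gr gi]; split.
- under eq_fun do rewrite ReM.
  by apply: measurable_funB; exact: measurable_funM.
- under eq_fun do rewrite ImM.
  by apply: measurable_funD; exact: measurable_funM.
Qed.

Lemma cmeasurable_cst (c : C) : cmeasurable (fun=> c).
Proof. by split; exact: measurable_cst. Qed.

Lemma cmeasurable_real (h : T -> R) : measurable_fun D h ->
  cmeasurable (fun t => (h t)%:C).
Proof. by move=> mh; split => //; exact: measurable_cst. Qed.

Lemma cintegrable_dom f (g : T -> R) : cmeasurable f ->
  mu.-integrable D (EFin \o g) -> (forall t, D t -> normc (f t) <= g t) ->
  cintegrable mu D f.
Proof.
move=> [mr mi] ig fg; split.
- apply: (le_integrable mD _ _ ig); first exact/measurable_EFinP.
  move=> t Dt /=; rewrite lee_fin; apply: (le_trans (Re_le_normc _)).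
  by apply: (le_trans (fg t Dt)); rewrite ler_norm.
- apply: (le_integrable mD _ _ ig); first exact/measurable_EFinP.
  move=> t Dt /=; rewrite lee_fin; apply: (le_trans (Im_le_normc _)).
  by apply: (le_trans (fg t Dt)); rewrite ler_norm.
Qed.

Lemma integrable_Rnorm (h : T -> R) : mu.-integrable D (EFin \o h) ->
  mu.-integrable D (EFin \o (fun t => `|h t|)).
Proof. by move=> /integrable_norm. Qed.

Lemma integrable_RD (h k : T -> R) : mu.-integrable D (EFin \o h) ->
  mu.-integrable D (EFin \o k) ->
  mu.-integrable D (EFin \o (fun t => h t + k t)).
Proof. by move=> ih ik; exact: (integrableD mD ih ik). Qed.

Lemma integrable_RZl (c : R) (h : T -> R) : mu.-integrable D (EFin \o h) ->
  mu.-integrable D (EFin \o (fun t => c * h t)).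
Proof. by move=> ih; exact: (integrableZl mD _ ih). Qed.

Lemma cintegrable_normc f : cintegrable mu D f ->
  mu.-integrable D (EFin \o (fun t => normc (f t))).
Proof.
move=> ifn; have [mr mi] := cintegrable_cmeasurable ifn; case: ifn => ir ii.
have i2 := integrable_RD (integrable_Rnorm ir) (integrable_Rnorm ii).
apply: (le_integrable mD _ _ i2).
  apply/measurable_EFinP.
  rewrite [X in measurable_fun _ X](_ : _ = fun t =>
    Num.sqrt (complex.Re (f t) ^+ 2 + complex.Im (f t) ^+ 2)).
    apply: (@measurableT_comp _ _ _ _ _ _ (@Num.sqrt R)).
      apply: continuous_measurable_fun; exact: sqrt_continuous.
    by apply: measurable_funD; exact: measurable_funX.
  by apply/funext => t; case: (f t).
move=> t Dt /=; rewrite lee_fin ger0_norm ?normc_ge0//.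
by apply: (le_trans (normc_le_ReIm _)); rewrite ler_norm.
Qed.

Lemma cintegrableD f g : cintegrable mu D f -> cintegrable mu D g ->
  cintegrable mu D (fun t => f t + g t).
Proof.
move=> [fr fi] [gr gi]; split.
- under eq_fun do rewrite ReD; exact: integrable_RD.
- under eq_fun do rewrite ImD; exact: integrable_RD.
Qed.

Lemma cintegralD f g : cintegrable mu D f -> cintegrable mu D g ->
  cintegral mu D (fun t => f t + g t) = cintegral mu D f + cintegral mu D g.
Proof.
move=> [fr fi] [gr gi]; rewrite /cintegral; apply: eqC => /=.
- by under eq_Rintegral do rewrite ReD; rewrite RintegralD.
- by under eq_Rintegral do rewrite ImD; rewrite RintegralD.
Qed.

Lemma cintegrableZl (c : C) f : cintegrable mu D f ->
  cintegrable mu D (fun t => c * f t).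
Proof.
move=> ifn; have mf := cintegrable_cmeasurable ifn.
apply: (cintegrable_dom (cmeasurableM (cmeasurable_cst c) mf)
  (integrable_RZl (normc c) (cintegrable_normc ifn))).
by move=> t _; rewrite normcM.
Qed.

Lemma cintegralZl (c : C) f : cintegrable mu D f ->
  cintegral mu D (fun t => c * f t) = c * cintegral mu D f.
Proof.
move=> [fr fi]; rewrite /cintegral; apply: eqC => /=; rewrite ?ReM ?ImM /=.
- under eq_Rintegral do rewrite ReM.
  rewrite RintegralB//; try exact: integrable_RZl.
  by rewrite !RintegralZl.
- under eq_Rintegral do rewrite ImM.
  rewrite RintegralD//; try exact: integrable_RZl.
  by rewrite !RintegralZl.
Qed.

Lemma cintegrableB f g : cintegrable mu D f -> cintegrable mu D g ->
  cintegrable mu D (fun t => f t - g t).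
Proof.
move=> ig ih; under eq_fun do rewrite -mulN1r.
by apply: cintegrableD => //; exact: cintegrableZl.
Qed.

Lemma cintegralB f g : cintegrable mu D f -> cintegrable mu D g ->
  cintegral mu D (fun t => f t - g t) = cintegral mu D f - cintegral mu D g.
Proof.
move=> ig ih; under eq_fun do rewrite -mulN1r.
by rewrite cintegralD ?cintegralZl ?mulN1r//; exact: cintegrableZl.
Qed.

Lemma eq_cintegral f g : (forall t, D t -> f t = g t) ->
  cintegral mu D f = cintegral mu D g.
Proof.
move=> fg; rewrite /cintegral; congr (_ +i* _); apply: eq_Rintegral => t;
  by rewrite inE => /fg ->.
Qed.

Lemma eq_cintegrable f g : (forall t, D t -> f t = g t) ->
  cintegrable mu D f -> cintegrable mu D g.
Proof.
move=> fg [fr fi]; split; [apply: eq_integrable fr|apply: eq_integrable fi];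
  by [|move=> t; rewrite inE => /fg ->].
Qed.

Lemma cintegrable_real (h : T -> R) : mu.-integrable D (EFin \o h) ->
  cintegrable mu D (fun t => (h t)%:C).
Proof. by move=> ih; split => //=; exact: integrable0. Qed.

Lemma cintegral_real (h : T -> R) :
  cintegral mu D (fun t => (h t)%:C) = (\int[mu]_(t in D) h t)%:C.
Proof.
by rewrite /cintegral /= ; congr (_ +i* _); rewrite /Rintegral integral0.
Qed.

Lemma cintegrable_conj f : cintegrable mu D f ->
  cintegrable mu D (fun t => (f t)^*%C).
Proof.
move=> [fr fi]; split.
- by apply: eq_integrable fr => // t _ /=; case: (f t).
- apply: eq_integrable (integrable_RZl (-1) fi) => // t _ /=.
  by case: (f t) => a b /=; rewrite mulN1r.
Qed.

Lemma cintegral_conj f : cintegrable mu D f ->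
  cintegral mu D (fun t => (f t)^*%C) = (cintegral mu D f)^*%C.
Proof.
move=> [fr fi]; apply: eqC => /=.
- by apply: eq_Rintegral => t _; case: (f t).
- rewrite -mulN1r -RintegralZl//.
  by apply: eq_Rintegral => t _; case: (f t) => a b /=; rewrite mulN1r.
Qed.

Lemma normc_cintegral_le f (g : T -> R) : cintegrable mu D f ->
  mu.-integrable D (EFin \o g) -> (forall t, D t -> normc (f t) <= g t) ->
  normc (cintegral mu D f) <= \int[mu]_(t in D) g t.
Proof.
move=> ifn ig fg; set I := cintegral mu D f.
have [I0|In0] := eqVneq (normc I) 0.
  rewrite I0; apply: Rintegral_ge0 => t Dt.
  by rewrite (le_trans _ (fg t Dt))// normc_ge0.
(* rotate so that the integral becomes real and nonnegative *)
pose c := I^*%C * ((normc I)^-1)%:C.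
have nc : normc c = 1.
  by rewrite /c normcM normcJ' normcR ger0_norm ?invr_ge0 ?normc_ge0// mulfV.
have -> : normc I = complex.Re (c * I).
  rewrite /c mulrAC [I^*%C * I]mulrC -sqr_normc normcE' -rmorphXn -rmorphM /=.
  by rewrite expr2 mulfK.
rewrite -cintegralZl// [complex.Re _]/=; apply: le_Rintegral => //.
  by have [] := cintegrableZl c ifn.
move=> t Dt; apply: (le_trans (ler_norm _)); apply: (le_trans (Re_le_normc _)).
by rewrite normcM nc mul1r; exact: fg.
Qed.

End ComplexIntegralTheory.

(** * Two-dimensional bisection *)

Section Bisection.
Variable R : realType.

Lemma nested_intervals (a b : nat -> R) :
  (forall n, a n <= a n.+1) -> (forall n, b n.+1 <= b n) ->
  (forall n, a n <= b n) -> exists x, forall n, a n <= x <= b n.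
Proof.
move=> an bn ab.
have aS n m : (n <= m)%N -> a n <= a m.
  move=> /subnK <-; elim: (m - n)%N => [|k IH]; first by rewrite add0n.
  by rewrite addSn; apply: (le_trans IH).
have bS n m : (n <= m)%N -> b m <= b n.
  move=> /subnK <-; elim: (m - n)%N => [|k IH]; first by rewrite add0n.
  by rewrite addSn; apply: (le_trans _ IH).
have abnm n m : a n <= b m.
  apply: (le_trans (aS n (maxn n m) (leq_maxl _ _))).
  exact: (le_trans (ab _) (bS _ _ (leq_maxr _ _))).
exists (sup (range a)) => n; apply/andP; split.
  apply: ub_le_sup; last by exists n.
  by exists (b 0%N) => _ [m _ <-].
apply: ge_sup; first by exists (a 0%N), 0%N.
by move=> _ [m _ <-].
Qed.

(** A property of closed rectangles that passes from four quarters to the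
    whole, and holds for all small rectangles around each point, holds for the
    whole rectangle: otherwise successive bad quarters shrink to a point. *)
Lemma bisection2 (P : R -> R -> R -> R -> Prop) a0 b0 c0 d0 :
  a0 <= b0 -> c0 <= d0 ->
  (forall a b c d, a0 <= a -> a <= b -> b <= b0 ->
     c0 <= c -> c <= d -> d <= d0 ->
     P a ((a + b) / 2) c ((c + d) / 2) -> P ((a + b) / 2) b c ((c + d) / 2) ->
     P a ((a + b) / 2) ((c + d) / 2) d -> P ((a + b) / 2) b ((c + d) / 2) d ->
     P a b c d) ->
  (forall x y, a0 <= x <= b0 -> c0 <= y <= d0 -> exists2 e, 0 < e &
     forall a b c d, a0 <= a -> a <= x -> x <= b -> b <= b0 ->
       c0 <= c -> c <= y -> y <= d -> d <= d0 ->
       b - a < e -> d - c < e -> P a b c d) ->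
  P a0 b0 c0 d0.
Proof.
move=> ab0 cd0 quarter small; apply: contrapT => nP0.
pose Q (q : R * R * R * R) := let: (a, b, c, d) := q in P a b c d.
pose good (q : R * R * R * R) := let: (a, b, c, d) := q in
  [/\ a0 <= a, a <= b, b <= b0 & [/\ c0 <= c, c <= d & d <= d0]] /\ ~ P a b c d.
pose half (q q' : R * R * R * R) := 
  let: (a, b, c, d) := q in let: (a', b', c', d') := q' in
  [/\ a <= a', b' <= b, c <= c' & d' <= d] /\
  b' - a' = (b - a) / 2 /\ d' - c' = (d - c) / 2.
have step q : good q -> exists q', good q' /\ half q q'.
  case: q => [[[a b] c] d] [[h1 h2 h3 [h4 h5 h6]] nP].
  apply: contrapT => nex; apply: nP; apply: quarter => //; apply: contrapT => nP';
    apply: nex.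
  - exists (a, (a + b) / 2, c, (c + d) / 2); do !split => //; lra.
  - exists ((a + b) / 2, b, c, (c + d) / 2); do !split => //; lra.
  - exists (a, (a + b) / 2, (c + d) / 2, d); do !split => //; lra.
  - exists ((a + b) / 2, b, (c + d) / 2, d); do !split => //; lra.
pose next q := if pselect (good q) is left h then sval (cid (step q h)) else q.
pose q n := iter n next (a0, b0, c0, d0).
have gq n : good (q n).
  elim: n => [|n IH]; first by split.
  by rewrite /q iterS -/(q n) /next; case: pselect => // h; case: cid => ? [].
have hq n : half (q n) (q n.+1).
  rewrite {2}/q iterS -/(q n) /next; case: pselect => [h|]; last by have := gq n.
  by case: cid => ? [].
pose a n := (q n).1.1.1; pose b n := (q n).1.1.2.
pose c n := (q n).1.2; pose d n := (q n).2.
have qE n : q n = (a n, b n, c n, d n).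
  by rewrite /a /b /c /d; case: (q n) => [[[]]].
have {}gq n : [/\ a0 <= a n, a n <= b n, b n <= b0 &
    [/\ c0 <= c n, c n <= d n & d n <= d0]] /\ ~ P (a n) (b n) (c n) (d n).
  by have := gq n; rewrite qE.
have {}hq n : [/\ a n <= a n.+1, b n.+1 <= b n, c n <= c n.+1 & d n.+1 <= d n] /\
  b n.+1 - a n.+1 = (b n - a n) / 2 /\ d n.+1 - c n.+1 = (d n - c n) / 2.
  by have := hq n; rewrite !qE.
have [x xab] : exists x, forall n, a n <= x <= b n.
  by apply: nested_intervals => n; have [[]] := hq n; have [[]] := gq n.
have [y ycd] : exists y, forall n, c n <= y <= d n.
  apply: nested_intervals => n; have [[]] := hq n => //.
  by have [[_ _ _ []]] := gq n.
have wab n : b n - a n = (b0 - a0) / 2 ^+ n.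
  elim: n => [|n IH]; first by rewrite expr0 divr1.
  by have [_ [-> _]] := hq n; rewrite IH exprSr invfM mulrA.
have wcd n : d n - c n = (d0 - c0) / 2 ^+ n.
  elim: n => [|n IH]; first by rewrite expr0 divr1.
  by have [_ [_ ->]] := hq n; rewrite IH exprSr invfM mulrA.
have [e e0 He] := small x y (xab 0%N) (ycd 0%N).
pose L := (b0 - a0) + (d0 - c0) + 1.
have L0 : 0 < L by rewrite /L; lra.
have [n Hn] : exists n, 1 / 2 ^+ n < e / L.
  have eL : 0 < e / L by rewrite divr_gt0.
  have [N _ HN] := near_infty_natSinv_expn_lt (PosNum eL).
  by exists N; apply: HN => /=.
have Hn' : L / 2 ^+ n < e.
  by move: Hn; rewrite ltr_pdivlMr// mul1r mulrC.
have p2 : 0 < (2 ^+ n)^-1 :> R by rewrite invr_gt0 exprn_gt0.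
have [[h1 h2 h3 [h4 h5 h6]] nP] := gq n; apply: nP.
have /andP[xa xb] := xab n; have /andP[yc yd] := ycd n.
apply: He => //.
- rewrite wab; apply: (le_lt_trans _ Hn'); rewrite ler_pM2r// /L; lra.
- rewrite wcd; apply: (le_lt_trans _ Hn'); rewrite ler_pM2r// /L; lra.
Qed.

End Bisection.

(** * Integrals along intervals and the unit circle *)

Section Paths.
Variable R : realType.
Local Notation C := R[i].
Local Notation normc := (@Normc.normc R).
Local Notation mu := (@lebesgue_measure R).
Implicit Types (k : R -> C) (g : C -> C).

Definition rcont k x := forall e : R, 0 < e -> exists2 d : R, 0 < d &
  forall y, `|y - x| < d -> normc (k y - k x) < e.

Lemma ccontM g h z : ccont g z -> ccont h z -> ccont (fun w => g w * h w) z.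
Proof.
move=> cg ch e e0; set M := normc (g z) + normc (h z) + 1.
have M0 : 0 < M by rewrite /M ltr_wpDl// addr_ge0// normc_ge0.
have eM : 0 < e / (3 * M) by rewrite divr_gt0// mulr_gt0.
have m0 : 0 < Num.min 1 (e / (3 * M)) by rewrite lt_min ltr01.
have [d1 d10 h1] := cg _ m0; have [d2 d20 h2] := ch _ m0.
exists (Num.min d1 d2); first by rewrite lt_min d10.
move=> w; rewrite lt_min => /andP[/h1 + /h2].
rewrite !lt_min => /andP[g1 ge] /andP[h1' he].
have -> : g w * h w - g z * h z =
  (g w - g z) * (h w - h z) + (g w - g z) * h z + g z * (h w - h z) by ring.
apply: (le_lt_trans (normcD _ _)).
apply: (@le_lt_trans _ _ (e / (3 * M) * 1 + e / (3 * M) * normc (h z) +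
  normc (g z) * (e / (3 * M)))).
  apply: lerD; last by rewrite normcM ler_wpM2l ?normc_ge0// ltW.
  apply: (le_trans (normcD _ _)); rewrite !normcM; apply: lerD.
    by apply: ler_pM; rewrite ?normc_ge0// ltW.
  by rewrite ler_wpM2r ?normc_ge0// ltW.
rewrite (_ : _ + _ = e / (3 * M) * M); last by rewrite /M; ring.
have -> : e / (3 * M) * M = e / 3 by field; rewrite gt_eqF.
lra.
Qed.

Lemma rcont_comp g k x : ccont g (k x) -> rcont k x ->
  rcont (fun y => g (k y)) x.
Proof.
move=> cg ck e /cg[d d0 hd]; have [d' d'0 hd'] := ck _ d0.
by exists d' => // y /hd' /hd.
Qed.

Lemma eq_rcont k k' x : k =1 k' -> rcont k x -> rcont k' x.
Proof. by move=> /funext ->. Qed.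

Lemma continuous_rcont k x : {for x, continuous (fun y => complex.Re (k y))} ->
  {for x, continuous (fun y => complex.Im (k y))} -> rcont k x.
Proof.
move=> /cvgrPdist_lt cr /cvgrPdist_lt ci e e0.
have e2 : 0 < e / 2 by rewrite divr_gt0.
have /nbhs_ballP[d1 /= d10 h1] := cr _ e2.
have /nbhs_ballP[d2 /= d20 h2] := ci _ e2.
exists (Num.min d1 d2); first by rewrite lt_min d10.
move=> y; rewrite lt_min distrC => /andP[/h1 h1' /h2 h2'].
apply: (le_lt_trans (normc_le_ReIm _)).
by rewrite ReD ImD ReN ImN distrC [X in _ + X]distrC (splitr e) ltrD.
Qed.

Lemma rcont_continuous k x : rcont k x ->
  {for x, continuous (fun y => complex.Re (k y))} /\
  {for x, continuous (fun y => complex.Im (k y))}.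
Proof.
move=> ck; split; apply/cvgrPdist_lt => e /ck[d d0 hd]; apply/nbhs_ballP;
  exists d => //= y; rewrite /ball /= distrC => /hd yx; rewrite distrC.
- by rewrite -ReN -ReD; apply: (le_lt_trans (Re_le_normc _)).
- by rewrite -ImN -ImD; apply: (le_lt_trans (Im_le_normc _)).
Qed.

Lemma rcont_cintegrable a b k : (forall x, a <= x <= b -> rcont k x) ->
  cintegrable mu `[a, b] k.
Proof.
move=> ck; split; apply: continuous_compact_integrable;
  try exact: segment_compact; apply: continuous_in_subspaceT => x;
  rewrite inE /= in_itv /= => /ck /rcont_continuous[].
  by [].
by [].
Qed.

Lemma cintegral_split a m b k : a <= m -> m <= b ->
  (forall x, a <= x <= b -> rcont k x) ->
  cintegral mu `[a, b] k = cintegral mu `[a, m] k + cintegral mu `[m, b] k.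
Proof.
move=> am mb /rcont_cintegrable ik.
have aux (h : R -> R) : mu.-integrable `[a, b] (EFin \o h) ->
    \int[mu]_(x in `[a, b]) h x =
    \int[mu]_(x in `[a, m]) h x + \int[mu]_(x in `[m, b]) h x.
  move=> ih; have ih' : mu.-integrable `]m, b] (EFin \o h).
    by apply: integrableS ih => //; apply: subset_itv; rewrite bnd_simp.
  rewrite -(@Rintegral_itv_obnd_cbnd _ m)//.
  rewrite -(@Rintegral_itvB _ h (BLeft a) (BRight b) m) ?bnd_simp//.
  by rewrite addrC subrK.
by case: ik => ir ii; apply: eqC; rewrite ?ReD ?ImD /=; exact: aux.
Qed.

Lemma normc_cintegral_itv a b k (M : R) : a <= b ->
  (forall x, a <= x <= b -> rcont k x) ->
  (forall x, a <= x <= b -> normc (k x) <= M) ->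
  normc (cintegral mu `[a, b] k) <= M * (b - a).
Proof.
move=> ab /rcont_cintegrable ik kM.
have iM : mu.-integrable `[a, b] (EFin \o (fun=> M)).
  apply: continuous_compact_integrable; first exact: segment_compact.
  by apply: continuous_subspaceT; exact: cst_continuous.
have fM t : `[a, b]%classic t -> normc (k t) <= M.
  by rewrite /= in_itv /=; exact: kM.
apply: (le_trans (normc_cintegral_le _ ik iM fM)); first by [].
rewrite Rintegral_cst//= lebesgue_measure_itv /= lte_fin.
case: ltP => [_ //|ba /=]; rewrite mulr0 (_ : b - a = 0) ?mulr0//; lra.
Qed.

Definition cis (x : R) : C := cos x +i* sin x.

Lemma normc_cis x : normc (cis x) = 1.
Proof. by rewrite /cis /= cos2Dsin2 sqrtr1. Qed.

Lemma cis_neq0 x : cis x != 0.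
Proof. by rewrite -normc_eq0 normc_cis oner_eq0. Qed.

Lemma rcont_cis x : rcont cis x.
Proof. by apply: continuous_rcont; [exact: continuous_cos|exact: continuous_sin]. Qed.

Lemma cis_pi : cis pi = cis (- pi).
Proof. by rewrite /cis cosN sinN sinpi oppr0. Qed.

Lemma cintegral_cis c d : c <= d ->
  'i%C * cintegral mu `[c, d] cis = cis d - cis c.
Proof.
rewrite le_eqVlt => /predU1P[->|cd].
  rewrite subrr set_itv1 /cintegral !Rintegral_set1.
  by apply: eqC => /=; ring.
have ccos : {within `[c, d], continuous (@cos R)}.
  by apply: continuous_subspaceT; exact: continuous_cos.
have csin : {within `[c, d], continuous (@sin R)}.
  by apply: continuous_subspaceT; exact: continuous_sin.
have e1 : \int[mu]_(x in `[c, d]) cos x = sin d - sin c.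
  rewrite /Rintegral (@continuous_FTC2 _ _ sin)//.
    split=> [x _||]; first exact: derivable_sin.
      by apply: cvg_at_right_filter; exact: continuous_sin.
    by apply: cvg_at_left_filter; exact: continuous_sin.
  by move=> x _; rewrite derive1E derive_val.
have e2 : \int[mu]_(x in `[c, d]) sin x = cos c - cos d.
  rewrite /Rintegral (@continuous_FTC2 _ _ (fun x => - cos x))//=.
  - by rewrite opprK addrC.
  - have dN x : derivable (fun x : R => - cos x) x 1.
      by apply: derivableN; exact: derivable_cos.
    have cN x : {for x, continuous (fun x : R => - cos x)}.
      by apply: continuousN; exact: continuous_cos.
    split=> [x _||]; first exact: dN.
      by apply: cvg_at_right_filter; exact: cN.
    by apply: cvg_at_left_filter; exact: cN.
  - by move=> x _; rewrite derive1E deriveN ?derive_val ?opprK//; exact: derivable_cos.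
by apply: eqC; rewrite /cintegral ?ReM ?ImM /= ?e1 ?e2; ring.
Qed.

Lemma cis_lipschitz c d : c <= d -> normc (cis d - cis c) <= d - c.
Proof.
move=> cd; rewrite -cintegral_cis// normcM normci mul1r -[d - c]mul1r.
apply: normc_cintegral_itv => //; first by move=> x _; exact: rcont_cis.
by move=> x _; rewrite normc_cis.
Qed.

End Paths.

(** * Goursat's lemma on polar rectangles *)

Section Goursat.
Variable R : realType.
Local Notation C := R[i].
Local Notation normc := (@Normc.normc R).
Local Notation mu := (@lebesgue_measure R).
Implicit Types (g h : C -> C).

(** The contour integral of [g z / z] along the boundary of the polar rectangle
    [a <= |z| <= b], [c <= arg z <= d]; with this form the two radial sides of
    a full turn cancel and the angular sides are circle means. *)
Definition polar_loop g (a b c d : R) : C :=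
  cintegral mu `[a, b] (fun r => (r^-1)%:C * g (r%:C * cis c)) -
  cintegral mu `[a, b] (fun r => (r^-1)%:C * g (r%:C * cis d)) +
  'i%C * (cintegral mu `[c, d] (fun x => g (b%:C * cis x)) -
        cintegral mu `[c, d] (fun x => g (a%:C * cis x))).

Lemma normc_polar (r x : R) : 0 <= r -> normc (r%:C * cis x) = r.
Proof. by move=> r0; rewrite normcM normcR normc_cis mulr1 ger0_norm. Qed.

Lemma rcont_radial g (c r : R) : 0 < r -> ccont g (r%:C * cis c) ->
  rcont (fun s => (s^-1)%:C * g (s%:C * cis c)) r.
Proof.
move=> r0 cg; have rc0 : r%:C * cis c != 0.
  by rewrite -normc_eq0 normc_polar ?ltW// gt_eqF.
have cG : ccont (fun z => cis c * z^-1 * g z) (r%:C * cis c).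
  apply: ccontM => //; apply: derivable_ccont; apply: holoM.
    exact: holo_cst.
  by apply: holoV => //; exact: holo_id.
have cr : rcont (fun s : R => s%:C * cis c) r.
  move=> e e0; exists e => // y ye.
  by rewrite -mulrBl normcM normc_cis mulr1 -rmorphB normcR.
apply: eq_rcont (rcont_comp cG cr) => s /=.
by rewrite invfM mulrCA mulfV ?cis_neq0// mulr1 fmorphV.
Qed.

Lemma rcont_angular g (r x : R) : ccont g (r%:C * cis x) ->
  rcont (fun y => g (r%:C * cis y)) x.
Proof.
move=> cg; apply: (rcont_comp cg).
have cM : ccont (fun z => r%:C * z) (cis x).
  by apply: derivable_ccont; apply: holoM; [exact: holo_cst|exact: holo_id].
exact: rcont_comp cM (rcont_cis x).
Qed.

Section PolarLoop.
Variables (a b c d : R).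
Hypotheses (a0 : 0 < a) (ab : a <= b) (cd : c <= d).

Let polar_norm r x : a <= r <= b -> a <= normc (r%:C * cis x) <= b.
Proof.
by move=> /andP[ar rb]; rewrite normc_polar ?ar// (le_trans (ltW a0)).
Qed.

Let radialc g : (forall z, a <= normc z <= b -> ccont g z) -> forall x r,
  a <= r <= b -> rcont (fun s => (s^-1)%:C * g (s%:C * cis x)) r.
Proof.
move=> cg x r rab; apply: rcont_radial.
  by move: rab => /andP[ar _]; exact: lt_le_trans ar.
by apply: cg; exact: polar_norm.
Qed.

Let angularc g : (forall z, a <= normc z <= b -> ccont g z) -> forall r x,
  a <= r <= b -> rcont (fun y => g (r%:C * cis y)) x.
Proof. by move=> cg r x rab; apply: rcont_angular; apply: cg; exact: polar_norm. Qed.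

Let aab : a <= a <= b. Proof. by rewrite lexx ab. Qed.
Let bab : a <= b <= b. Proof. by rewrite lexx ab. Qed.

Lemma polar_loop_quarter g m n : (forall z, a <= normc z <= b -> ccont g z) ->
  a <= m <= b -> c <= n <= d ->
  polar_loop g a b c d = polar_loop g a m c n + polar_loop g m b c n +
    (polar_loop g a m n d + polar_loop g m b n d).
Proof.
move=> cg mab /andP[cn nd]; have /andP[am mb] := mab.
have rad x : cintegral mu `[a, b] (fun r => (r^-1)%:C * g (r%:C * cis x)) =
    cintegral mu `[a, m] (fun r => (r^-1)%:C * g (r%:C * cis x)) +
    cintegral mu `[m, b] (fun r => (r^-1)%:C * g (r%:C * cis x)).
  by apply: cintegral_split => // r; exact: radialc.
have ang r : a <= r <= b -> cintegral mu `[c, d] (fun x => g (r%:C * cis x)) =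
    cintegral mu `[c, n] (fun x => g (r%:C * cis x)) +
    cintegral mu `[n, d] (fun x => g (r%:C * cis x)).
  by move=> rab; apply: cintegral_split => // x _; exact: angularc.
by rewrite /polar_loop !rad !ang//; ring.
Qed.

Lemma polar_loopB g h : (forall z, a <= normc z <= b -> ccont g z) ->
  (forall z, a <= normc z <= b -> ccont h z) ->
  polar_loop (fun z => g z - h z) a b c d =
  polar_loop g a b c d - polar_loop h a b c d.
Proof.
move=> cg ch; rewrite /polar_loop.
have rad x : cintegral mu `[a, b]
      (fun r => (r^-1)%:C * (g (r%:C * cis x) - h (r%:C * cis x))) =
    cintegral mu `[a, b] (fun r => (r^-1)%:C * g (r%:C * cis x)) -
    cintegral mu `[a, b] (fun r => (r^-1)%:C * h (r%:C * cis x)).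
  rewrite -cintegralB//; try by apply: rcont_cintegrable => r; exact: radialc.
  by apply: eq_cintegral => r _; rewrite mulrBr.
have ang r : a <= r <= b ->
    cintegral mu `[c, d] (fun x => g (r%:C * cis x) - h (r%:C * cis x)) =
    cintegral mu `[c, d] (fun x => g (r%:C * cis x)) -
    cintegral mu `[c, d] (fun x => h (r%:C * cis x)).
  by move=> rab; rewrite cintegralB//; apply: rcont_cintegrable => x _;
     exact: angularc.
by rewrite !rad !ang//; ring.
Qed.

Lemma cintegral_cst (u v : R) (k : C) : u <= v ->
  cintegral mu `[u, v] (fun=> k) = k * (v - u)%:C.
Proof.
move=> uv; have -> : v - u = fine (mu `[u, v]%classic).
  rewrite lebesgue_measure_itv /= lte_fin.
  by case: ltP => //= vu; apply/eqP; rewrite subr_eq0 eq_le uv vu.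
by rewrite /cintegral !Rintegral_cst//; apply: eqC;
  rewrite ?ReM ?ImM /= ?mulr0 ?subr0 ?add0r.
Qed.

Lemma polar_loop_affine (k l : C) :
  polar_loop (fun z => k + l * z) a b c d = 0.
Proof.
have cg z : a <= normc z <= b -> ccont (fun w : C => k + l * w) z.
  move=> _; apply: derivable_ccont; apply: holoD; first exact: holo_cst.
  by apply: holoM; [exact: holo_cst|exact: holo_id].
have irad x : cintegrable mu `[a, b]
    (fun r => (r^-1)%:C * (k + l * (r%:C * cis x))).
  by apply: rcont_cintegrable => r; exact: (radialc cg).
have iang r : a <= r <= b -> cintegrable mu `[c, d]
    (fun x => k + l * (r%:C * cis x)).
  by move=> rab; apply: rcont_cintegrable => x _; exact: (angularc cg).
rewrite /polar_loop -!cintegralB//; try exact: irad; try exact: iang.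
transitivity (l * (cis c - cis d) * (b - a)%:C +
    'i%C * (l * (b - a)%:C * cintegral mu `[c, d] (@cis R))).
  congr (_ + 'i%C * _).
    rewrite -cintegral_cst//; apply: eq_cintegral => r.
    rewrite /= in_itv /= => /andP[ar _].
    have r0 : r%:C != 0 :> C.
      by rewrite -normc_eq0 normcR normr_eq0 gt_eqF// (lt_le_trans a0).
    by rewrite fmorphV /=; field.
  rewrite -cintegralZl//; last first.
    by apply: rcont_cintegrable => x _; exact: rcont_cis.
  by apply: eq_cintegral => x _; rewrite rmorphB/=; ring.
by rewrite mulrCA cintegral_cis//; ring.
Qed.

Lemma normc_polar_loop g (M : R) : (forall z, a <= normc z <= b -> ccont g z) ->
  (forall r x, a <= r <= b -> c <= x <= d -> normc (g (r%:C * cis x)) <= M) ->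
  normc (polar_loop g a b c d) <= 2 * M * ((b - a) / a + (d - c)).
Proof.
move=> cg gM.
have M0 : 0 <= M.
  by apply: le_trans (normc_ge0 _) (gM a c _ _); rewrite lexx ?ab ?cd.
have rad x : c <= x <= d ->
    normc (cintegral mu `[a, b] (fun r => (r^-1)%:C * g (r%:C * cis x))) <=
    (a^-1 * M) * (b - a).
  move=> xcd; apply: normc_cintegral_itv => // r rab; first exact: radialc.
  have /andP[ar _] := rab; have r0 := lt_le_trans a0 ar.
  rewrite normcM normcR ger0_norm ?invr_ge0 ?(ltW r0)//.
  by apply: ler_pM; rewrite ?invr_ge0 ?normc_ge0 ?(ltW r0) ?lef_pV2//; exact: gM.
have ang r : a <= r <= b ->
    normc (cintegral mu `[c, d] (fun x => g (r%:C * cis x))) <= M * (d - c).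
  move=> rab; apply: normc_cintegral_itv => // x xcd; first exact: angularc.
  exact: gM.
have cc : c <= c <= d by rewrite lexx.
have dd : c <= d <= d by rewrite lexx cd.
apply: (le_trans (normcD _ _)); rewrite [normc ('i%C * _)]normcM normci mul1r.
apply: (le_trans (lerD (normcD _ _) (normcD _ _))); rewrite !normcN'.
have := rad _ cc; have := rad _ dd; have := ang _ aab; have := ang _ bab.
set x1 := normc _; set x2 := normc _; set x3 := normc _; set x4 := normc _.
have -> : 2 * M * ((b - a) / a + (d - c)) =
  a^-1 * M * (b - a) + a^-1 * M * (b - a) + (M * (d - c) + M * (d - c)) by ring.
lra.
Qed.

End PolarLoop.

(** Goursat's lemma: on a small polar rectangle around [z0] the integrand is
    affine up to an error small compared with the diameter, affine functions
    integrate to zero, and the remaining bound, quadratic in the diameter, is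
    inherited from quarters. *)
Lemma goursat g a b c d : 0 < a -> a <= b -> c <= d ->
  (forall z, a <= normc z <= b -> derivable g z 1) ->
  polar_loop g a b c d = 0.
Proof.
move=> a0 ab cd dg.
have cg z : a <= normc z <= b -> ccont g z by move=> /dg /derivable_ccont.
suff H : forall e : R, 0 < e ->
    normc (polar_loop g a b c d) <= e * ((b - a) + (d - c)) ^+ 2.
  apply/eqP; rewrite -normc_eq0; apply/eqP/le_anti; rewrite normc_ge0 andbT.
  set S := _ ^+ 2 in H; have S0 : 0 <= S by rewrite sqr_ge0.
  apply/ler_addgt0Pl => e e0; rewrite addr0.
  have eS : 0 < e / (S + 1) by rewrite divr_gt0// ltr_wpDl.
  apply: (le_trans (H _ eS)); rewrite mulrAC ler_pdivrMr ?ltr_wpDl//.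
  by rewrite ler_pM2l// lerDl.
move=> e e0.
apply: (@bisection2 R (fun a b c d =>
  normc (polar_loop g a b c d) <= e * ((b - a) + (d - c)) ^+ 2)) => //.
  move=> a' b' c' d' aa' ab' bb' cc' cd' dd' h1 h2 h3 h4.
  have a'0 := lt_le_trans a0 aa'.
  have cg' z : a' <= normc z <= b' -> ccont g z.
    by move=> /andP[z1 z2]; apply: cg; rewrite (le_trans aa' z1) (le_trans z2 bb').
  have hm : a' <= (a' + b') / 2 <= b' by rewrite !(midf_le ab').
  have hn : c' <= (c' + d') / 2 <= d' by rewrite !(midf_le cd').
  rewrite (polar_loop_quarter a'0 ab' cg' hm hn).
  apply: (le_trans (normcD _ _)).
  apply: (le_trans (lerD (normcD _ _) (normcD _ _))).
  apply: (le_trans (lerD (lerD h1 h2) (lerD h3 h4))).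
  by rewrite [X in X <= _](_ : _ = e * ((b' - a') + (d' - c')) ^+ 2)//; field.
move=> r x rab xcd; have /andP[ar rb] := rab.
have r0 := lt_le_trans a0 ar; have b0 := lt_le_trans r0 rb.
(* [1 + b] relates distances to the perimeter [s], and [a^-1 + 1] bounds the
   length of the contour for the form [dz / z] *)
pose K := 2 * (1 + b) * (a^-1 + 1).
have K0 : 0 < K by rewrite /K !mulr_gt0// ?addr_gt0// invr_gt0.
have : derivable g (r%:C * cis x) 1 by apply: dg; rewrite normc_polar// ltW.
move=> /derivable_normcP[l hl].
have [del del0 hdel] := hl (e / K) (divr_gt0 e0 K0).
have b1 : 0 < 1 + b by rewrite ltr_wpDl.
exists (del / (2 * (1 + b))); first by rewrite divr_gt0// mulr_gt0.
move=> a' b' c' d' aa' ar' rb' bb' cc' cx xd dd' ba dc.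
have a'0 := lt_le_trans a0 aa'; have ab' := le_trans ar' rb'.
have cd' := le_trans cx xd.
set s := (b' - a') + (d' - c').
have s0 : 0 <= s by rewrite /s; lra.
set z0 := r%:C * cis x in hl hdel *.
have dist r' x' : a' <= r' <= b' -> c' <= x' <= d' ->
    normc (r'%:C * cis x' - z0) <= (1 + b) * s.
  move=> /andP[r1 r2] /andP[x1 x2].
  have -> : r'%:C * cis x' - z0 = (r' - r)%:C * cis x' + r%:C * (cis x' - cis x).
    by rewrite /z0 rmorphB /=; ring.
  apply: (le_trans (normcD _ _)); rewrite !normcM !normcR normc_cis mulr1.
  have h1 : `|r' - r| <= b' - a' by rewrite ler_norml; lra.
  have h2 : normc (cis x' - cis x) <= d' - c'.
    case: (leP x x') => xx'.
      by apply: (le_trans (cis_lipschitz xx')); lra.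
    by rewrite normcB; apply: (le_trans (cis_lipschitz (ltW xx'))); lra.
  have h3 : `|r| * normc (cis x' - cis x) <= b * (d' - c').
    by rewrite (ger0_norm (ltW r0)); apply: ler_pM; rewrite ?normc_ge0// ltW.
  rewrite mulrDl mul1r; apply: lerD; first by rewrite /s; lra.
  by apply: (le_trans h3); rewrite ler_pM2l// /s; lra.
have sdel : (1 + b) * s < del.
  have : s < del / (2 * (1 + b)) + del / (2 * (1 + b)) by rewrite /s ltrD.
  have -> : del / (2 * (1 + b)) + del / (2 * (1 + b)) = del / (1 + b).
    by field; rewrite gt_eqF.
  by rewrite ltr_pdivlMr// mulrC.
have cg' z : a' <= normc z <= b' -> ccont g z.
  by move=> /andP[z1 z2]; apply: cg; rewrite (le_trans aa' z1) (le_trans z2 bb').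
pose aff z := (g z0 - l * z0) + l * z.
have caff z : a' <= normc z <= b' -> ccont aff z.
  move=> _; apply: derivable_ccont; apply: holoD; first exact: holo_cst.
  by apply: holoM; [exact: holo_cst|exact: holo_id].
rewrite -[polar_loop _ _ _ _ _]subr0 -(@polar_loop_affine a' b' c' d' a'0 ab' cd' (g z0 - l * z0) l).
rewrite -(polar_loopB c' d' a'0 ab' cg' caff).
have crem z : a' <= normc z <= b' -> ccont (fun w => g w - aff w) z.
  move=> h; apply: derivable_ccont; apply: holoB.
    by apply: dg; move: h => /andP[z1 z2]; rewrite (le_trans aa' z1) (le_trans z2 bb').
  apply: holoD; first exact: holo_cst.
  by apply: holoM; [exact: holo_cst|exact: holo_id].
apply: (le_trans (normc_polar_loop (M := e / K * ((1 + b) * s)) a'0 ab' cd' crem _)).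
  move=> r' x' hr hx; have hd := dist _ _ hr hx.
  have := hdel _ (le_lt_trans hd sdel).
  have -> : g (r'%:C * cis x') - g z0 - l * (r'%:C * cis x' - z0) =
    g (r'%:C * cis x') - aff (r'%:C * cis x') by rewrite /aff; ring.
  move=> h; apply: (le_trans h); rewrite ler_pM2l// divr_gt0//.
have h1 : (b' - a') / a' + (d' - c') <= (a^-1 + 1) * s.
  have h2 : (b' - a') / a' <= (b' - a') * a^-1.
    by apply: ler_wpM2l; [lra|rewrite lef_pV2].
  have a10 : 0 <= a^-1 by rewrite invr_ge0 ltW.
  have h3 : 0 <= a^-1 * (d' - c') by apply: mulr_ge0; lra.
  have -> : (a^-1 + 1) * s =
      (b' - a') * a^-1 + a^-1 * (d' - c') + (b' - a') + (d' - c').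
    by rewrite /s; ring.
  have h4 : 0 <= b' - a' by rewrite subr_ge0.
  by rewrite lerD2r -addrA; apply: (le_trans h2); rewrite lerDl addr_ge0.
apply: (le_trans (ler_wpM2l _ h1)).
  have eK : 0 <= e / K by rewrite divr_ge0// ltW.
  by rewrite mulr_ge0 ?ler0n// mulr_ge0// mulr_ge0// (ltW b1).
rewrite [X in X <= _](_ : _ = e * s ^+ 2)// /K; field.
by rewrite (gt_eqF a0) (gt_eqF b1) (gt_eqF (addr_gt0 ltr01 a0)).
Qed.

End Goursat.

(** * Mean value property, Cauchy and Schwarz formulas on a disc *)

Section CircleMean.
Variable R : realType.
Local Notation C := R[i].
Local Notation normc := (@Normc.normc R).
Local Notation mu := (@lebesgue_measure R).
Local Notation pi := (@pi R).
Implicit Types (g h : C -> C) (r : R).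

Definition circle_mean g r : C :=
  cintegral mu `[- pi, pi] (fun x => g (r%:C * cis x)).

Let Npipi : - pi <= pi. Proof. by rewrite ge0_cp ?pi_ge0. Qed.

(** Goursat's lemma on a full turn: the two radial sides lie on the same
    half-line and cancel. *)
Lemma circle_mean_holo g a b : 0 < a -> a <= b ->
  (forall z, a <= normc z <= b -> derivable g z 1) ->
  circle_mean g a = circle_mean g b.
Proof.
move=> a0 ab dg; have := goursat a0 ab Npipi dg.
rewrite /polar_loop cis_pi subrr add0r => /eqP.
rewrite mulf_eq0 subr_eq0 => /orP[/eqP i0|/eqP/esym//].
by have := normci R; rewrite i0 normc0 => /eqP; rewrite eq_sym oner_eq0.
Qed.

Lemma rcont_circle g r x : 0 <= r -> (forall z, normc z = r -> ccont g z) ->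
  rcont (fun y => g (r%:C * cis y)) x.
Proof. by move=> r0 cg; apply: rcont_angular; apply: cg; exact: normc_polar. Qed.

Lemma cis_lip (x y : R) : normc (cis x - cis y) <= `|x - y|.
Proof.
have [xy|/ltW xy] := leP x y.
- by rewrite normcB distrC ger0_norm ?subr_ge0// cis_lipschitz.
- by rewrite ger0_norm ?subr_ge0// cis_lipschitz.
Qed.

(** Joint continuity along a whole circle is uniform in the angle; bisection
    of the range of angles replaces a compactness argument. *)
Lemma circle_uniform_cont g r0 : 0 <= r0 ->
  (forall z, normc z = r0 -> ccont g z) -> forall e, 0 < e ->
  exists2 d, 0 < d & forall r x, `|r - r0| < d -> - pi <= x <= pi ->
    normc (g (r%:C * cis x) - g (r0%:C * cis x)) <= e.
Proof.
move=> r00 cg e e0.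
apply: (@bisection2 R (fun _ _ c d => exists2 del, 0 < del &
  forall r x, `|r - r0| < del -> c <= x <= d ->
    normc (g (r%:C * cis x) - g (r0%:C * cis x)) <= e) 0 0 (- pi) pi) => //.
  move=> a b c d _ _ _ _ _ _ [d1 d10 h1] _ [d2 d20 h2] _.
  exists (Num.min d1 d2); first by rewrite lt_min d10.
  move=> r x; rewrite lt_min => /andP[rd1 rd2] /andP[cx xd].
  have [xm|/ltW mx] := leP x ((c + d) / 2).
  - by apply: h1 => //; rewrite cx.
  - by apply: h2 => //; rewrite mx.
move=> x0 y _ _; have [d d0 hd] := cg _ (normc_polar y r00) _ (divr_gt0 e0 (ltr0Sn _ 1)).
have k0 : 0 < 1 + r0 by rewrite ltr_pwDl.
exists (d / (1 + r0)); first by rewrite divr_gt0.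
move=> a' b' c' d' _ _ _ _ _ cy yd _ _ dc.
exists (d / (1 + r0)); first by rewrite divr_gt0.
move=> r x rr0 /andP[cx xd].
have xy : `|x - y| < d / (1 + r0).
  by apply: (le_lt_trans _ dc); rewrite ler_norml; lra.
have near s : `|s - r0| < d / (1 + r0) -> normc (s%:C * cis x - r0%:C * cis y) < d.
  move=> sr0; have -> : s%:C * cis x - r0%:C * cis y =
    (s - r0)%:C * cis x + r0%:C * (cis x - cis y) by rewrite rmorphB /=; ring.
  apply: (le_lt_trans (normcD _ _)); rewrite !normcM !normcR normc_cis mulr1.
  rewrite (ger0_norm r00).
  apply: (@le_lt_trans _ _ (`|s - r0| + r0 * (d / (1 + r0)))).
    by rewrite lerD2l ler_wpM2l// (le_trans (cis_lip _ _))// ltW.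
  rewrite [ltRHS](_ : _ = d / (1 + r0) + r0 * (d / (1 + r0))); last first.
    by field; rewrite gt_eqF.
  by rewrite ltrD2r.
have := hd _ (near _ rr0); have : `|r0 - r0| < d / (1 + r0).
  by rewrite subrr normr0 divr_gt0.
move=> /near /hd h2 h1.
have -> : g (r%:C * cis x) - g (r0%:C * cis x) =
  (g (r%:C * cis x) - g (r0%:C * cis y)) - (g (r0%:C * cis x) - g (r0%:C * cis y)).
  by ring.
by apply: (le_trans (normcD _ _)); rewrite normcN' (splitr e) ltW// ltrD.
Qed.

Lemma circle_mean_cont g r0 : 0 <= r0 ->
  (forall z, normc z = r0 -> ccont g z) -> forall e, 0 < e ->
  exists2 d, 0 < d & forall r, 0 <= r -> `|r - r0| < d ->
    (forall z, normc z = r -> ccont g z) ->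
    normc (circle_mean g r - circle_mean g r0) <= e.
Proof.
move=> r00 cg e e0; have p0 : 0 < pi - - pi by rewrite opprK addr_gt0 ?pi_gt0.
have [d d0 hd] := circle_uniform_cont r00 cg (divr_gt0 e0 p0).
exists d => // r rge0 rd cgr; rewrite /circle_mean -cintegralB//;
  try by apply: rcont_cintegrable => x _; exact: rcont_circle.
rewrite -[leRHS](divfK (lt0r_neq0 p0)); apply: normc_cintegral_itv => //.
  move=> x _; have := rcont_circle x r00 cg; have := rcont_circle x rge0 cgr.
  move=> c1 c2 e' e'0; have [d1 d10 h1] := c1 _ (divr_gt0 e'0 (ltr0Sn _ 1)).
  have [d2 d20 h2] := c2 _ (divr_gt0 e'0 (ltr0Sn _ 1)).
  exists (Num.min d1 d2); first by rewrite lt_min d10.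
  move=> y; rewrite lt_min => /andP[/h1 h1' /h2 h2'].
  rewrite opprB addrACA [_ + g (r0%:C * cis x)]addrC.
  rewrite [X in normc X](_ : _ = (g (r%:C * cis y) - g (r%:C * cis x)) -
    (g (r0%:C * cis y) - g (r0%:C * cis x))); last by ring.
  by apply: (le_lt_trans (normcD _ _)); rewrite normcN' (splitr e') ltrD.
by move=> x xpi; exact: hd.
Qed.

Lemma circle_mean0 g : circle_mean g 0 = (2 * pi)%:C * g 0.
Proof.
rewrite /circle_mean (_ : 2 * pi = pi - - pi); last by ring.
rewrite mulrC -cintegral_cst//; apply: eq_cintegral => x _.
by rewrite mul0r.
Qed.

(** The mean value property survives on a disc when differentiability fails on
    one circle [|z| = r0] but continuity does not: the circle means are locally
    constant off [r0] and continuous everywhere. *)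
Lemma mean_value g r0 Rad r : 0 <= r0 ->
  (forall z, normc z < Rad -> ccont g z) ->
  (forall z, normc z < Rad -> normc z != r0 -> derivable g z 1) ->
  0 <= r -> r < Rad -> circle_mean g r = (2 * pi)%:C * g 0.
Proof.
move=> r00 cg dg rge0 rR; rewrite -circle_mean0.
have cgr s : s < Rad -> forall z, normc z = s -> ccont g z.
  by move=> sR z zs; apply: cg; rewrite zs.
have const a b : 0 < a -> a <= b -> b < Rad -> b < r0 \/ r0 < a ->
    circle_mean g a = circle_mean g b.
  move=> a0 ab bR h; apply: circle_mean_holo => // z /andP[az zb].
  apply: dg; first exact: le_lt_trans bR.
  by case: h => h; [rewrite lt_eqF// (le_lt_trans zb)|rewrite gt_eqF// (lt_le_trans h)].
have close s : 0 <= s -> s < Rad -> (forall e, 0 < e ->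
    normc (circle_mean g s - circle_mean g 0) <= e) -> circle_mean g s = circle_mean g 0.
  move=> s0 sR h; apply/eqP; rewrite -subr_eq0 -normc_eq0; apply/eqP/le_anti.
  by rewrite normc_ge0 andbT; apply/ler_addgt0Pl => e e0; rewrite addr0 h.
have R0 : 0 < Rad by exact: le_lt_trans rR.
have inner s : 0 <= s -> s < r0 -> s < Rad -> circle_mean g s = circle_mean g 0.
  rewrite le_eqVlt => /predU1P[<-//|s0] sr0 sR; apply: close => // [|e e0].
    exact: ltW.
  have [d d0 hd] := circle_mean_cont (lexx 0) (cgr _ R0) e0.
  pose a := Num.min s (d / 2).
  have a0 : 0 < a by rewrite lt_min s0 divr_gt0.
  have as_ : a <= s by rewrite ge_min lexx.
  have ad : a < d.
    apply: (@le_lt_trans _ _ (d / 2)); first by rewrite ge_min lexx orbT.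
    by rewrite ltr_pdivrMr// mulr_natr mulr2n ltrDr.
  rewrite -(const a s)//; last by left.
  apply: hd; rewrite ?subr0 ?(ltW a0) ?ger0_norm ?(ltW a0)//.
  by apply: cgr; exact: le_lt_trans sR.
have mid : r0 < Rad -> circle_mean g r0 = circle_mean g 0.
  move: r00; rewrite le_eqVlt => /predU1P[<-//|r0gt0] r0R; apply: close => //.
    exact: ltW.
  move=> e e0; have [d d0 hd] := circle_mean_cont (ltW r0gt0) (cgr _ r0R) e0.
  pose s := Num.max (r0 / 2) (r0 - d / 2).
  have s0 : 0 < s by rewrite lt_max divr_gt0.
  have sr0 : s < r0 by rewrite gt_max; apply/andP; split; lra.
  have sR : s < Rad by exact: lt_trans r0R.
  have rs : `|s - r0| < d.
    rewrite ltr0_norm ?subr_lt0//; have : r0 - d / 2 <= s by rewrite le_max lexx orbT.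
    by move=> h; lra.
  rewrite -(inner s)// ?(ltW s0)// normcB; apply: hd => //; first exact: ltW.
  exact: cgr.
have [rr0|r0r|rr0] := ltgtP r r0; [exact: inner| |by rewrite rr0; apply: mid; rewrite -rr0].
have r0R : r0 < Rad by exact: lt_trans rR.
rewrite -mid//; apply/eqP; rewrite -subr_eq0 -normc_eq0; apply/eqP/le_anti.
rewrite normc_ge0 andbT; apply/ler_addgt0Pl => e e0; rewrite addr0.
have [d d0 hd] := circle_mean_cont r00 (cgr _ r0R) e0.
pose s := Num.min r (r0 + d / 2).
have r0s : r0 < s by rewrite lt_min r0r; lra.
have sr : s <= r by rewrite ge_min lexx.
have rs : `|s - r0| < d.
  rewrite gtr0_norm ?subr_gt0//; have : s <= r0 + d / 2 by rewrite ge_min lexx orbT.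
  by move=> h; lra.
rewrite -(const s r)//; [|exact: le_lt_trans r0s|by right].
apply: hd => //; first by rewrite ltW// (le_lt_trans r00).
by apply: cgr; exact: le_lt_trans rR.
Qed.

Lemma mean_value_holo g Rad r : (forall z, normc z < Rad -> derivable g z 1) ->
  0 <= r -> r < Rad -> circle_mean g r = (2 * pi)%:C * g 0.
Proof.
move=> dg; apply: (@mean_value _ 0) => //.
  by move=> z /dg/derivable_ccont.
by move=> z /dg.
Qed.

End CircleMean.

Section Cauchy.
Variable R : realType.
Local Notation C := R[i].
Local Notation normc := (@Normc.normc R).
Local Notation mu := (@lebesgue_measure R).
Local Notation pi := (@pi R).
Implicit Types (g h : C -> C) (r : R) (w z : C).

Lemma conjcM z w : (z * w)^*%C = z^*%C * w^*%C.
Proof. exact: rmorphM. Qed.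

Lemma conjcB z w : (z - w)^*%C = z^*%C - w^*%C.
Proof. exact: rmorphB. Qed.

Lemma conjcV z : (z^-1)^*%C = (z^*%C)^-1.
Proof. exact: fmorphV. Qed.

(** On [|z| = r] the kernel [z / (z - w)] is conjugate to a function that is
    holomorphic inside the circle. *)
Definition conj_kernel r w z : C := (r ^+ 2)%:C / ((r ^+ 2)%:C - w^*%C * z).

Lemma conj_kernelE r w x : 0 < r -> normc w < r ->
  (r%:C * cis x) / (r%:C * cis x - w) = (conj_kernel r w (r%:C * cis x))^*%C.
Proof.
move=> r0 wr; set z := r%:C * cis x.
have zz : (r ^+ 2)%:C = z * z^*%C.
  by rewrite -sqr_normc normcE' normc_polar ?ltW// rmorphXn.
have z0 : z != 0 by rewrite -normc_eq0 normc_polar ?ltW// gt_eqF.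
have zw : z - w != 0.
  rewrite subr_eq0; apply: contraTneq wr => <-.
  by rewrite normc_polar ?ltW// ltxx.
have zc0 : z^*%C != 0 by rewrite conjc_eq0.
rewrite /conj_kernel conjcM. rewrite conjcV conjcB conjcM conjcK.
have -> : ((r ^+ 2)%:C)^*%C = (r ^+ 2)%:C by rewrite conjc_real.
rewrite zz -mulrBl invfM mulrACA mulfV// mulr1.
by [].
Qed.

Definition conj_radius r w : R := r ^+ 2 / ((normc w + r) / 2).

Lemma conj_radius_gt r w : 0 < r -> normc w < r -> r < conj_radius r w.
Proof.
move=> r0 wr; have w0 := normc_ge0 w.
have m0 : 0 < (normc w + r) / 2 by rewrite divr_gt0// ltr_wpDl.
rewrite /conj_radius ltr_pdivlMr// expr2 ltr_pM2l//; lra.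
Qed.

Lemma conj_kernel_holo r w z : 0 < r -> normc w < r ->
  normc z < conj_radius r w -> derivable (conj_kernel r w) z 1.
Proof.
move=> r0 wr zR; have w0 := normc_ge0 w.
have m0 : 0 < (normc w + r) / 2 by rewrite divr_gt0// ltr_wpDl.
apply: holoM; first exact: holo_cst.
apply: holoV; last first.
  apply: holoB; first exact: holo_cst.
  by apply: holoM; [exact: holo_cst|exact: holo_id].
rewrite subr_eq0; apply: contraTneq zR => /(congr1 normc).
rewrite normcR ger0_norm ?sqr_ge0// [normc (_ * z)]normcM normcJ' => e.
rewrite -leNgt /conj_radius e.
rewrite ler_pdivrMr// mulrC ler_wpM2l ?normc_ge0//; lra.
Qed.

Lemma mean_kernel r w : 0 < r -> normc w < r ->
  circle_mean (fun z => z / (z - w)) r = (2 * pi)%:C.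
Proof.
move=> r0 wr; rewrite /circle_mean.
have dk := conj_kernel_holo r0 wr; have rR := conj_radius_gt r0 wr.
transitivity (circle_mean (conj_kernel r w) r)^*%C.
  rewrite /circle_mean -cintegral_conj//; last first.
    apply: rcont_cintegrable => x _; apply: rcont_circle; first exact: ltW.
    by move=> z zr; apply: derivable_ccont; apply: dk; rewrite zr.
  by apply: eq_cintegral => x _; rewrite conj_kernelE.
rewrite (mean_value_holo dk) ?(ltW r0)// /conj_kernel mulr0 subr0 mulfV.
  by rewrite mulr1 conjc_real.
by rewrite -normc_eq0 normcR normr_eq0 sqrf_eq0 gt_eqF.
Qed.

(** Cauchy's formula, as the mean value property of
    [z (h z - h w) / (z - w)], which extends continuously to [z = w]. *)
Lemma cauchy_formula h Rad r w : (forall z, normc z < Rad -> derivable h z 1) ->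
  normc w < r -> r < Rad ->
  circle_mean (fun z => h z * (z / (z - w))) r = (2 * pi)%:C * h w.
Proof.
move=> dh wr rR; have r0 : 0 < r by exact: le_lt_trans (normc_ge0 w) wr.
have wR := lt_trans wr rR.
have /derivable_normcP[l hl] := dh w wR.
pose g z := if z == w then l * w else (h z - h w) * (z / (z - w)).
have dg z : normc z < Rad -> z != w -> derivable g z 1.
  move=> zR zw; apply: (@eq_holo _ (fun z => (h z - h w) * (z / (z - w))) _ _ (normc (z - w))).
  - by rewrite normc_gt0 subr_eq0.
  - move=> u uz; rewrite /g; case: eqVneq => // uw; move: uz.
    by rewrite uw normcB ltxx.
  - apply: holoM; first by apply: holoB; [exact: dh|exact: holo_cst].
    apply: holoM; first exact: holo_id.
    by apply: holoV; [rewrite subr_eq0|apply: holoB; [exact: holo_id|exact: holo_cst]].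
have cgw : ccont g w.
  move=> e e0; pose K := normc w + 1 + normc l.
  have K0 : 0 < K by rewrite /K -addrA ltr_wpDl ?normc_ge0// ltr_pwDl ?normc_ge0.
  have [d d0 hd] := hl (e / (2 * K)) (divr_gt0 e0 (mulr_gt0 (ltr0Sn _ 1) K0)).
  exists (Num.min d (Num.min 1 (e / (2 * K)))).
    by rewrite !lt_min d0 ltr01 divr_gt0// mulr_gt0.
  move=> z; rewrite !lt_min => /and3P[zd z1 ze].
  rewrite /g eqxx; case: eqVneq => [_|zw]; first by rewrite subrr normc0.
  have zw0 : z - w != 0 by rewrite subr_eq0.
  have -> : (h z - h w) * (z / (z - w)) - l * w =
      (h z - h w - l * (z - w)) / (z - w) * z + l * (z - w) by field.
  apply: (le_lt_trans (normcD _ _)); rewrite !normcM normcV.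
  apply: (@le_lt_trans _ _ (e / (2 * K) * (normc w + 1) + normc l * (e / (2 * K)))).
    apply: lerD; last by rewrite ler_wpM2l ?normc_ge0// ltW.
    apply: ler_pM; rewrite ?normc_ge0 ?mulr_ge0 ?invr_ge0 ?normc_ge0//.
      by rewrite ler_pdivrMr ?normc_gt0//; exact: hd.
    rewrite -[z](subrK w) addrC; apply: (le_trans (normcD _ _)).
    by rewrite lerD2l ltW.
  have -> : e / (2 * K) * (normc w + 1) + normc l * (e / (2 * K)) = e / 2.
    by rewrite mulrC [normc l * _]mulrC [_ * (e / _)]mulrC -mulrDr -/K; field; rewrite gt_eqF.
  lra.
have cg z : normc z < Rad -> ccont g z.
  by move=> zR; have [->//|zw] := eqVneq z w; apply: derivable_ccont; exact: dg.
have gm : circle_mean g r = 0.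
  rewrite (@mean_value _ g (normc w) Rad r) ?normc_ge0 ?(ltW r0)//.
    rewrite /g; case: eqVneq => [<-|_]; first by rewrite !mulr0.
    by rewrite mul0r !mulr0.
  by move=> z zR zw; apply: dg => //; apply: contraNneq zw => ->.
have zw0 z : normc z = r -> z - w != 0.
  by move=> zr; rewrite subr_eq0; apply: contraTneq wr => <-; rewrite zr ltxx.
have ck z : normc z = r -> ccont (fun z => z / (z - w)) z.
  move=> zr; apply: derivable_ccont; apply: holoM; first exact: holo_id.
  by apply: holoV; [exact: zw0|apply: holoB; [exact: holo_id|exact: holo_cst]].
have ch z : normc z = r -> ccont h z.
  by move=> zr; apply: derivable_ccont; apply: dh; rewrite zr.
have ik : cintegrable mu `[- pi, pi] (fun x => r%:C * cis x / (r%:C * cis x - w)).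
  apply: rcont_cintegrable => x _.
  exact: (@rcont_circle _ (fun z => z / (z - w)) _ _ (ltW r0) ck).
have ihk : cintegrable mu `[- pi, pi]
    (fun x => h (r%:C * cis x) * (r%:C * cis x / (r%:C * cis x - w))).
  apply: rcont_cintegrable => x _.
  apply: (@rcont_circle _ (fun z => h z * (z / (z - w))) _ _ (ltW r0)) => z zr.
  by apply: ccontM; [exact: ch|exact: ck].
have : circle_mean g r = circle_mean (fun z => h z * (z / (z - w))) r -
    h w * circle_mean (fun z => z / (z - w)) r.
  rewrite /circle_mean -cintegralZl// -cintegralB//; last exact: cintegrableZl.
  apply: eq_cintegral => x _; rewrite /g; case: eqVneq => [zw|_].
    by move: wr; rewrite -zw normc_polar ?ltxx// ltW.
  by rewrite mulrBl.
by rewrite gm mean_kernel// [_%:C * _]mulrC => /esym/eqP; rewrite subr_eq0 => /eqP.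
Qed.

(** Only the values of [h] on the circle are bounded, and the constant is
    explicit, as the identity theorem needs it for a whole family [h]. *)
Lemma cauchy_bound_itv h Rad r w (M : R) :
  (forall z, normc z < Rad -> derivable h z 1) ->
  normc w < r -> r < Rad ->
  (forall x, - pi <= x <= pi -> normc (h (r%:C * cis x)) <= M) ->
  normc (h w) <= M * (r / (r - normc w)).
Proof.
move=> dh wr rR hM; have r0 : 0 < r by exact: le_lt_trans (normc_ge0 w) wr.
have p2 : 0 < 2 * pi by rewrite mulr_gt0// pi_gt0.
have rw0 : 0 < r - normc w by rewrite subr_gt0.
rewrite -(ler_pM2l p2) -[X in X * _ <= _](ger0_norm (ltW p2)) -normcR -normcM.
rewrite -(cauchy_formula dh wr rR) mulrC (_ : 2 * pi = pi - - pi); last by ring.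
have zw0 z : normc z = r -> z - w != 0.
  by move=> zr; rewrite subr_eq0; apply: contraTneq wr => <-; rewrite zr ltxx.
apply: normc_cintegral_itv.
- by rewrite ge0_cp ?pi_ge0.
- move=> x _; apply: (@rcont_circle _ (fun z => h z * (z / (z - w))) _ _ (ltW r0)) => z zr.
  apply: derivable_ccont; apply: holoM; first by apply: dh; rewrite zr.
  apply: holoM; first exact: holo_id.
  by apply: holoV; [exact: zw0|apply: holoB; [exact: holo_id|exact: holo_cst]].
- move=> x xpi; rewrite !normcM normcV normcR normc_cis mulr1 (gtr0_norm r0).
  have zr := normc_polar x (ltW r0).
  apply: ler_pM; rewrite ?normc_ge0 ?mulr_ge0 ?invr_ge0 ?normc_ge0 ?(ltW r0)//.
    exact: hM.
  rewrite ler_pM2l// lef_pV2 ?posrE ?normc_gt0 ?zw0//.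
  rewrite lerBlDr -{1}zr -[X in normc X <= _](subrK w).
  exact: normcD.
Qed.

(** Schwarz's formula: the conjugate part of [2 Re h = h + h^*%C] has circle mean
    [h(0)^*%C] against the kernel, because conjugation turns the kernel into a
    holomorphic function equal to [1] at the centre. *)
Lemma schwarz_formula h Rad r w : (forall z, normc z < Rad -> derivable h z 1) ->
  normc w < r -> r < Rad ->
  circle_mean (fun z => (2 * complex.Re (h z))%:C * (z / (z - w))) r =
  (2 * pi)%:C * (h w + (h 0)^*%C).
Proof.
move=> dh wr rR; have r0 : 0 < r by exact: le_lt_trans (normc_ge0 w) wr.
have dk := conj_kernel_holo r0 wr; have rk := conj_radius_gt r0 wr.
have dhk z : normc z < Num.min Rad (conj_radius r w) ->
    derivable (fun z => h z * conj_kernel r w z) z 1.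
  by rewrite lt_min => /andP[z1 z2]; apply: holoM; [exact: dh|exact: dk].
have rmin : r < Num.min Rad (conj_radius r w) by rewrite lt_min rR.
have zw0 z : normc z = r -> z - w != 0.
  by move=> zr; rewrite subr_eq0; apply: contraTneq wr => <-; rewrite zr ltxx.
have i1 : cintegrable mu `[- pi, pi]
    (fun x => h (r%:C * cis x) * (r%:C * cis x / (r%:C * cis x - w))).
  apply: rcont_cintegrable => x _.
  apply: (@rcont_circle _ (fun z => h z * (z / (z - w))) _ _ (ltW r0)) => z zr.
  apply: derivable_ccont; apply: holoM; first by apply: dh; rewrite zr.
  apply: holoM; first exact: holo_id.
  by apply: holoV; [exact: zw0|apply: holoB; [exact: holo_id|exact: holo_cst]].
have i2 : cintegrable mu `[- pi, pi]
    (fun x => h (r%:C * cis x) * conj_kernel r w (r%:C * cis x)).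
  apply: rcont_cintegrable => x _.
  apply: (@rcont_circle _ (fun z => h z * conj_kernel r w z) _ _ (ltW r0)) => z zr.
  by apply: derivable_ccont; apply: dhk; rewrite zr.
rewrite mulrDr -(cauchy_formula dh wr rR).
have -> : (2 * pi)%:C * (h 0)^*%C = (circle_mean (fun z => h z * conj_kernel r w z) r)^*%C.
  rewrite (mean_value_holo dhk) ?(ltW r0)// conjcM conjc_real; congr (_ * _^*%C).
  rewrite /conj_kernel mulr0 subr0 mulfV ?mulr1//.
  by rewrite -normc_eq0 normcR normr_eq0 sqrf_eq0 gt_eqF.
rewrite /circle_mean -cintegral_conj// -cintegralD//; last exact: cintegrable_conj.
apply: eq_cintegral => x _.
rewrite conj_kernelE// [(h _ * _)^*%C]conjcM -mulrDl addcJ.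
by rewrite rmorphM /= rmorph_nat.
Qed.

End Cauchy.

(** * Stieltjes measures of nondecreasing functions *)

Section RightLimit.
Variable R : realType.
Implicit Types (F : R -> R) (x y : R).

(** A limit of distribution functions need not be right-continuous; its right
    limits are, and differ from it at countably many points only. *)
Definition right_lim F x : R := inf [set F y | y in `]x, +oo[%classic].

Lemma right_lim_has_inf F x : {homo F : x y / x <= y} ->
  has_inf [set F y | y in `]x, +oo[%classic].
Proof.
move=> ndF; split; first by exists (F (x + 1)), (x + 1) => //=;
  rewrite in_itv /= andbT ltrDl.
exists (F x) => _ [y /= + <-]; rewrite in_itv /= andbT => xy; exact/ndF/ltW.
Qed.

Lemma le_right_lim F x : {homo F : x y / x <= y} -> F x <= right_lim F x.
Proof.
move=> ndF; apply: lb_le_inf; first by have [] := right_lim_has_inf x ndF.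
by move=> _ [y /= + <-]; rewrite in_itv /= andbT => xy; exact/ndF/ltW.
Qed.

Lemma right_lim_le F x y : {homo F : x y / x <= y} -> x < y -> right_lim F x <= F y.
Proof.
move=> ndF xy; apply: ge_inf; first by have [] := right_lim_has_inf x ndF.
by exists y => //=; rewrite in_itv /= andbT.
Qed.

Lemma right_lim_adherent F x e : {homo F : x y / x <= y} -> 0 < e ->
  exists2 y, x < y & F y < right_lim F x + e.
Proof.
move=> ndF e0; have [_ [y + <-] h] := inf_adherent e0 (right_lim_has_inf x ndF).
by rewrite /= in_itv /= andbT; exists y.
Qed.

Lemma right_lim_nd F : {homo F : x y / x <= y} -> {homo right_lim F : x y / x <= y}.
Proof.
move=> ndF x y; rewrite le_eqVlt => /predU1P[->//|xy].
exact: le_trans (right_lim_le ndF xy) (le_right_lim _ ndF).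
Qed.

Lemma right_lim_rc F : {homo F : x y / x <= y} ->
  forall x, right_lim F @ at_right x --> right_lim F x.
Proof.
move=> ndF x; apply/cvgrPdist_le => e e0.
have [y xy Fy] := right_lim_adherent x ndF e0.
near=> z; have xz : x < z by near: z; exact: nbhs_right_gt.
have zy : z < y by near: z; exact: nbhs_right_lt.
have h1 := right_lim_nd ndF (ltW xz); have h2 := right_lim_le ndF zy.
by rewrite distrC ger0_norm ?subr_ge0//; lra.
Unshelve. all: by end_near. Qed.

Lemma right_limD F G x : {homo F : x y / x <= y} -> {homo G : x y / x <= y} ->
  right_lim (fun y => F y + G y) x = right_lim F x + right_lim G x.
Proof.
move=> ndF ndG; have ndFG : {homo (fun y => F y + G y) : x y / x <= y}.
  by move=> u v uv; rewrite lerD ?ndF ?ndG.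
apply/le_anti/andP; split.
  apply/ler_addgt0Pl => e e0; have e2 : 0 < e / 2 by rewrite divr_gt0.
  have [y xy Fy] := right_lim_adherent x ndF e2.
  have [z xz Gz] := right_lim_adherent x ndG e2.
  have xm : x < Num.min y z by rewrite lt_min xy.
  apply: (le_trans (right_lim_le ndFG xm)).
  have h1 : F (Num.min y z) <= F y by apply: ndF; rewrite ge_min lexx.
  have h2 : G (Num.min y z) <= G z by apply: ndG; rewrite ge_min lexx orbT.
  by rewrite (splitr e); lra.
apply: lb_le_inf; first by have [] := right_lim_has_inf x ndFG.
move=> _ [y /= + <-]; rewrite in_itv /= andbT => xy.
by rewrite lerD// right_lim_le.
Qed.

Lemma right_limZ F x c : {homo F : x y / x <= y} -> 0 <= c ->
  right_lim (fun y => c * F y) x = c * right_lim F x.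
Proof.
move=> ndF c0; have ndcF : {homo (fun y => c * F y) : x y / x <= y}.
  by move=> u v uv; rewrite ler_wpM2l ?ndF.
apply/le_anti/andP; split.
  apply/ler_addgt0Pl => e e0.
  have c1 : 0 < c + 1 by rewrite ltr_wpDl.
  have [y xy Fy] := right_lim_adherent x ndF (divr_gt0 e0 c1).
  apply: (le_trans (right_lim_le ndcF xy)).
  apply: (le_trans (ler_wpM2l c0 (ltW Fy))); rewrite mulrDr addrC lerD2r.
  by rewrite mulrCA -[leRHS]mulr1 ler_pM2l// ler_pdivrMr// mul1r lerDl.
apply: lb_le_inf; first by have [] := right_lim_has_inf x ndcF.
move=> _ [y /= + <-]; rewrite in_itv /= andbT => xy.
by rewrite ler_wpM2l// right_lim_le.
Qed.

Lemma lebesgue_stieltjes_itvoc (f : cumulative R R) x y : x <= y ->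
  lebesgue_stieltjes_measure f `]x, y]%classic = (f y - f x)%:E.
Proof.
move=> xy; rewrite /lebesgue_stieltjes_measure /measure_extension/=.
by rewrite measurable_mu_extE/= ?wlength_itv_bnd//; exact: is_ocitv.
Qed.

Definition cumulative_right_lim F (ndF : {homo F : x y / x <= y}) :
  cumulative R R := HB.pack (right_lim F)
    (isCumulative.Build R _ R (right_lim F) (right_lim_nd ndF) (right_lim_rc ndF)).

Definition stieltjes F (ndF : {homo F : x y / x <= y}) :=
  lebesgue_stieltjes_measure (cumulative_right_lim ndF).

HB.instance Definition _ F (ndF : {homo F : x y / x <= y}) :=
  Measure.on (stieltjes ndF).

Lemma stieltjes_itvoc F (ndF : {homo F : x y / x <= y}) x y : x <= y ->
  stieltjes ndF `]x, y]%classic = (right_lim F y - right_lim F x)%:E.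
Proof. exact: lebesgue_stieltjes_itvoc. Qed.

Lemma stieltjesD F G H (ndF : {homo F : x y / x <= y})
    (ndG : {homo G : x y / x <= y}) (ndH : {homo H : x y / x <= y}) :
  (forall x, H x = F x + G x) -> forall A, measurable A ->
  stieltjes ndH A = (stieltjes ndF A + stieltjes ndG A)%E.
Proof.
move=> HFG A mA.
have -> : (stieltjes ndF A + stieltjes ndG A = measure_add (stieltjes ndF) (stieltjes ndG) A)%E.
  by rewrite measure_addE.
apply: lebesgue_stieltjes_measure_unique => // _ [[x y] _ <-] /=.
have [xy|yx] := leP x y; last first.
  by rewrite set_itv_ge ?bnd_simp -?leNgt ?ltW// !measure0.
have e z : right_lim H z = right_lim F z + right_lim G z.
  by rewrite -right_limD//; congr right_lim; apply/funext.
transitivity ((right_lim F y - right_lim F x)%:E +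
    (right_lim G y - right_lim G x)%:E)%E.
  apply: (etrans (stieltjes_itvoc ndH xy)).
  by rewrite -EFinD !e; congr _%:E; ring.
by rewrite [RHS]measure_addE; congr (_ + _)%E; apply/esym; exact: stieltjes_itvoc.
Qed.

Lemma stieltjesZ F H c (ndF : {homo F : x y / x <= y})
    (ndH : {homo H : x y / x <= y}) : 0 <= c ->
  (forall x, H x = c * F x) -> forall A, measurable A ->
  stieltjes ndH A = (c%:E * stieltjes ndF A)%E.
Proof.
move=> c0 HF A mA.
have -> : (c%:E * stieltjes ndF A = mscale (NngNum c0) (stieltjes ndF) A)%E by [].
apply: lebesgue_stieltjes_measure_unique => // _ [[x y] _ <-] /=.
have [xy|yx] := leP x y; last first.
  by rewrite set_itv_ge ?bnd_simp -?leNgt ?ltW// !measure0.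
have e z : right_lim H z = c * right_lim F z.
  by rewrite -right_limZ//; congr right_lim; apply/funext.
transitivity (c%:E * (right_lim F y - right_lim F x)%:E)%E.
  apply: (etrans (stieltjes_itvoc ndH xy)).
  by rewrite -EFinM !e; congr _%:E; ring.
by rewrite /mscale /=; congr (_ * _)%E; apply/esym; exact: stieltjes_itvoc.
Qed.

Section SupportedOnSegment.
Variables (F : R -> R) (ndF : {homo F : x y / x <= y}) (a b : R).
Hypotheses (ab : a < b) (F0 : forall x, x < a -> F x = 0)
  (F1 : forall x, b <= x -> F x = F b).

Lemma right_lim_lt x : x < a -> right_lim F x = 0.
Proof.
move=> xa; apply/le_anti/andP; split.
  have xm : x < (x + a) / 2 by lra.
  by apply: (le_trans (right_lim_le ndF xm)); rewrite F0//; lra.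
by rewrite -(F0 xa) le_right_lim.
Qed.

Lemma right_lim_ge x : b <= x -> right_lim F x = F b.
Proof.
move=> bx; apply/le_anti/andP; split.
  have xm : x < x + 1 by rewrite ltrDl.
  by apply: (le_trans (right_lim_le ndF xm)); rewrite F1//; lra.
by rewrite -(F1 bx) le_right_lim.
Qed.

Lemma stieltjes_set1 : stieltjes ndF [set a] = (right_lim F a)%:E.
Proof.
have left0 : stieltjes ndF `]a - 1, a[%classic = 0%E.
  rewrite itv_bnd_open_bigcup//; apply/eqP; rewrite eq_le measure_ge0 andbT.
  apply: (@le_trans _ _ (\sum_(n <oo) stieltjes ndF `](a - 1)%R, (a - n.+1%:R^-1)%R]%classic)%E).
    apply: measure_sigma_subadditive => //.
    by apply: bigcup_measurable => k _; exact: measurable_itv.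
  rewrite eseries0// => n _ _.
  have n0 : 0 < n.+1%:R^-1 :> R by rewrite invr_gt0.
  have n1 : n.+1%:R^-1 <= 1 :> R by rewrite invf_le1// ler1n.
  move: n0 n1; set v : R := _^-1 => n0 n1.
  have h1 : a - 1 < a by lra.
  have h2 : a - v < a by lra.
  have h3 : a - 1 <= a - v by lra.
  by rewrite stieltjes_itvoc// !right_lim_lt// subrr.
have : stieltjes ndF `]a - 1, a]%classic =
    (stieltjes ndF `](a - 1)%R, a[%classic + stieltjes ndF [set a])%E.
  rewrite -(setUitv1 true) ?bnd_simp; last by rewrite ltrBlDr ltrDl.
  by rewrite measureU// -(setDitv1r _ a true) setDKI.
rewrite left0 add0e => <-; rewrite stieltjes_itvoc; last by rewrite gerBl.
by rewrite (@right_lim_lt (a - 1)) ?subr0// ltrBlDr ltrDl.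
Qed.

Lemma stieltjes_segment x : a <= x -> stieltjes ndF `[a, x]%classic = (right_lim F x)%:E.
Proof.
move=> ax; rewrite -(setU1itv false) ?bnd_simp// measureU//.
  transitivity ((right_lim F a)%:E + (right_lim F x - right_lim F a)%:E)%E.
    by congr (_ + _)%E; [exact: stieltjes_set1|exact: stieltjes_itvoc].
  by rewrite -EFinD addrC subrK.
by apply/seteqP; split => // y [/= ->]; rewrite in_itv /= ltxx.
Qed.

Lemma stieltjes_total : stieltjes ndF `[a, b]%classic = (F b)%:E.
Proof. by rewrite (stieltjes_segment (ltW ab)) right_lim_ge. Qed.

End SupportedOnSegment.

End RightLimit.

(** * Weak limits of densities along an ultrafilter *)

Section UltraLimit.
Variable R : realType.

(** A fixed nonprincipal ultrafilter: limits along it exist for all bounded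
    sequences and depend linearly on the sequence, which a choice of convergent
    subsequences would not provide. *)
Definition ultra : set_system nat :=
  sval (cid (ultraFilterLemma (F := \oo) eventually_filter)).

Lemma ultra_ultra : UltraFilter ultra.
Proof. by rewrite /ultra; case: cid => ? []. Qed.

Lemma ultra_oo (A : set nat) : \oo A -> ultra A.
Proof. by rewrite /ultra; case: cid => ? [] /= _; exact. Qed.

#[global] Instance ultra_filter : ProperFilter ultra.
Proof. exact: (@ultra_proper _ _ ultra_ultra). Qed.

Lemma cvg_ultra (v : nat -> R) (l : R) : v @ \oo --> l -> v @ ultra --> l.
Proof. by move=> h A /h; exact: ultra_oo. Qed.

Lemma is_cvg_ultra (v : nat -> R) (M : R) : (forall n, `|v n| <= M) ->
  cvg (v @ ultra).
Proof.
move=> vM; pose S := [set x : R | ultra [set n | x <= v n]].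
have S0 : S !=set0.
  exists (- M); rewrite /S /=; apply: filterS filterT => n _ /=.
  by have := vM n; rewrite ler_norml => /andP[].
have Sub : has_ubound S.
  exists M => x /filter_ex[n /= xn]; apply: (le_trans xn).
  by have := vM n; rewrite ler_norml => /andP[].
apply/cvg_ex; exists (sup S); apply/cvgrPdist_le => e e0.
have [x Sx xe] := sup_adherent e0 (conj S0 Sub).
have [U1|U2] := in_ultra_setVsetC [set n | sup S + e <= v n] ultra_ultra.
  have : sup S + e <= sup S by exact: ub_le_sup.
  by rewrite gerDl leNgt e0.
apply: filterS2 Sx U2 => n /= xn /negP; rewrite -ltNge => vn.
by rewrite ler_norml; lra.
Qed.

End UltraLimit.

Section Densities.
Variable R : realType.
Local Notation mu := (@lebesgue_measure R).
Implicit Types (k f : R -> R).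

Lemma continuous_integrable_itv k a b : continuous k ->
  mu.-integrable `[a, b] (EFin \o k).
Proof.
move=> ck; apply: continuous_compact_integrable; first exact: segment_compact.
exact: continuous_subspaceT.
Qed.

Lemma Rintegral_split k a m b : continuous k -> a <= m -> m <= b ->
  \int[mu]_(x in `[a, b]) k x =
  \int[mu]_(x in `[a, m]) k x + \int[mu]_(x in `[m, b]) k x.
Proof.
move=> ck am mb; have ih := @continuous_integrable_itv k a b ck.
have ih' : mu.-integrable `]m, b] (EFin \o k).
  by apply: integrableS ih => //; apply: subset_itv; rewrite bnd_simp.
rewrite -(@Rintegral_itv_obnd_cbnd _ m)//.
rewrite -(@Rintegral_itvB _ k (BLeft a) (BRight b) m) ?bnd_simp//.
by rewrite addrC subrK.
Qed.

Lemma unif_cont_segment k a b e : continuous k -> a <= b -> 0 < e ->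
  exists2 d, 0 < d & forall x y, a <= x <= b -> `|x - y| < d -> `|k x - k y| <= e.
Proof.
move=> ck ab e0.
apply: (@bisection2 R (fun _ _ c d => exists2 del, 0 < del &
  forall x y, c <= x <= d -> `|x - y| < del -> `|k x - k y| <= e) 0 0 a b) => //.
  move=> a' b' c d _ _ _ _ _ _ [d1 d10 h1] _ [d2 d20 h2] _.
  exists (Num.min d1 d2); first by rewrite lt_min d10.
  move=> x y /andP[cx xd]; rewrite lt_min => /andP[xy1 xy2].
  have [xm|/ltW mx] := leP x ((c + d) / 2).
  - by apply: h1 => //; rewrite cx.
  - by apply: h2 => //; rewrite mx.
move=> x0 z _ _; have /cvgrPdist_lt/(_ _ (divr_gt0 e0 (ltr0Sn _ 1))) := ck z.
move=> /nbhs_ballP[d /= d0 hd].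
exists (d / 2); first by rewrite divr_gt0.
move=> a' b' c' d' _ _ _ _ _ cz zd _ _ dc; exists (d / 2); first by rewrite divr_gt0.
move=> x y /andP[cx xd] xy.
have h1 : `|z - x| < d by apply: (@le_lt_trans _ _ (d' - c')); [rewrite ler_norml; lra|lra].
have h2 : `|z - y| < d.
  rewrite -(subrK x z) -addrA; apply: (le_lt_trans (ler_normD _ _)).
  have : `|z - x| <= d' - c' by rewrite ler_norml; lra.
  by move=> ?; lra.
have -> : k x - k y = (k z - k y) - (k z - k x) by ring.
have := hd _ h1; have := hd _ h2.
by move=> h3 h4; apply: (le_trans (ler_normB _ _)); rewrite (splitr e) ltW// ltrD.
Qed.

(** Errors on single cells add up because their bounds telescope. *)
Lemma stieltjes_sum_bound (k J Phi : R -> R) (p : nat -> R) e N :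
  (forall i, (i < N)%N -> `|J (p i.+1) - J (p i) -
     k (p i.+1) * (Phi (p i.+1) - Phi (p i))| <= e * (Phi (p i.+1) - Phi (p i))) ->
  `|J (p N) - J (p 0%N) - \sum_(i < N) k (p i.+1) * (Phi (p i.+1) - Phi (p i))|
    <= e * (Phi (p N) - Phi (p 0%N)).
Proof.
elim: N => [|N IH] h; first by rewrite big_ord0 !subrr ?subr0 normr0 mulr0.
rewrite big_ord_recr /=.
have -> : J (p N.+1) - J (p 0%N) - (\sum_(i < N) k (p i.+1) * (Phi (p i.+1) - Phi (p i)) +
    k (p N.+1) * (Phi (p N.+1) - Phi (p N))) =
  (J (p N) - J (p 0%N) - \sum_(i < N) k (p i.+1) * (Phi (p i.+1) - Phi (p i))) +
  (J (p N.+1) - J (p N) - k (p N.+1) * (Phi (p N.+1) - Phi (p N))) by ring.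
apply: (le_trans (ler_normD _ _)).
have -> : e * (Phi (p N.+1) - Phi (p 0%N)) =
  e * (Phi (p N) - Phi (p 0%N)) + e * (Phi (p N.+1) - Phi (p N)) by ring.
apply: lerD; last exact: h.
by apply: IH => i iN; apply: h; exact: ltnW.
Qed.

End Densities.

Section WeakLimit.
Variables (R : realType) (a b : R).
Hypothesis ab : a < b.
Local Notation mu := (@lebesgue_measure R).

(** The cut-off at [b] makes this a distribution function on the whole line, as
    Stieltjes measures require. *)
Definition prim (u : R -> R) x : R := \int[mu]_(t in `[a, Num.min x b]) u t.

Definition limit_dist (u : nat -> R -> R) x : R :=
  lim ((fun n => prim (u n) x) @ ultra).

Definition bounded_density (u : nat -> R -> R) : Prop :=
  [/\ forall n, continuous (u n), forall n x, 0 <= u n x &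
      exists M, forall n, \int[mu]_(t in `[a, b]) u n t <= M].

Lemma prim_lt u x : x < a -> prim u x = 0.
Proof.
move=> xa; rewrite /prim set_itv_ge ?Rintegral_set0// bnd_simp -ltNge.
by rewrite gt_min xa.
Qed.

Lemma prim_ge u x : b <= x -> prim u x = \int[mu]_(t in `[a, b]) u t.
Proof. by move=> bx; rewrite /prim min_r. Qed.

Lemma primB (u : R -> R) x y : continuous u -> a <= x -> x <= y -> y <= b ->
  prim u y - prim u x = \int[mu]_(t in `[x, y]) u t.
Proof.
move=> cu ax xy yb; rewrite /prim !min_l//; last exact: le_trans yb.
by rewrite (Rintegral_split cu ax xy) addrC addKr.
Qed.

Lemma prim_nd (u : R -> R) : continuous u -> (forall x, 0 <= u x) ->
  {homo prim u : x y / x <= y}.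
Proof.
move=> cu u0 x y xy; have [xa|ax] := ltP x a.
  by rewrite prim_lt//; apply: Rintegral_ge0.
have [bx|xb] := leP b x; first by rewrite !prim_ge// (le_trans bx).
have [by_|yb] := leP b y.
  rewrite (prim_ge u by_) -(prim_ge u (lexx b)) -subr_ge0 primB ?(ltW xb)//.
  by apply: Rintegral_ge0 => t _; exact: u0.
by rewrite -subr_ge0 primB ?(ltW yb)//; by apply: Rintegral_ge0 => t _; exact: u0.
Qed.

Section OneDensity.
Variable u : nat -> R -> R.
Hypothesis bu : bounded_density u.

Lemma prim_cvg x : (fun n => prim (u n) x) @ ultra --> limit_dist u x.
Proof.
have [cu u0 [M hM]] := bu; apply: (@is_cvg_ultra _ _ M) => n.
rewrite ger0_norm; last by apply: Rintegral_ge0 => t _; exact: u0.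
apply: (le_trans _ (hM n)); rewrite -(prim_ge (u n) (lexx b)).
have [xb|bx] := leP x b; first exact: prim_nd.
by rewrite !prim_ge// ltW.
Qed.

Lemma limit_dist_lt x : x < a -> limit_dist u x = 0.
Proof.
move=> xa; apply/cvg_lim => //; under eq_fun do rewrite prim_lt//.
exact: cvg_cst.
Qed.

Lemma limit_dist_ge x : b <= x -> limit_dist u x = limit_dist u b.
Proof.
by move=> bx; rewrite /limit_dist; under eq_fun do rewrite (prim_ge _ bx) -(prim_ge _ (lexx b)).
Qed.

Lemma limit_dist_nd : {homo limit_dist u : x y / x <= y}.
Proof.
have [cu u0 _] := bu; move=> x y xy.
apply: (ler_cvg_to (@prim_cvg x) (@prim_cvg y)).
by apply: nearW => n; exact: prim_nd.
Qed.

Lemma mass_cvg : (fun n => \int[mu]_(t in `[a, b]) u n t) @ ultra --> limit_dist u b.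
Proof. by have := @prim_cvg b; under eq_fun do rewrite (prim_ge _ (lexx b)). Qed.

Definition limit_measure := stieltjes limit_dist_nd.

HB.instance Definition _ := Measure.on limit_measure.

Lemma limit_measure_total : limit_measure `[a, b]%classic = (limit_dist u b)%:E.
Proof.
exact: (stieltjes_total limit_dist_nd ab limit_dist_lt limit_dist_ge).
Qed.

Lemma limit_measure_integrable (k : R -> R) (A : set R) : continuous k ->
  measurable A -> A `<=` `[a, b] -> limit_measure.-integrable A (EFin \o k).
Proof.
move=> ck mA Aab.
suff h : limit_measure.-integrable `[a, b]%classic (EFin \o k).
  exact: integrableS h.
apply: measurable_bounded_integrable => //.
- by rewrite [X in (X < _)%E](limit_measure_total) ltry.
- by apply: measurable_funTS; exact: continuous_measurable_fun.
- have ck' : {within `[a, b], continuous k} by exact: continuous_subspaceT.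
  have /compact_bounded[M [_ mrt]] := continuous_compact ck' (@segment_compact _ _ _).
  by exists M; split; rewrite ?num_real // => ? ? ? ?; exact: mrt.
Qed.

Lemma limit_dist_a : limit_dist u a = 0.
Proof.
apply/cvg_lim => //; rewrite (_ : (fun n => _) = (fun=> 0)); first exact: cvg_cst.
by apply/funext => n; rewrite /prim min_l ?ltW// set_itv1 Rintegral_set1.
Qed.

(** Abel summation: replacing the limit distribution by its right limits moves
    each mass only within one cell of the partition. *)
Lemma abel_right_lim (k : R -> R) (p : nat -> R) N :
  let G := limit_dist u in let d x := right_lim G x - G x in
  k (p 0%N) * d (p 0%N) +
    \sum_(i < N) k (p i.+1) * (right_lim G (p i.+1) - right_lim G (p i)) -
    \sum_(i < N) k (p i.+1) * (G (p i.+1) - G (p i)) =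
  k (p N) * d (p N) + \sum_(i < N) d (p i) * (k (p i) - k (p i.+1)).
Proof.
move=> G d; elim: N => [|N IH]; first by rewrite !big_ord0 !addr0 subr0.
rewrite !big_ord_recr /=.
set S1 := \sum_(i < N) _ in IH *; set S2 := \sum_(i < N) _ in IH *.
set S3 := \sum_(i < N) _ in IH *.
have -> : forall x y z w : R, x + (y + z) - (S2 + w) = x + y - S2 + (z - w).
  by move=> x y z w; ring.
rewrite IH /d; move: (k (p N.+1)) (k (p N)) (right_lim G (p N.+1)) => ? ? ?.
by move: (right_lim G (p N)) (G (p N.+1)) (G (p N)) => ? ? ?; ring.
Qed.

(** Helly's theorem. Both integrals are compared with Stieltjes sums over one fine
    partition; the sums converge along the ultrafilter, and the passage to right
    limits is an Abel summation. *)
Lemma limit_measure_cvg (k : R -> R) : continuous k ->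
  (fun n => \int[mu]_(t in `[a, b]) (k t * u n t)) @ ultra -->
  \int[limit_measure]_(t in `[a, b]) k t.
Proof.
move=> ck; have [cu u0 [M0 hM0]] := bu.
pose M := `|M0| + 1; have M_gt0 : 0 < M by rewrite ltr_wpDl.
have hM n : \int[mu]_(t in `[a, b]) u n t <= M.
  by apply: (le_trans (hM0 n)); rewrite (le_trans (ler_norm _))// lerDl.
set G := limit_dist u; have Gnd : {homo G : x y / x <= y} := limit_dist_nd.
have GbM : G b <= M by apply: (cvgr_to_le mass_cvg); exact: nearW.
have Ga : G a = 0 := limit_dist_a.
apply/cvgrPdist_le => e e0; pose e' := e / (4 * M).
have e'0 : 0 < e' by rewrite divr_gt0// mulr_gt0.
have e'M : e' * M = e / 4 by rewrite /e'; field; rewrite gt_eqF.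
have [del del0 hdel] := unif_cont_segment ck (ltW ab) e'0.
have [N hN] : exists N : nat, (b - a) / N.+1%:R < del.
  have dba : 0 < del / (b - a) by rewrite divr_gt0// subr_gt0.
  have [N _ hN] := near_infty_natSinv_lt (PosNum dba).
  exists N; have := hN N (leqnn N); rewrite /= ltr_pdivlMr ?subr_gt0// mulrC.
  by [].
pose p (i : nat) := a + i%:R * ((b - a) / N.+1%:R).
have w0 : 0 < (b - a) / N.+1%:R by rewrite divr_gt0// subr_gt0.
have p0 : p 0%N = a by rewrite /p mul0r addr0.
have pN : p N.+1 = b by rewrite /p mulrC divfK ?pnatr_eq0// addrC subrK.
have pS i : p i.+1 - p i = (b - a) / N.+1%:R by rewrite /p -natr1; ring.
have pSlt i : p i < p i.+1 by rewrite -subr_gt0 pS.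
have ple i j : (i <= j)%N -> p i <= p j.
  by move=> ij; rewrite /p lerD2l ler_pM2r// ler_nat.
have pa i : a <= p i by rewrite -p0 ple.
have pb i : (i <= N.+1)%N -> p i <= b by move=> h; rewrite -pN ple.
have osc i x : (i < N.+1)%N -> p i <= x <= p i.+1 -> `|k x - k (p i.+1)| <= e'.
  move=> iN /andP[px xp]; apply: hdel.
    by rewrite (le_trans (pa i) px) (le_trans xp)// pb.
  apply: le_lt_trans hN; rewrite -(pS i) ler0_norm ?subr_le0//; lra.
pose S (F : R -> R) := \sum_(i < N.+1) k (p i.+1) * (F (p i.+1) - F (p i)).
have h1 n : `|\int[mu]_(t in `[a, b]) (k t * u n t) - S (prim (u n))| <= e / 4.
  have cku : continuous (fun t => k t * u n t).
    by move=> t; apply: cvgM; [exact: ck|exact: cu].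
  have prima v : prim v a = 0 by rewrite /prim min_l ?ltW// set_itv1 Rintegral_set1.
  have := @stieltjes_sum_bound _ k (prim (fun t => k t * u n t)) (prim (u n)) p e' N.+1.
  rewrite pN p0 !prima !subr0 !(prim_ge _ (lexx b)) => h.
  apply: le_trans (h _) _; last first.
    by rewrite -e'M ler_pM2l.
  move=> i iN; have pi1 := pb _ iN; have pi2 := ltW (pSlt i).
  rewrite (primB cku (pa i) pi2 pi1) (primB (cu n) (pa i) pi2 pi1).
  rewrite -RintegralZl//; last first.
    exact: continuous_integrable_itv.
  rewrite -RintegralB//; [|exact: continuous_integrable_itv| ]; last first.
    by apply: continuous_integrable_itv => t; apply: cvgM; [exact: cvg_cst|exact: cu].
  have cd : continuous (fun t => k t * u n t - k (p i.+1) * u n t).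
    by move=> t; apply: cvgB; [exact: cku|apply: cvgM; [exact: cvg_cst|exact: cu]].
  apply: le_trans; first (apply: le_normr_Rintegral => //;
    exact: continuous_integrable_itv).
  rewrite -RintegralZl//; last exact: continuous_integrable_itv.
  apply: le_Rintegral => //.
  - apply: continuous_integrable_itv => t.
    by apply: cvg_norm; exact: cd.
  - by apply: continuous_integrable_itv => t; apply: cvgM; [exact: cvg_cst|exact: cu].
  - move=> t; rewrite /= in_itv /= => tp.
    by rewrite -mulrBl normrM (ger0_norm (u0 n t)) ler_wpM2r// osc.
have h2 : `|\int[limit_measure]_(t in `[a, b]) k t -
    (k a * right_lim G a + S (right_lim G))| <= e / 4.
  have ik x y : a <= x -> y <= b -> limit_measure.-integrable `]x, y]%classic (EFin \o k).
    move=> ax yb; apply: limit_measure_integrable => // t /=.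
    rewrite !in_itv /= => /andP[xt ty].
    by rewrite (le_trans ax (ltW xt)) (le_trans ty).
  have ik' y : y <= b -> limit_measure.-integrable `[a, y]%classic (EFin \o k).
    move=> yb; apply: limit_measure_integrable => // t /=.
    by rewrite !in_itv /= => /andP[-> ty]; rewrite (le_trans ty).
  have mass x y : x <= y -> limit_measure `]x, y]%classic = (right_lim G y - right_lim G x)%:E.
    exact: stieltjes_itvoc.
  have := @stieltjes_sum_bound _ k (fun y => \int[limit_measure]_(t in `[a, y]) k t)
    (right_lim G) p e' N.+1.
  rewrite pN p0 -/(S _) => h.
  have -> : k a * right_lim G a = \int[limit_measure]_(t in `[a, a]) k t.
    transitivity (\int[limit_measure]_(t in [set a]) k a).
      rewrite Rintegral_cst//; congr (_ * _).
      exact: (esym (congr1 fine (stieltjes_set1 limit_dist_nd limit_dist_lt))).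
    by rewrite set_itv1; apply: eq_Rintegral => t; rewrite inE /= => ->.
  rewrite opprD addrA; apply: le_trans (h _) _; last first.
    rewrite -e'M ler_pM2l// (right_lim_ge limit_dist_nd limit_dist_ge)// lerBlDr.
    by rewrite (le_trans GbM)// lerDl -Ga le_right_lim.
  move=> i iN; have pip := ltW (pSlt i).
  have -> : \int[limit_measure]_(t in `[a, p i.+1]) k t =
      \int[limit_measure]_(t in `[a, p i]) k t +
      \int[limit_measure]_(t in `]p i, p i.+1]) k t.
    rewrite (@itv_bndbnd_setU _ _ _ (BRight (p i))) ?bnd_simp//.
    rewrite Rintegral_setU//.
      rewrite -itv_bndbnd_setU ?bnd_simp//; apply: ik'; exact: pb.
    apply/disj_setPS => y [/=]; rewrite !in_itv/= => /andP[_ yx] /andP[].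
    by rewrite ltNge yx.
  rewrite [X in X - _ - _]addrC addrK.
  have -> : k (p i.+1) * (right_lim G (p i.+1) - right_lim G (p i)) =
      \int[limit_measure]_(t in `]p i, p i.+1]) k (p i.+1).
    rewrite Rintegral_cst//; congr (_ * _).
    exact: (esym (congr1 fine (mass _ _ pip))).
  have icst c : limit_measure.-integrable `]p i, p i.+1]%classic (EFin \o (fun=> c)).
    apply: (@limit_measure_integrable (fun=> c)) => //; first by move=> t; exact: cvg_cst.
    move=> t /=; rewrite !in_itv /= => /andP[xt ty].
    by rewrite (le_trans (pa i) (ltW xt)) (le_trans ty)// pb.
  have iki := ik _ _ (pa i) (pb _ iN).
  rewrite -RintegralB//.
  have ikd : limit_measure.-integrable `]p i, p i.+1]%classic (EFin \o (fun t => k t - k (p i.+1))).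
    exact: (integrableB _ iki (icst (k (p i.+1)))).
  apply: le_trans; first exact: le_normr_Rintegral.
  have -> : e' * (right_lim G (p i.+1) - right_lim G (p i)) =
      \int[limit_measure]_(t in `]p i, p i.+1]) e'.
    rewrite Rintegral_cst//; congr (_ * _).
    exact: (esym (congr1 fine (mass _ _ pip))).
  apply: le_Rintegral => //.
    exact: (integrable_norm ikd).
  by move=> t; rewrite /= in_itv /= => /andP[/ltW ? ?]; apply: osc => //; apply/andP.
have h3 : `|S G - (k a * right_lim G a + S (right_lim G))| <= e / 4.
  rewrite distrC; have := @abel_right_lim k p N.+1; cbv zeta.
  rewrite -/G -/(S _) -/(S _) p0 pN Ga subr0 => ->.
  rewrite (right_lim_ge limit_dist_nd limit_dist_ge)// subrr mulr0 add0r.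
  apply: (le_trans (ler_norm_sum _ _ _)).
  apply: (@le_trans _ _ (\sum_(i < N.+1) e' * (G (p i.+1) - G (p i)))).
    apply: ler_sum => i _; rewrite normrM mulrC.
    have d0 : 0 <= right_lim G (p i) - G (p i) by rewrite subr_ge0 le_right_lim.
    apply: ler_pM => //; first by apply: osc => //; rewrite lexx ltW.
    by rewrite ger0_norm// lerD2r right_lim_le.
  rewrite -mulr_sumr -(big_mkord xpredT (fun i => G (p i.+1) - G (p i))).
  by rewrite (@telescope_sumr _ _ _ (G \o p))//= pN p0 Ga subr0 -e'M ler_pM2l.
have h4 : (fun n => S (prim (u n))) @ ultra --> S G.
  rewrite /S; elim: N.+1 => [|n IH].
    by rewrite big_ord0; under eq_fun do rewrite big_ord0; exact: cvg_cst.
  rewrite big_ord_recr /=; under eq_fun do rewrite big_ord_recr /=.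
  apply: cvgD => //; apply: cvgM; first exact: cvg_cst.
  by apply: cvgB; exact: prim_cvg.
have e4 : 0 < e / 4 by rewrite divr_gt0.
move/cvgrPdist_le : h4 => /(_ _ e4); apply: filterS => n h4n.
set I := \int[limit_measure]_(t in _) _ in h2 *; set X := _ + S _ in h2 h3.
have := h1 n; set J := Rintegral _ _ _ => h1n.
have -> : I - J = (I - X) - (S G - X) + (S G - S (prim (u n))) - (J - S (prim (u n))) by ring.
have -> : e = e / 4 + e / 4 + e / 4 + e / 4 by field.
apply: (le_trans (ler_normB _ _)); apply: lerD => //.
apply: (le_trans (ler_normD _ _)); apply: lerD => //.
by apply: (le_trans (ler_normB _ _)); apply: lerD.
Qed.

End OneDensity.

Lemma limit_distD u v : bounded_density u -> bounded_density v ->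
  bounded_density (fun n x => u n x + v n x) /\
  forall x, limit_dist (fun n x => u n x + v n x) x = limit_dist u x + limit_dist v x.
Proof.
move=> bu bv; have [cu u0 [M hM]] := bu; have [cv v0 [M' hM']] := bv.
have add c d n : \int[mu]_(t in `[c, d]) (u n t + v n t) =
    \int[mu]_(t in `[c, d]) u n t + \int[mu]_(t in `[c, d]) v n t.
  by rewrite RintegralD//; exact: continuous_integrable_itv.
split; last first.
  move=> x; apply/cvg_lim => //; rewrite /prim; under eq_fun do rewrite add.
  by apply: cvgD; [exact: (@prim_cvg _ bu)|exact: (@prim_cvg _ bv)].
split; first by move=> n t; apply: cvgD; [exact: cu|exact: cv].
  by move=> n x; rewrite addr_ge0.
by exists (M + M') => n; rewrite add lerD.
Qed.

Lemma limit_distZ u c : 0 <= c -> bounded_density u ->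
  bounded_density (fun n x => c * u n x) /\
  forall x, limit_dist (fun n x => c * u n x) x = c * limit_dist u x.
Proof.
move=> c0 bu; have [cu u0 [M hM]] := bu.
have scal d e n : \int[mu]_(t in `[d, e]) (c * u n t) = c * \int[mu]_(t in `[d, e]) u n t.
  by rewrite RintegralZl//; exact: continuous_integrable_itv.
split; last first.
  move=> x; apply/cvg_lim => //; rewrite /prim; under eq_fun do rewrite scal.
  by apply: cvgM; [exact: cvg_cst|exact: (@prim_cvg _ bu)].
split; first by move=> n t; apply: cvgM; [exact: cvg_cst|exact: cu].
  by move=> n x; rewrite mulr_ge0.
by exists (c * M) => n; rewrite scal ler_wpM2l.
Qed.

End WeakLimit.

(** * Image of a measure with a density *)

Section WeightedImage.
Context d d' (T : measurableType d) (T' : measurableType d') (R : realType).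
Variables (nu : {measure set T -> \bar R}) (D : set T) (phi : T -> T') (w : T -> R).
Hypotheses (mD : measurable D) (mphi : measurable_fun setT phi)
  (mw : measurable_fun setT w) (w0 : forall x, 0 <= w x).

(** The image under [phi] of the measure with density [w] with respect to [nu] on
    [D]. The hypotheses are arguments so that the measure structure can be
    attached to the function. *)
Definition wimage (_ : measurable D) (_ : measurable_fun setT phi)
    (_ : measurable_fun setT w) (_ : forall x, 0 <= w x) (A : set T') : \bar R :=
  \int[nu]_(x in D `&` phi @^-1` A) (w x)%:E.

Local Notation img := (wimage mD mphi mw w0).

Let mw' : measurable_fun setT (EFin \o w).
Proof. exact/measurable_EFinP. Qed.

Let mpre A : measurable A -> measurable (D `&` phi @^-1` A).
Proof. by move=> mA; apply: measurableI => //; rewrite -[_ @^-1` _]setTI; exact: mphi. Qed.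

Let mcomp (g : T' -> R) : measurable_fun setT g ->
  measurable_fun setT (fun x => g (phi x)).
Proof. by move=> mg; exact: (measurableT_comp mg mphi). Qed.

Let img0 : img set0 = 0%E.
Proof. by rewrite /wimage preimage_set0 setI0 integral_set0. Qed.

Let img_ge0 A : (0 <= img A)%E.
Proof. by apply: integral_ge0 => x _; rewrite lee_fin. Qed.

Let img_sigma_additive : semi_sigma_additive img.
Proof.
move=> /= F mF tF mUF; rewrite /wimage; apply: cvg_toP.
  apply: ereal_nondecreasing_is_cvgn => m n mn.
  by apply: lee_sum_nneg_natr => // k _ _; exact: img_ge0.
rewrite preimage_bigcup setI_bigcupr ge0_integral_bigcup//=.
- by move=> n; exact: mpre.
- exact: measurable_funTS.
- by move=> x _; rewrite lee_fin.
- move: tF => /trivIsetP tF; apply/trivIsetP => i j _ _ ij.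
  by rewrite setIACA setIid -preimage_setI tF// preimage_set0 setI0.
Qed.

HB.instance Definition _ := isMeasure.Build _ _ _ img img0 img_ge0 img_sigma_additive.

Import HBNNSimple.

Let integral_wimage_nnsfun (h : {nnsfun T' >-> R}) :
  (\int[img]_x (h x)%:E = \int[nu]_(x in D) ((h (phi x))%:E * (w x)%:E))%E.
Proof.
rewrite integral_nnsfun// sintegralE.
have -> : (h : T' -> R) \_ setT = h by apply/funext => x; rewrite patchE in_setT.
under [RHS]eq_integral.
  move=> x _; rewrite fimfunE -fsumEFin// ge0_mule_fsuml; last first.
    by move=> r; rewrite EFinM nnfun_muleindic_ge0.
  over.
rewrite ge0_integral_fsum//; last 2 first.
- move=> r; apply: emeasurable_funM; last exact: measurable_funTS.
  apply/measurable_EFinP/measurable_funTS.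
  apply: (@mcomp (fun y => r * \1_(h @^-1` [set r]) y)).
  by apply: measurable_funM => //; exact: measurable_indic.
- by move=> r x _; apply: mule_ge0; [rewrite EFinM nnfun_muleindic_ge0|rewrite lee_fin].
apply: eq_fsbigr => r rh.
have r0 : 0 <= r by move: rh; rewrite inE => -[t _ <-].
under eq_integral do rewrite EFinM -muleA.
rewrite ge0_integralZl//; last 2 first.
- apply: emeasurable_funM; last exact: measurable_funTS.
  apply/measurable_EFinP/measurable_funTS.
  by apply: (@mcomp (\1_(h @^-1` [set r]))); exact: measurable_indic.
- by move=> x _; rewrite mule_ge0 ?lee_fin.
congr (_ * _)%E; rewrite /= /wimage integral_mkcondr; apply: eq_integral => x _.
rewrite patchE indicE (_ : (phi x \in _) = (x \in phi @^-1` (h @^-1` [set r])))//.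
by case: ifPn => _; rewrite ?mul1e ?mul0e.
Qed.

Lemma ge0_integral_wimage (g : T' -> \bar R) : measurable_fun setT g ->
  (forall x, 0 <= g x)%E ->
  (\int[img]_x g x = \int[nu]_(x in D) (g (phi x) * (w x)%:E))%E.
Proof.
move=> mg g0; pose g_ := nnsfun_approx measurableT mg.
have cg x : (g_ n x)%:E @[n --> \oo] --> g x by exact: cvg_nnsfun_approx.
transitivity (lim (\int[img]_x (g_ n x)%:E @[n --> \oo])%E).
  rewrite -monotone_convergence//=.
  - by apply: eq_integral => ? _; apply/esym/cvg_lim => //=; exact: cg.
  - by move=> n; exact/measurable_EFinP/measurable_funTS.
  - by move=> n ? _; rewrite lee_fin.
  - by move=> ? _ ? ? mn; rewrite lee_fin; exact/lefP/nd_nnsfun_approx.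
have mgn n : measurable_fun D (fun x => ((g_ n (phi x))%:E * (w x)%:E)%E).
  apply: emeasurable_funM; last exact: measurable_funTS.
  by apply/measurable_EFinP/measurable_funTS; exact: (@mcomp (g_ n)).
transitivity (lim (\int[nu]_(x in D) ((g_ n (phi x))%:E * (w x)%:E) @[n --> \oo])%E).
  by apply: congr_lim; apply/funext => n /=; exact: integral_wimage_nnsfun.
rewrite -monotone_convergence//=.
- by apply: eq_integral => x _; apply/cvg_lim => //; apply: cvgeZr => //; exact: cg.
- by move=> n x _; rewrite mule_ge0// lee_fin.
- move=> x _ m n mn; rewrite lee_wpmul2r// lee_fin//.
  exact/lefP/nd_nnsfun_approx.
Qed.

Lemma integrable_wimage (g : T' -> R) : measurable_fun setT g ->
  nu.-integrable D (EFin \o (fun x => g (phi x) * w x)) <->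
  img.-integrable setT (EFin \o g).
Proof.
move=> mg.
have E : (\int[img]_x `|(g x)%:E| = \int[nu]_(x in D) `|(g (phi x) * w x)%:E|)%E.
  rewrite ge0_integral_wimage//.
    by apply: eq_integral => x _; rewrite EFinM abseM [in RHS](@gee0_abs _ (w x)%:E) ?lee_fin.
  by apply: measurableT_comp => //; exact/measurable_EFinP.
have m1 : measurable_fun setT (EFin \o g) by exact/measurable_EFinP.
have m2 : measurable_fun D (EFin \o (fun x => g (phi x) * w x)).
  apply/measurable_EFinP/measurable_funTS; apply: measurable_funM => //.
  exact: (@mcomp g).
by split=> /integrableP[_ h]; apply/integrableP; split => //=; rewrite ?E// -E.
Qed.

Lemma Rintegral_wimage (g : T' -> R) :  measurable_fun setT g ->
  \int[img]_x g x = \int[nu]_(x in D) (g (phi x) * w x).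
Proof.
move=> mg; rewrite /Rintegral; congr fine.
have mg' : measurable_fun setT (EFin \o g) by exact/measurable_EFinP.
rewrite [LHS]integralE [RHS]integralE !ge0_integral_wimage//.
- have key (r s : R) : 0 <= s -> (maxe r%:E 0 * s%:E = maxe (r * s)%:E 0)%E.
    by move=> s0; rewrite -!EFin_max -EFinM maxr_pMl// mul0r.
  congr (_ - _)%E; apply: eq_integral => x _; first by rewrite !funeposE /= key.
  by rewrite !funenegE /= key// mulNr.
- exact: measurable_funeneg.
- exact: measurable_funepos.
Qed.

End WeightedImage.

(** * Herglotz measures of functions with nonnegative imaginary part *)

Section Cayley.
Variable R : realType.
Local Notation C := R[i].
Local Notation normc := (@Normc.normc R).
Local Notation i := ('i%C : C).
Implicit Types (z w : C).

Lemma Re_inv z : complex.Re z^-1 = complex.Re z / normc z ^+ 2.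
Proof. by rewrite sqr_normc'; case: z. Qed.

Lemma Im_inv z : complex.Im z^-1 = - complex.Im z / normc z ^+ 2.
Proof. by rewrite sqr_normc' mulNr; case: z. Qed.

Lemma ReMr (d : R) z : complex.Re (d%:C * z) = d * complex.Re z.
Proof. by rewrite ReM mul0r subr0. Qed.

Lemma ImMr (d : R) z : complex.Im (d%:C * z) = d * complex.Im z.
Proof. by rewrite ImM mul0r addr0. Qed.

Definition cayley w : C := i * (2 * (1 + w)^-1 - 1).

Definition uncayley z : C := (i - z) / (i + z).

Lemma cayley_den w : normc w < 1 -> 1 + w != 0.
Proof.
apply: contraTneq => /eqP; rewrite addrC addr_eq0 => /eqP ->.
by rewrite normcN' normc1 ltxx.
Qed.

Lemma Re2 z : complex.Re (2 * z) = 2 * complex.Re z.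
Proof. by rewrite !mulr_natl !mulr2n ReD. Qed.

Lemma Im_cayley w : normc w < 1 -> 0 < complex.Im (cayley w).
Proof.
move=> w1; have v0 := cayley_den w1.
rewrite /cayley ImM /= mul0r add0r mul1r ReD Re2 Re_inv ReN /=.
rewrite subr_gt0 mulrA ltr_pdivlMr ?exprn_gt0 ?normc_gt0// mul1r.
have : normc w ^+ 2 < 1 by rewrite expr_lt1 ?normc_ge0.
by rewrite !sqr_normc' ReD ImD /=; case: w {w1 v0} => a b /=; nra.
Qed.

Lemma uncayley_den z : 0 < complex.Im z -> i + z != 0.
Proof.
move=> z0; apply: contraTneq z0 => /eqP; rewrite addrC addr_eq0 => /eqP ->.
by rewrite /= -leNgt oppr_le0 ler01.
Qed.

Lemma normc_uncayley z : 0 < complex.Im z -> normc (uncayley z) < 1.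
Proof.
move=> z0; have v0 := uncayley_den z0.
rewrite /uncayley normcM normcV ltr_pdivrMr ?normc_gt0// mul1r.
rewrite -(ltr_pXn2r (_ : (0 < 2)%N)) ?nnegrE ?normc_ge0// !sqr_normc'.
by rewrite !ReD !ImD ReN ImN /=; case: z z0 {v0} => a b /= b0; nra.
Qed.

Lemma uncayleyK z : 0 < complex.Im z -> cayley (uncayley z) = z.
Proof.
move=> z0; have v0 := uncayley_den z0; rewrite /cayley /uncayley.
have i2 : i * i = -1 by rewrite -expr2 sqr_i.
have i0 : i != 0 by rewrite -normc_eq0 normci oner_eq0.
have -> : 1 + (i - z) / (i + z) = 2 * i / (i + z) by field.
rewrite invfM invrK !invfM.
have -> : i * (2 * (2^-1 * i^-1 * (i + z)) - 1) = z by field; rewrite i0.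
by [].
Qed.

Lemma cayley_holo w : normc w < 1 -> derivable cayley w 1.
Proof.
move=> w1; apply: holoM; first exact: holo_cst.
apply: holoB; last exact: holo_cst.
apply: holoM; first exact: holo_cst.
apply: holoV; first exact: cayley_den.
by apply: holoD; [exact: holo_cst|exact: holo_id].
Qed.

End Cayley.

Section Herglotz.
Variable R : realType.
Local Notation C := R[i].
Local Notation normc := (@Normc.normc R).
Local Notation i := ('i%C : C).
Local Notation mu := (@lebesgue_measure R).
Local Notation pi := (@pi R).
Implicit Types (f : C -> C) (z w : C).

Definition nevanlinna f := (forall z, 0 < complex.Im z -> derivable f z 1) /\
  (forall z, 0 < complex.Im z -> 0 <= complex.Im (f z)).

(** The factor [-i] turns a nonnegative imaginary part on the half-plane into a
    nonnegative real part on the disc. *)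
Definition on_disc f w : C := - i * f (cayley w).

Lemma Re_on_disc f w : complex.Re (on_disc f w) = complex.Im (f (cayley w)).
Proof. by rewrite /on_disc mulNr ReN ReM /=; ring. Qed.

Lemma on_disc_holo f w : nevanlinna f -> normc w < 1 -> derivable (on_disc f) w 1.
Proof.
move=> [df _] w1; apply: holoM; first exact: holo_cst.
by apply: holo_comp; [apply: df; exact: Im_cayley|exact: cayley_holo].
Qed.

Definition radius (n : nat) : R := 1 - n.+2%:R^-1.

Lemma radius_gt0 n : 0 < radius n.
Proof. by rewrite subr_gt0 invf_lt1// ltr1n. Qed.

Lemma radius_lt1 n : radius n < 1.
Proof. by rewrite gtrBl invr_gt0. Qed.

Lemma radius_cvg : radius @ \oo --> (1 : R).
Proof.
rewrite -[X in _ --> X]subr0; apply: cvgB; first exact: cvg_cst.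
by have := @cvg_harmonic R; rewrite -cvg_shiftS.
Qed.

(** Poisson's boundary densities on circles increasing to the unit circle. The mean
    value property bounds their total mass by the value at the centre. *)
Definition circle_density f (n : nat) (x : R) : R :=
  pi^-1 * complex.Im (f (cayley ((radius n)%:C * cis x))).

Let Npipi : - pi < pi. Proof. by rewrite gt0_cp ?pi_gt0. Qed.

Lemma circle_densityE f n x :
  circle_density f n x = pi^-1 * complex.Re (on_disc f ((radius n)%:C * cis x)).
Proof. by rewrite Re_on_disc. Qed.

Lemma circle_density_bounded f : nevanlinna f ->
  bounded_density (- pi) pi (circle_density f).
Proof.
move=> nf; have [df f0] := nf.
have rc n x : rcont (fun y => on_disc f ((radius n)%:C * cis y)) x.
  apply: rcont_circle; first exact/ltW/radius_gt0.
  move=> z zr; apply: derivable_ccont; apply: on_disc_holo => //.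
  by rewrite zr radius_lt1.
have cd n : continuous (circle_density f n).
  move=> x; rewrite (_ : circle_density f n = fun y => pi^-1 * complex.Re (on_disc f ((radius n)%:C * cis y))).
    by apply: cvgM; [exact: cvg_cst|have [] := rcont_continuous (rc n x)].
  by apply/funext => y; rewrite circle_densityE.
split => //.
  move=> n x; rewrite mulr_ge0 ?invr_ge0 ?pi_ge0//; apply: f0; apply: Im_cayley.
  by rewrite normc_polar ?radius_lt1// ltW// radius_gt0.
exists (2 * complex.Re (on_disc f 0)) => n.
have dh z : normc z < 1 -> derivable (on_disc f) z 1 by exact: on_disc_holo.
have /(congr1 (@complex.Re R)) := mean_value_holo dh (ltW (radius_gt0 n)) (radius_lt1 n).
rewrite ReM /= mul0r subr0 => h.
under eq_Rintegral do rewrite circle_densityE.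
rewrite RintegralZl//; last first.
  apply: continuous_integrable_itv => x.
  by have [] := rcont_continuous (rc n x).
rewrite h mulrA [pi^-1 * _]mulrCA mulVf ?mulr1//.
by rewrite gt_eqF// pi_gt0.
Qed.

Definition herglotz f (nf : nevanlinna f) :=
  limit_measure (circle_density_bounded nf).

HB.instance Definition _ f (nf : nevanlinna f) := Measure.on (herglotz nf).

Lemma kernel_rcont w x : normc w < 1 -> rcont (fun y => cis y / (cis y - w)) x.
Proof.
move=> w1; apply: (@rcont_comp _ (fun z => z / (z - w)) (@cis R)); last exact: rcont_cis.
apply: derivable_ccont; apply: holoM; first exact: holo_id.
apply: holoV; last by apply: holoB; [exact: holo_id|exact: holo_cst].
by rewrite subr_eq0; apply: contraTneq w1 => <-; rewrite normc_cis ltxx.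
Qed.

(** Herglotz's formula: Schwarz's formula on the circles of radius
    [radius n], in the limit. *)
Lemma herglotz_formula f (nf : nevanlinna f) w : normc w < 1 ->
  cintegral (herglotz nf) `[- pi, pi] (fun x => cis x / (cis x - w)) =
  on_disc f w + (on_disc f 0)^*%C.
Proof.
move=> w1; set h := on_disc f; set k := fun x => cis x / (cis x - w).
have dh z : normc z < 1 -> derivable h z 1 by exact: on_disc_holo.
have rk x : rcont k x by exact: kernel_rcont.
have [ckr cki] : continuous (fun x => complex.Re (k x)) /\
    continuous (fun x => complex.Im (k x)).
  by split=> x; have [] := rcont_continuous (rk x).
have rwn n : normc ((radius n)%:C * w) < radius n.
  rewrite normcM normcR gtr0_norm ?radius_gt0//.
  by rewrite -[ltRHS]mulr1 ltr_pM2l ?radius_gt0.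
have p0 : (2 * pi)%:C != 0 :> C.
  by rewrite -normc_eq0 normcR normr_eq0 gt_eqF// mulr_gt0// pi_gt0.
have [cd _ _] := circle_density_bounded nf.
have rd n x : rcont (fun x => (circle_density f n x)%:C) x.
  by apply: continuous_rcont => /=; [exact: cd|exact: cvg_cst].
have step n : cintegral mu `[- pi, pi] (fun x => (circle_density f n x)%:C * k x) =
    h ((radius n)%:C * w) + (h 0)^*%C.
  have := schwarz_formula dh (rwn n) (radius_lt1 n).
  move=> e; apply: (mulfI p0); rewrite -e -cintegralZl//; last first.
    split.
    - have := continuous_integrable_itv (k := fun x => circle_density f n x * complex.Re (k x)) (- pi) pi.
      move=> H; apply: eq_integrable (H _) => //.
        by move=> x _; rewrite /comp ReMr.
      by move=> x; apply: cvgM; [exact: cd|exact: ckr].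
    - have := continuous_integrable_itv (k := fun x => circle_density f n x * complex.Im (k x)) (- pi) pi.
      move=> H; apply: eq_integrable (H _) => //.
        by move=> x _; rewrite /comp ImMr.
      by move=> x; apply: cvgM; [exact: cd|exact: cki].
  apply: eq_cintegral => x _; rewrite /k circle_densityE.
  have r0 : (radius n)%:C != 0 :> C.
    by rewrite -normc_eq0 normcR normr_eq0 gt_eqF// radius_gt0.
  have kr : cis x - w != 0.
    by rewrite subr_eq0; apply: contraTneq w1 => <-; rewrite normc_cis ltxx.
  rewrite -mulrBr invfM mulrACA mulfV// mul1r mulrA -rmorphM /=.
  have pin0 : pi != 0 by rewrite gt_eqF// pi_gt0.
  by rewrite -mulrA mulVKf.
have hcvg e : 0 < e -> \forall n \near \oo, normc (h ((radius n)%:C * w) - h w) < e.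
  move=> e0; have [d d0 hd] := derivable_ccont (dh _ w1) e0.
  have /cvgrPdist_lt/(_ _ d0) := radius_cvg; apply: filterS => n rn.
  apply: hd; rewrite -[X in _ - X]mul1r -mulrBl normcM.
  apply: (@le_lt_trans _ _ `|1 - radius n|) => //.
  rewrite -(rmorph1 (real_complex R)) -rmorphB normcR distrC ler_piMr//.
  exact: ltW.
have lim_part (P : C -> R) : (forall x y, P (x - y) = P x - P y) ->
    (forall x, `|P x| <= normc x) -> continuous (fun x => P (k x)) ->
    (forall (d : R) (z : C), P (d%:C * z) = d * P z) ->
    (forall n, \int[mu]_(x in `[- pi, pi]) (P ((circle_density f n x)%:C * k x)) =
      P (h ((radius n)%:C * w) + (h 0)^*%C)) ->
    \int[herglotz nf]_(x in `[- pi, pi]) P (k x) = P (h w + (h 0)^*%C).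
  move=> PB Pn cP PZ Pstep.
  have h1 := @limit_measure_cvg R _ _ Npipi _ (circle_density_bounded nf) _ cP.
  have h2 : (fun n => \int[mu]_(t in `[- pi, pi]) (P (k t) * circle_density f n t))
      @ ultra --> P (h w + (h 0)^*%C).
    apply: cvg_ultra; apply/cvgrPdist_lt => e /hcvg; apply: filterS => n hn.
    rewrite (_ : \int[mu]_(t in _) _ = P (h ((radius n)%:C * w) + (h 0)^*%C)).
      rewrite distrC -PB; apply: (le_lt_trans (Pn _)).
      by rewrite opprD addrACA subrr addr0.
    by rewrite -Pstep; apply: eq_Rintegral => x _; rewrite PZ mulrC.
  exact: (cvg_unique _ h1 h2).
apply: eqC; rewrite /cintegral [LHS]/=.
- apply: (lim_part (@complex.Re R)) => //.
  + by move=> x y; rewrite ReD ReN.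
  + exact: Re_le_normc.
  + exact: ReMr.
  + by move=> n; rewrite -step.
- apply: (lim_part (@complex.Im R)) => //.
  + by move=> x y; rewrite ImD ImN.
  + exact: Im_le_normc.
  + exact: ImMr.
  + by move=> n; rewrite -step.
Qed.

End Herglotz.

(** * From the circle to the line *)

Section CircleToLine.
Variable R : realType.
Local Notation C := R[i].
Local Notation normc := (@Normc.normc R).
Local Notation i := ('i%C : C).
Implicit Types (z w : C) (x y : R).

Lemma measurable_inv : measurable_fun setT (@GRing.inv R).
Proof.
have -> : [set: R] = [set 0] `|` ~` [set 0] by rewrite setUv.
have m1 : measurable [set (0 : R)] by exact: measurable_set1.
apply/measurable_funU => //; first exact: measurableC.
split; first exact: measurable_fun_set1.
apply: open_continuous_measurable_fun.
  by rewrite openC; exact: accessible_closed_set1 (@hausdorff_accessible _ (@norm_hausdorff _ _)) _.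
by move=> x; rewrite inE /= => /eqP x0; exact: inv_continuous.
Qed.

Lemma measurable_funV (f : R -> R) : measurable_fun setT f ->
  measurable_fun setT (fun x => (f x)^-1).
Proof. exact: measurableT_comp measurable_inv. Qed.

(** The point of the line corresponding to [cis x] under the Cayley transform,
    and the density [(1 + t^2) / 2]; both vanish at [cis x = -1], the point
    at infinity. *)
Definition tcoord x : R := sin x / (1 + cos x).

Definition weight x : R := (1 + cos x)^-1.

Lemma weight_ge0 x : 0 <= weight x.
Proof. by rewrite invr_ge0; have := cos_geN1 x; lra. Qed.

Lemma measurable_weight : measurable_fun setT weight.
Proof.
apply: measurable_funV; apply: continuous_measurable_fun => x.
by apply: cvgD; [exact: cvg_cst|exact: continuous_cos].
Qed.

Lemma measurable_tcoord : measurable_fun setT tcoord.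
Proof.
apply: measurable_funM; last exact: measurable_weight.
by apply: continuous_measurable_fun; exact: continuous_sin.
Qed.

Lemma tcoord_sqr x : 1 + cos x != 0 -> 1 + tcoord x ^+ 2 = 2 * weight x.
Proof.
move=> c0; rewrite /tcoord /weight expr_div_n -[sin x ^+ 2](addKr (cos x ^+ 2)).
by rewrite cos2Dsin2; field.
Qed.

Lemma tcoord_le x : `|tcoord x| <= weight x.
Proof.
have [c0|c0] := eqVneq (1 + cos x) 0.
  by rewrite /tcoord /weight c0 invr0 mulr0 normr0.
have := tcoord_sqr c0; set t := tcoord x => e.
have -> : weight x = (1 + t ^+ 2) / 2 by rewrite e mulrC mulKf.
have := sqr_ge0 (1 + t); have := sqr_ge0 (1 - t).
by rewrite ler_norml => h1 h2; apply/andP; split; lra.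
Qed.

Lemma cis_tcoord x : 1 + cos x != 0 ->
  cis x = (i - (tcoord x)%:C) / (i + (tcoord x)%:C).
Proof.
move=> c0; set t := tcoord x.
have it0 : i + t%:C != 0.
  by rewrite -normc_eq0; apply/eqP => /Normc.eq0_normc /(congr1 (@complex.Im R)) /= /eqP;
     rewrite addr0 oner_eq0.
apply: (mulIf it0); rewrite divfK//.
have sE : sin x = t * (1 + cos x) by rewrite /t /tcoord divfK.
have e := tcoord_sqr c0; rewrite -/t /weight in e.
have cE : cos x * (1 + t ^+ 2) = 1 - t ^+ 2.
  by apply: (mulIf c0); rewrite mulrBl -{2}[_ ^+ 2](addKr 1) e; field.
apply: eqC; rewrite ?ReM ?ImM ?ReD ?ImD ?ReN ?ImN /= sE; first by ring.
by move: cE; lra.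
Qed.

End CircleToLine.

Section AlmostEverywhere.
Context d (T : measurableType d) (R : realType).
Variable mu : {measure set T -> \bar R}.
Local Notation C := R[i].

Lemma eq_cintegral_off (D N : set T) (f g : T -> C) : measurable D ->
  measurable N -> mu N = 0%E -> cmeasurable D f -> cmeasurable D g ->
  (forall x, D x -> ~ N x -> f x = g x) ->
  cintegral mu D f = cintegral mu D g.
Proof.
move=> mD mN N0 [fr fi] [gr gi] fg.
by rewrite /cintegral /Rintegral; congr (_ +i* _); congr fine;
  apply: ae_eq_integral => //; try exact/measurable_EFinP;
  exists N; split => // x /= /not_implyP[Dx fgx]; apply: contrapT => Nx; apply: fgx;
  rewrite fg.
Qed.

End AlmostEverywhere.

Section StieltjesUpper.
Variable R : realType.
Local Notation C := R[i].
Local Notation normc := (@Normc.normc R).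
Local Notation i := ('i%C : C).
Local Notation pi := (@pi R).
Implicit Types (z w : C) (x y : R).

Definition decays (f : C -> C) := exists K Y : R, forall y, Y <= y -> 0 < y ->
  y * normc (f (0 +i* y)) <= K.

Local Notation D := (`[- pi, pi]%classic : set R).

Let mD : measurable D. Proof. exact: measurable_itv. Qed.

Let cos_bounds x : 0 <= 1 + cos x /\ 0 <= 1 - cos x.
Proof. by have := cos_geN1 x; have := cos_le1 x; lra. Qed.

(** [Im (1 / (t - i y))] transported to the circle, times the density. *)
Definition poisson y x : R := y / ((1 - cos x) + y ^+ 2 * (1 + cos x)).

Lemma poisson_den y x : 0 < y -> 0 < (1 - cos x) + y ^+ 2 * (1 + cos x).
Proof.
move=> y0; have [h1 h2] := cos_bounds x; have y2 : 0 < y ^+ 2 by rewrite exprn_gt0.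
have [c0|c0] := eqVneq (1 + cos x) 0.
  by rewrite c0 mulr0 addr0; lra.
by rewrite ltr_wpDl// mulr_gt0// lt_neqAle eq_sym c0.
Qed.

Lemma continuous_poisson y : 0 < y -> continuous (poisson y).
Proof.
move=> y0 x; apply: cvgM; first exact: cvg_cst.
apply: cvgV; first by rewrite gt_eqF// poisson_den.
apply: cvgD; first by apply: cvgB; [exact: cvg_cst|exact: continuous_cos].
apply: cvgM; first exact: cvg_cst.
by apply: cvgD; [exact: cvg_cst|exact: continuous_cos].
Qed.

(** For [z = i y] the Schwarz kernel has real part [1 / 2] plus the Poisson
    kernel; the constant is removed by subtracting the formula at the centre. *)
Lemma kernel_poisson y x : 0 < y ->
  complex.Re (cis x / (cis x - uncayley (0 +i* y))) - 2^-1 = poisson y x.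
Proof.
move=> y0; have y1 : 1 + y != 0 by rewrite gt_eqF// addr_gt0.
have -> : uncayley (0 +i* y) = ((1 - y) / (1 + y))%:C.
  have den : i + (0 +i* y) != 0 by apply: uncayley_den.
  apply: (mulIf den); rewrite /uncayley divfK//.
  by apply: eqC; rewrite ?ReM ?ImM ?ReD ?ImD ?ReN ?ImN /=; field.
set o := (1 - y) / (1 + y).
have dp := poisson_den x y0; have d0 := lt0r_neq0 dp.
have cs : sin x ^+ 2 = 1 - cos x ^+ 2 by rewrite -(cos2Dsin2 x); ring.
rewrite ReM Re_inv Im_inv sqr_normc' !ReD !ImD !ReN !ImN /= subr0.
have e : (cos x - o) ^+ 2 + sin x ^+ 2 =
    2 * ((1 - cos x) + y ^+ 2 * (1 + cos x)) / (1 + y) ^+ 2.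
  by rewrite cs /o; field.
have e' : cos x * ((cos x - o) / ((cos x - o) ^+ 2 + sin x ^+ 2)) -
    sin x * (- sin x / ((cos x - o) ^+ 2 + sin x ^+ 2)) =
    (cos x * (cos x - o) + sin x ^+ 2) / ((cos x - o) ^+ 2 + sin x ^+ 2).
  by move: ((cos x - o) ^+ 2 + sin x ^+ 2)^-1 => Q; ring.
rewrite e' e cs /o /poisson; field.
by rewrite y1 d0.
Qed.

Variables (f : C -> C) (nf : nevanlinna f) (df : decays f).

Local Notation nu := (herglotz nf).

Let nuD : (nu D < +oo)%E.
Proof. by rewrite /herglotz [X in (X < _)%E]limit_measure_total ?ltry// gt0_cp ?pi_gt0. Qed.

Let nu_integrable (k : R -> R) : continuous k -> nu.-integrable D (EFin \o k).
Proof. by move=> ck; apply: limit_measure_integrable => //; rewrite gt0_cp ?pi_gt0. Qed.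

Let kernel_integrable w : normc w < 1 ->
  cintegrable nu D (fun x => cis x / (cis x - w)).
Proof.
by move=> w1; split; apply: nu_integrable => x;
  have [] := rcont_continuous (kernel_rcont x w1).
Qed.

Lemma Im_poisson y : 0 < y ->
  complex.Im (f (0 +i* y)) = \int[nu]_(x in D) poisson y x.
Proof.
move=> y0; have z0 : 0 < complex.Im (0 +i* y) by [].
have w1 := normc_uncayley z0; set w := uncayley _ in w1.
rewrite -{1}(uncayleyK z0) -/w -Re_on_disc.
have k1 := herglotz_formula nf w1; have := herglotz_formula nf (w := 0).
rewrite normc0 ltr01 => /(_ isT) /(congr1 (@complex.Re R)) /=.
rewrite ReD (_ : complex.Re (_^*%C) = complex.Re (on_disc f 0)); last by case: (on_disc f 0).
move=> h0; have /(congr1 (@complex.Re R)) /= := k1.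
rewrite ReD (_ : complex.Re (_^*%C) = complex.Re (on_disc f 0)); last by case: (on_disc f 0).
move=> hw.
have one : \int[nu]_(x in D) (2^-1 : R) = complex.Re (on_disc f 0).
  apply: (mulfI (_ : 2 != 0 :> R)) => //; rewrite -RintegralZl//; last first.
    by apply: nu_integrable => x; exact: cvg_cst.
  rewrite [RHS]mulrDl mul1r -h0; apply: eq_Rintegral => x _.
  have k0 : complex.Re (cis x / (cis x - 0)) = 1 :> R.
    by rewrite subr0 divff ?cis_neq0.
  by rewrite mulfV//; apply/esym/k0.
have -> : complex.Re (on_disc f w) = complex.Re (on_disc f w) +
   complex.Re (on_disc f 0) - complex.Re (on_disc f 0) by rewrite addrK.
rewrite -hw -one -RintegralB//; [|by have [] := kernel_integrable w1|].
  by apply: eq_Rintegral => x _; exact: kernel_poisson.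
by apply: nu_integrable => x; exact: cvg_cst.
Qed.

Local Notation Einf := (D `&` [set x : R | 1 + cos x = 0]).

Lemma measurable_infty : measurable Einf.
Proof.
apply: measurableI => //.
have -> : [set x | 1 + cos x = 0] = (fun x : R => 1 + cos x) @^-1` [set 0] by [].
rewrite -[_ @^-1` _]setTI.
have m : measurable_fun setT (fun x : R => 1 + cos x).
  apply: continuous_measurable_fun => x.
  by apply: cvgD; [exact: cvg_cst|exact: continuous_cos].
by apply: m => //; exact: measurable_set1.
Qed.

Let K_bound : exists K Y : R, 0 < Y /\
  forall y, Y <= y -> \int[nu]_(x in D) (y * poisson y x) <= K.
Proof.
have [K [Y h]] := df; exists K, (Num.max 1 Y); split; first by rewrite lt_max ltr01.
move=> y; rewrite ge_max => /andP[y1 Yy]; have y0 : 0 < y by lra.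
rewrite RintegralZl//; last by apply: nu_integrable; exact: continuous_poisson.
rewrite -Im_poisson//; apply: le_trans (h _ Yy y0).
by rewrite ler_pM2l// (le_trans (ler_norm _))// Im_le_normc.
Qed.

(** No mass sits at infinity: it would make [y f(iy)] grow like [y^2]. *)
Lemma herglotz_infty0 : nu Einf = 0%E.
Proof.
have [K [Y [Y0 h]]] := K_bound.
have fE : nu Einf \is a fin_num.
  rewrite ge0_fin_numE ?measure_ge0//; apply: le_lt_trans nuD.
  by apply: le_measure; rewrite ?inE; [exact: measurable_infty|exact: mD|move=> x []].
suff : fine (nu Einf) = 0 by move=> e; rewrite -(fineK fE) e.
apply/eqP; rewrite eq_le fine_ge0 ?measure_ge0// andbT.
apply/ler_addgt0Pl => e e0; rewrite addr0.
pose y := Num.max (Num.max 1 Y) (2 * `|K| / e).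
have yY : Y <= y by rewrite !le_max lexx orbT.
have y1 : 1 <= y by rewrite !le_max lexx.
have yK : 2 * `|K| / e <= y by rewrite le_max lexx orbT.
have y0 : 0 < y by lra.
have iq : nu.-integrable D (EFin \o (fun x => y * poisson y x)).
  by apply: nu_integrable => x; apply: cvgM; [exact: cvg_cst|exact: continuous_poisson].
have EK : y ^+ 2 / 2 * fine (nu Einf) <= K.
  apply: (le_trans _ (h _ yY)); rewrite -Rintegral_cst; last exact: measurable_infty.
  have -> : \int[nu]_(x in Einf) (y ^+ 2 / 2) = \int[nu]_(x in Einf) (y * poisson y x).
    apply: eq_Rintegral => x; rewrite inE => -[_ /= c0].
    have c1 : cos x = -1 by lra.
    by rewrite /poisson c1; field.
  apply: fine_le.
  - apply: integrable_fin_num; first exact: measurable_infty.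
    by move: iq; apply: integrableS => //; exact: measurable_infty || move=> x [].
  - exact: integrable_fin_num.
  - apply: ge0_subset_integral;
      [exact: measurable_infty|exact: mD|by have /integrableP[] := iq| |by move=> x []].
    move=> x _; rewrite lee_fin mulr_ge0 ?(ltW y0)// divr_ge0 ?(ltW y0)//.
    exact/ltW/poisson_den.
have y2 : y <= y ^+ 2 by rewrite expr2 ler_peMl// ltW.
have : y / 2 * fine (nu Einf) <= `|K|.
  apply: (le_trans _ (le_trans EK (ler_norm _))).
  by rewrite ler_wpM2r ?fine_ge0 ?measure_ge0//; lra.
move=> h1; rewrite leNgt; apply/negP => eF.
have : y / 2 * e < `|K|.
  by apply: lt_le_trans h1; rewrite ltr_pM2l//; lra.
by move: yK; rewrite ler_pdivrMr//; lra.
Qed.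

Let qn (n : nat) x : R := n.+1%:R * poisson n.+1%:R x * (weight x * (1 + cos x)).

Let qn_cvg x : qn ^~ x @ \oo --> weight x.
Proof.
have [c0|c0] := eqVneq (1 + cos x) 0.
  rewrite /qn c0 /weight c0 invr0 (_ : (fun n => _) = (fun=> 0)); first exact: cvg_cst.
  by apply/funext => n; rewrite mul0r mulr0.
rewrite (_ : qn ^~ x = fun n => ((1 - cos x) * (n.+1%:R^-1 * n.+1%:R^-1) + (1 + cos x))^-1).
  rewrite /weight -{2}[1 + cos x]add0r; apply: cvgV; first by rewrite add0r.
  apply: cvgD; last exact: cvg_cst.
  rewrite -[X in _ --> X](mulr0 (1 - cos x)); apply: cvgM; first exact: cvg_cst.
  by rewrite -[X in _ --> X](mulr0 0); apply: cvgM; exact: cvg_harmonic.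
apply/funext => n; rewrite /qn /weight mulVf// mulr1 /poisson.
have n0 : 0 < n.+1%:R :> R by [].
have := poisson_den x n0; set m : R := n.+1%:R in n0 * => d0.
have -> : (1 - cos x) * (m^-1 * m^-1) + (1 + cos x) =
    (1 - cos x + m ^+ 2 * (1 + cos x)) / (m * m) by field; rewrite gt_eqF.
by rewrite invf_div mulrA.
Qed.

(** The decay of [f] bounds the integrals of [y * poisson y], which converge to the
    weight off infinity; Fatou's lemma concludes. *)
Lemma weight_integrable : nu.-integrable D (EFin \o @weight R).
Proof.
have [K [Y [Y0 h]]] := K_bound.
apply/integrableP; split.
  by apply/measurable_EFinP/measurable_funTS; exact: measurable_weight.
have -> : (\int[nu]_(x in D) `|(EFin \o @weight R) x| = \int[nu]_(x in D) limn_einf (fun n => (qn n x)%:E))%E.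
  apply: eq_integral => x _; rewrite /comp gee0_abs ?lee_fin ?weight_ge0//.
  have c : (fun n => (qn n x)%:E) @ \oo --> (weight x)%:E.
    by apply: cvg_EFin; [exact: nearW|exact: qn_cvg].
  by rewrite is_cvg_limn_einfE ?(cvg_lim _ c)//; apply/cvg_ex; exists (weight x)%:E.
have q0 n x : 0 <= n.+1%:R * poisson n.+1%:R x.
  by rewrite mulr_ge0// divr_ge0// ltW// poisson_den.
have w1 x : 0 <= weight x * (1 + cos x) <= 1.
  have [c0|c0] := eqVneq (1 + cos x) 0; first by rewrite c0 mulr0 lexx ler01.
  by rewrite /weight mulVf// ler01 lexx.
have mq n : measurable_fun D (fun x => (qn n x)%:E).
  apply/measurable_EFinP/measurable_funTS; apply: measurable_funM.
    apply: continuous_measurable_fun => x; apply: cvgM; first exact: cvg_cst.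
    exact: continuous_poisson.
  apply: measurable_funM; first exact: measurable_weight.
  apply: continuous_measurable_fun => x.
  by apply: cvgD; [exact: cvg_cst|exact: continuous_cos].
have mp n : measurable_fun setT (fun x : R => n.+1%:R * poisson n.+1%:R x).
  apply: continuous_measurable_fun => x; apply: cvgM; first exact: cvg_cst.
  exact: continuous_poisson.
apply: (@le_lt_trans _ _ K%:E); last exact: ltry.
apply: (@le_trans _ _ (limn_einf (fun n => \int[nu]_(x in D) (qn n x)%:E)%E)).
  apply: fatou => // n x _; rewrite lee_fin mulr_ge0 ?q0//.
  by have /andP[] := w1 x.
rewrite limn_einf_lim; apply: lime_le; first exact: is_cvg_einfs.
near=> n; have nY : Y <= n.+1%:R.
  near: n; exists (Num.truncn Y).+1 => // n /= Yn.
  apply: ltW; apply: (lt_le_trans (truncnS_gt Y)); rewrite ler_nat.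
  by apply: (leq_trans Yn).
apply: (@le_trans _ _ (\int[nu]_(x in D) (qn n x)%:E)%E).
  by apply: ereal_inf_lbound; exists n => /=.
apply: (@le_trans _ _ (\int[nu]_(x in D) (n.+1%:R * poisson n.+1%:R x)%:E)%E).
  apply: ge0_le_integral => //.
  - by move=> x _; rewrite lee_fin mulr_ge0 ?q0//; have /andP[] := w1 x.
  - exact: mq.
  - by apply/measurable_EFinP; apply: measurable_funTS; exact: mp.
  - by move=> x _; rewrite lee_fin ler_piMr ?q0//; have /andP[] := w1 x.
rewrite -[leLHS]fineK ?lee_fin; first exact: h.
apply: integrable_fin_num => //; apply: nu_integrable => x.
by apply: cvgM; [exact: cvg_cst|exact: continuous_poisson].
Unshelve. all: by end_near. Qed.

End StieltjesUpper.

(** * The Stieltjes measure of a function on the upper half-plane *)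

Section SpectralMeasure.
Variable R : realType.
Local Notation C := R[i].
Local Notation normc := (@Normc.normc R).
Local Notation i := ('i%C : C).
Local Notation pi := (@pi R).
Local Notation D := (`[- pi, pi]%classic : set R).
Implicit Types (f g h : C -> C) (z w : C) (x y : R).

Let mD : measurable D. Proof. exact: measurable_itv. Qed.

(** The Herglotz measure transported from the circle to the line, with the factor
    that turns the Schwarz kernel into the Cauchy kernel. *)
Definition spectral f (nf : nevanlinna f) : set R -> \bar R :=
  wimage (herglotz nf) mD (@measurable_tcoord R) (@measurable_weight R) (@weight_ge0 R).

HB.instance Definition _ f (nf : nevanlinna f) := Measure.on (spectral nf).

Let NpiPi : - pi < pi. Proof. by rewrite gt0_cp ?pi_gt0. Qed.

Let mB (A : set R) : measurable A -> measurable (D `&` @tcoord R @^-1` A).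
Proof.
by move=> mA; apply: measurableI => //; rewrite -[_ @^-1` _]setTI; exact: measurable_tcoord.
Qed.

Let mw (B : set R) : measurable_fun B (EFin \o @weight R).
Proof. by apply/measurable_EFinP/measurable_funTS; exact: measurable_weight. Qed.

Let Im_circle n x : 0 < complex.Im (cayley ((radius R n)%:C * cis x)).
Proof.
have r0 := ltW (radius_gt0 R n).
by apply: Im_cayley; rewrite (normc_polar x r0); exact: radius_lt1.
Qed.

Lemma herglotzD f g h (nf : nevanlinna f) (ng : nevanlinna g) (nh : nevanlinna h) :
  (forall z, 0 < complex.Im z -> h z = f z + g z) ->
  forall A, measurable A -> herglotz nh A = (herglotz nf A + herglotz ng A)%E.
Proof.
move=> hfg A mA.
have Eh : circle_density h = fun n x => circle_density f n x + circle_density g n x.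
  apply/funext => n; apply/funext => y; rewrite /circle_density.
  by rewrite (hfg _ (Im_circle n y)) ImD mulrDr.
have [_ e] := limit_distD (circle_density_bounded nf) (circle_density_bounded ng).
have H x : limit_dist (- pi) pi (circle_density h) x =
    limit_dist (- pi) pi (circle_density f) x + limit_dist (- pi) pi (circle_density g) x.
  by rewrite Eh; exact: e.
exact: (@stieltjesD R _ _ _ (limit_dist_nd (circle_density_bounded nf))
  (limit_dist_nd (circle_density_bounded ng))
  (limit_dist_nd (circle_density_bounded nh)) H A mA).
Qed.

Lemma herglotzZ f h c (nf : nevanlinna f) (nh : nevanlinna h) : 0 <= c ->
  (forall z, 0 < complex.Im z -> h z = c%:C * f z) ->
  forall A, measurable A -> herglotz nh A = (c%:E * herglotz nf A)%E.
Proof.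
move=> c0 hf A mA.
have Eh : circle_density h = fun n x => c * circle_density f n x.
  apply/funext => n; apply/funext => y; rewrite /circle_density.
  by rewrite (hf _ (Im_circle n y)) ImMr mulrCA.
have [_ e] := limit_distZ c0 (circle_density_bounded nf).
have H x : limit_dist (- pi) pi (circle_density h) x =
    c * limit_dist (- pi) pi (circle_density f) x.
  by rewrite Eh; exact: e.
exact: (@stieltjesZ R _ _ c (limit_dist_nd (circle_density_bounded nf))
  (limit_dist_nd (circle_density_bounded nh)) c0 H A mA).
Qed.

(** Additivity is the reason for taking limits along an ultrafilter: the measure
    of a sum is the sum of the measures, without an appeal to the uniqueness part
    of Stieltjes inversion. *)
Lemma spectralD f g h (nf : nevanlinna f) (ng : nevanlinna g) (nh : nevanlinna h) :
  (forall z, 0 < complex.Im z -> h z = f z + g z) ->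
  forall A, measurable A -> spectral nh A = (spectral nf A + spectral ng A)%E.
Proof.
move=> hfg A mA; rewrite /spectral /wimage.
rewrite -(ge0_integral_measure_add (herglotz nf) (herglotz ng)) //; last 3 first.
- exact: mB.
- by move=> x _; rewrite lee_fin weight_ge0.
- exact: mw.
apply: eq_measure_integral => B mB' _; rewrite [RHS]measure_addE.
exact: herglotzD.
Qed.

Lemma spectralZ f h c (nf : nevanlinna f) (nh : nevanlinna h) : 0 <= c ->
  (forall z, 0 < complex.Im z -> h z = c%:C * f z) ->
  forall A, measurable A -> spectral nh A = (c%:E * spectral nf A)%E.
Proof.
move=> c0 hf A mA; rewrite /spectral /wimage.
transitivity (\int[mscale (NngNum c0) (herglotz nf)]_(x in D `&` @tcoord R @^-1` A) (weight x)%:E)%E.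
  apply: eq_measure_integral => B mB' _; rewrite /mscale/=.
  exact: herglotzZ.
rewrite ge0_integral_mscale//.
- exact: mB.
- exact: mw.
- by move=> x _; rewrite lee_fin weight_ge0.
Qed.

Lemma cmeasurable_cauchy z : cmeasurable setT (fun t : R => 1 / (t%:C - z)).
Proof.
have mR : measurable_fun setT (fun t : R => complex.Re (t%:C - z)).
  under eq_fun do rewrite ReD ReN.
  by apply: measurable_funB => //; exact: measurable_id.
have mI : measurable_fun setT (fun t : R => complex.Im (t%:C - z)).
  rewrite (_ : (fun t => _) = cst (- complex.Im z)); first exact: measurable_cst.
  by apply/funext => t; rewrite ImD ImN /= add0r.
have mV : measurable_fun setT (fun t : R => (normc (t%:C - z) ^+ 2)^-1).
  apply: measurable_funV; under eq_fun do rewrite sqr_normc'.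
  by apply: measurable_funD; exact: measurable_funX.
split; under eq_fun do rewrite div1r.
- by under eq_fun do rewrite Re_inv; exact: measurable_funM.
- under eq_fun do rewrite Im_inv mulNr -mulN1r.
  by apply: measurable_funM => //; exact: measurable_funM.
Qed.

(** The Schwarz kernel in the coordinate of the line: a term that does not depend
    on [z] plus the weighted Cauchy kernel. *)
Lemma kernel_cauchy z x : 0 < complex.Im z -> 1 + cos x != 0 ->
  i * (cis x / (cis x - uncayley z)) =
  (i - (tcoord x)%:C) / 2 + (weight x)%:C * (1 / ((tcoord x)%:C - z)).
Proof.
move=> z0 c0; have iz := uncayley_den z0.
rewrite (cis_tcoord c0) /uncayley.
have w2 : (weight x)%:C = (1 + (tcoord x)%:C ^+ 2) / 2.
  apply: (mulIf (_ : 2 != 0 :> C)) => //; rewrite divfK// mulrC -rmorphXn.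
  by rewrite -(rmorph_nat (real_complex R) 2) -rmorphM -tcoord_sqr// rmorphD rmorph1.
rewrite {}w2; set t := (tcoord x)%:C.
have it : i + t != 0.
  by rewrite -normc_eq0; apply/eqP => /Normc.eq0_normc /(congr1 (@complex.Im R)) /= /eqP;
     rewrite addr0 oner_eq0.
have tz : t - z != 0.
  rewrite subr_eq0; apply: contraTneq z0 => <-; by rewrite /= ltxx.
have i2 : i ^+ 2 = -1 by exact: sqr_i.
have i0 : i != 0 by rewrite -normc_eq0 normci oner_eq0.
have -> : 1 + t ^+ 2 = - ((i - t) * (i + t)).
  have -> : (i - t) * (i + t) = i ^+ 2 - t ^+ 2 by ring.
  by rewrite i2; ring.
have -> : (i - t) / (i + t) - (i - z) / (i + z) = 2 * i * (z - t) / ((i + t) * (i + z)).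
  by field; rewrite it iz.
have zt : z - t != 0 by rewrite -opprB oppr_eq0.
have [it0|itn] := eqVneq (i - t) 0; first by rewrite it0; ring.
by field; rewrite ?i0 ?zt ?tz ?it ?iz.
Qed.

Variables (f : C -> C) (nf : nevanlinna f) (df : decays f).

Local Notation nu := (herglotz nf).
Local Notation sg := (spectral nf).

Lemma spectral_setT : spectral nf setT = (\int[nu]_(x in D) (weight x)%:E)%E.
Proof. by rewrite /spectral /wimage preimage_setT setIT. Qed.

Lemma spectral_finite : (spectral nf setT < +oo)%E.
Proof.
rewrite spectral_setT; have /integrableP[_] := weight_integrable nf df.
by under eq_integral do rewrite /comp gee0_abs ?lee_fin ?weight_ge0//.
Qed.

Lemma spectral_cst_integrable (c : R) : sg.-integrable setT (EFin \o (fun=> c)).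
Proof.
apply: measurable_bounded_integrable => //; first exact: spectral_finite.
exact: bounded_cst.
Qed.

Lemma normc_cauchy_le z (t : R) : 0 < complex.Im z ->
  normc (1 / (t%:C - z)) <= (complex.Im z)^-1.
Proof.
move=> z0; have h : complex.Im z <= normc (t%:C - z).
  apply: le_trans (Im_le_normc _); rewrite ImD ImN /= add0r normrN.
  by rewrite ler_norm.
have n0 : 0 < normc (t%:C - z) by exact: lt_le_trans h.
by rewrite div1r normcV lef_pV2.
Qed.

Lemma cauchy_integrable z : 0 < complex.Im z ->
  cintegrable sg setT (fun t : R => 1 / (t%:C - z)).
Proof.
move=> z0; apply: (cintegrable_dom _ (cmeasurable_cauchy z)
  (spectral_cst_integrable (complex.Im z)^-1)) => //.
by move=> t _; exact: normc_cauchy_le.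
Qed.

Let W z x : C := (weight x)%:C * (1 / ((tcoord x)%:C - z)).

Let Re_W z x : complex.Re (W z x) = complex.Re (1 / ((tcoord x)%:C - z)) * weight x.
Proof. by rewrite /W [LHS]ReMr mulrC. Qed.

Let Im_W z x : complex.Im (W z x) = complex.Im (1 / ((tcoord x)%:C - z)) * weight x.
Proof. by rewrite /W [LHS]ImMr mulrC. Qed.

Let W_integrable z : 0 < complex.Im z -> cintegrable nu D (W z).
Proof.
move=> z0; have [mr mi] := cmeasurable_cauchy z.
have [ir ii] := cauchy_integrable z0; split.
- have /(integrable_wimage (herglotz nf) mD (@measurable_tcoord R)
    (@measurable_weight R) (@weight_ge0 R) mr) := ir.
  by move=> H; apply: eq_integrable H => // x _; rewrite /comp Re_W.
- have /(integrable_wimage (herglotz nf) mD (@measurable_tcoord R)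
    (@measurable_weight R) (@weight_ge0 R) mi) := ii.
  by move=> H; apply: eq_integrable H => // x _; rewrite /comp Im_W.
Qed.

Let W_integral z : 0 < complex.Im z ->
  cintegral sg setT (fun t : R => 1 / (t%:C - z)) = cintegral nu D (W z).
Proof.
move=> z0; have [mr mi] := cmeasurable_cauchy z.
apply: eqC; rewrite /cintegral /= Rintegral_wimage//; apply: eq_Rintegral => x _.
- by rewrite Re_W.
- by rewrite Im_W.
Qed.

Let shift_integrable : cintegrable nu D (fun x => (i - (tcoord x)%:C) / 2).
Proof.
rewrite (_ : (fun x => _) = fun x => 2^-1 * (i - (tcoord x)%:C)); last first.
  by apply/funext => x; rewrite mulrC.
apply: cintegrableZl => //; apply: cintegrableB => //.
  split; (apply: limit_measure_integrable => //; move=> x; exact: cvg_cst).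
apply: cintegrable_real => //.
move: (weight_integrable nf df); apply: le_integrable => //.
  by apply/measurable_EFinP/measurable_funTS; exact: measurable_tcoord.
by move=> x _; rewrite lee_fin (le_trans (tcoord_le x))// ler_norm.
Qed.

Let A : C := cintegral nu D (fun x => (i - (tcoord x)%:C) / 2) - i * (on_disc f 0)^*%C.

Let spectral_const z : 0 < complex.Im z ->
  f z = A + cintegral sg setT (fun t : R => 1 / (t%:C - z)).
Proof.
move=> z0; have w1 := normc_uncayley z0; have := herglotz_formula nf w1.
have ik : cintegrable nu D (fun x => cis x / (cis x - uncayley z)).
  split; (apply: limit_measure_integrable => // x;
    by have [] := rcont_continuous (kernel_rcont x w1)).
have fz : i * on_disc f (uncayley z) = f z.
  by rewrite /on_disc uncayleyK// mulrA mulrN -expr2 sqr_i opprK mul1r.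
move=> /(congr1 (fun u => i * u)); rewrite mulrDr fz -cintegralZl// => e.
rewrite W_integral// /A addrAC -cintegralD//; last exact: W_integrable.
rewrite -[LHS](addrK (i * (on_disc f 0)^*%C)) -e; congr (_ - _).
apply: (eq_cintegral_off _ _ (herglotz_infty0 nf df)).
- exact: mD.
- exact: measurable_infty.
- exact: cintegrable_cmeasurable (cintegrableZl _ _ ik).
- apply: cintegrable_cmeasurable; apply: cintegrableD; [by []|exact: shift_integrable|].
  exact: W_integrable.
- move=> x Dx nE; apply: kernel_cauchy => //; apply/eqP => c0; exact: nE.
Qed.

(** By the kernel identity, [f] is a Cauchy transform up to a constant. Along the
    imaginary axis both functions are [O(1 / y)], so the constant is zero. *)
Lemma spectral_upper z : 0 < complex.Im z ->
  f z = cintegral sg setT (fun t : R => 1 / (t%:C - z)).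
Proof.
move=> z0; rewrite (spectral_const z0); suff -> : A = 0 by rewrite add0r.
have [K [Y h]] := df; pose S := \int[sg]_(t in setT) (1 : R).
have S0 : 0 <= S by apply: Rintegral_ge0.
have bnd y : Y <= y -> 0 < y -> y * normc A <= K + S.
  move=> Yy y0; have z0' : 0 < complex.Im (0 +i* y) by [].
  have -> : A = f (0 +i* y) - cintegral sg setT (fun t : R => 1 / (t%:C - (0 +i* y))).
    by rewrite spectral_const// addrK.
  apply: (le_trans (ler_wpM2l (ltW y0) (normcD _ _))); rewrite mulrDr normcN'.
  apply: lerD; first exact: h.
  rewrite mulrC -ler_pdivlMr//.
  apply: (le_trans (normc_cintegral_le _ (cauchy_integrable z0')
    (spectral_cst_integrable y^-1) _)) => //.
    by move=> t _; exact: normc_cauchy_le.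
  have := @RintegralZl _ _ _ sg setT (fun=> 1) y^-1 measurableT (spectral_cst_integrable 1).
  by rewrite -/S mulr1 => ->; rewrite mulrC.
apply/eqP; rewrite -normc_eq0; apply/eqP/le_anti; rewrite normc_ge0 andbT.
rewrite leNgt; apply/negP => nA.
pose y := Num.max (Num.max 1 Y) ((`|K| + S + 1) / normc A).
have y1 : 1 <= y by rewrite !le_max lexx.
have Yy : Y <= y by rewrite !le_max lexx orbT.
have := bnd y Yy (lt_le_trans ltr01 y1); apply/negP; rewrite -ltNge.
have : (`|K| + S + 1) / normc A <= y by rewrite le_max lexx orbT.
rewrite ler_pdivrMr// => h1; apply: lt_le_trans h1; have := ler_norm K; lra.
Qed.

End SpectralMeasure.

(** * Identity theorem on the slit plane *)

Section Identity.
Variable R : realType.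
Local Notation C := R[i].
Local Notation normc := (@Normc.normc R).
Implicit Types (g h : C -> C) (z w p : C) (r : R).

Lemma circle_bounded h r : 0 <= r -> (forall z, normc z = r -> ccont h z) ->
  exists M, forall x, - pi <= x <= pi -> normc (h (r%:C * cis x)) <= M.
Proof.
move=> r0 ch; have Npipi : - pi <= pi :> R by rewrite ge0_cp ?pi_ge0.
apply: (@bisection2 R (fun _ _ c d => exists M, forall x, c <= x <= d ->
  normc (h (r%:C * cis x)) <= M) 0 0 (- pi) pi) => //.
  move=> a b c d _ _ _ _ _ _ [M1 h1] _ [M2 h2] _.
  exists (Num.max M1 M2) => x /andP[cx xd]; rewrite le_max.
  have [xm|/ltW mx] := leP x ((c + d) / 2).
  - by rewrite h1// cx.
  - by rewrite h2 ?orbT// mx.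
move=> x0 y _ _; have [d d0 hd] := rcont_circle y r0 ch ltr01.
exists d => // a b c' d' _ _ _ _ _ cy yd _ _ dc.
exists (1 + normc (h (r%:C * cis y))) => x /andP[cx xd].
have xy : `|x - y| < d by apply: (le_lt_trans _ dc); rewrite ler_norml; lra.
rewrite -[X in normc X](subrK (h (r%:C * cis y))).
by apply: (le_trans (normcD _ _)); rewrite lerD2r ltW// hd.
Qed.

(** If [g] vanishes near [p], then [g / (z - p)^n] is still differentiable, and
    Cauchy's estimate for it makes [g] smaller than every geometric sequence. *)
Lemma identity_disc g p Rad d : 0 < d ->
  (forall z, normc (z - p) < Rad -> derivable g z 1) ->
  (forall z, normc (z - p) < d -> g z = 0) ->
  forall z, normc (z - p) < Rad -> g z = 0.
Proof.
move=> d0 dg g0 z zR; pose k u := g (p + u).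
have dk u : normc u < Rad -> derivable k u 1.
  move=> uR; apply: holo_comp; first by apply: dg; rewrite addrC addKr.
  by apply: holoD; [exact: holo_cst|exact: holo_id].
have k0 u : normc u < d -> k u = 0 by move=> ud; apply: g0; rewrite addrC addKr.
set w := z - p in zR; have -> : g z = k w by rewrite /k /w addrC subrK.
have [wd|dw] := ltP (normc w) d; first exact: k0.
have w0 : 0 < normc w by exact: lt_le_trans dw.
pose r := (normc w + Rad) / 2.
have wr : normc w < r by rewrite /r; lra.
have rR : r < Rad by rewrite /r; lra.
have r0 : 0 < r by exact: lt_trans wr.
have [M hM] : exists M, forall x, - pi <= x <= pi -> normc (k (r%:C * cis x)) <= M.
  by apply: circle_bounded; [exact: ltW|move=> u ur; apply: derivable_ccont; apply: dk; rewrite ur].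
have bound n : normc (k w) <= `|M| * (r / (r - normc w)) * (normc w / r) ^+ n.
  pose kn u := k u / u ^+ n.
  have dkn u : normc u < Rad -> derivable kn u 1.
    move=> uR; have [u0|un0] := eqVneq u 0.
      apply: (@eq_holo R (fun _ : C => (0 : C)) kn u d d0).
        by move=> v; rewrite u0 subr0 => /k0; rewrite /kn => ->; rewrite mul0r.
      exact: (@holo_cst R 0 u).
    apply: holoM; first exact: dk.
    apply: holoV; first by rewrite expf_neq0.
    by apply: holoX; exact: holo_id.
  have hkn x : - pi <= x <= pi -> normc (kn (r%:C * cis x)) <= `|M| / r ^+ n.
    move=> xpi; rewrite /kn normcM normcV normcX normc_polar ?(ltW r0)//.
    apply: ler_wpM2r; first by rewrite invr_ge0 exprn_ge0// ltW.
    by apply: (le_trans (hM _ xpi)); rewrite ler_norm.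
  have := cauchy_bound_itv dkn wr rR hkn.
  rewrite /kn normcM normcV normcX ler_pdivrMr ?exprn_gt0// => h.
  apply: (le_trans h); rewrite [(normc w / r) ^+ n]expr_div_n.
  rewrite [X in X <= _](_ : _ = `|M| * (r / (r - normc w)) * (normc w ^+ n / r ^+ n))//.
  by move: (r ^+ n)^-1 (normc w ^+ n) (r / (r - normc w)) => a b c; ring.
apply/eqP; rewrite -normc_eq0; apply/eqP/le_anti; rewrite normc_ge0 andbT.
set K := `|M| * _ in bound.
have q1 : `|normc w / r| < 1.
  have q0 : 0 <= normc w / r by apply: divr_ge0; [exact: normc_ge0|exact: ltW].
  by rewrite (ger0_norm q0) ltr_pdivrMr// mul1r.
have cv : (fun n => K * (normc w / r) ^+ n) @ \oo --> (0 : R).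
  rewrite -[X in _ --> X](mulr0 K); apply: cvgM; first exact: cvg_cst.
  exact: cvg_expr.
by apply: (cvgr_to_ge cv); exact: nearW.
Qed.

Variable alpha : R.
Local Notation slit_plane := (@slit_plane R alpha).

Lemma slit_planeP z : slit_plane z <-> complex.Im z != 0 \/ complex.Re z < alpha.
Proof.
split=> [zs|].
  apply: contrapT => /not_orP[/negP]; rewrite negbK => /eqP zi /negP.
  rewrite -leNgt => zr; apply: zs => /=; exists (complex.Re z).
    by rewrite in_itv /= andbT.
  by apply: eqC.
move=> h [t /= + tz]; rewrite in_itv /= andbT => at_.
by case: h; rewrite -tz /= ?eqxx// ltNge at_.
Qed.

(** From the upper half-plane, one disc in [Re z < alpha] and one in the lower
    half-plane reach every point of the slit plane. *)
Lemma identity_slit g : (forall z, slit_plane z -> derivable g z 1) ->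
  (forall z, 0 < complex.Im z -> g z = 0) -> forall z, slit_plane z -> g z = 0.
Proof.
move=> dg g0.
have left z : complex.Re z < alpha -> g z = 0.
  move=> za; pose e := alpha - complex.Re z; pose v := complex.Im z.
  have e0 : 0 < e by rewrite subr_gt0.
  (* the discs about [(alpha - L) + i] with radius [L] exhaust [Re z < alpha] *)
  pose L := (e ^+ 2 + (v - 1) ^+ 2) / e + 1.
  have L0 : 0 < L.
    apply: ltr_wpDl => //; apply: divr_ge0; last exact: ltW.
    by apply: addr_ge0; exact: sqr_ge0.
  pose p : C := (alpha - L) +i* 1.
  apply: (@identity_disc g p L 1) => //.
  - move=> u up; apply: dg; apply/slit_planeP; right.
    have := le_lt_trans (Re_le_normc _) up; rewrite ReD ReN /= ltr_norml => /andP[_].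
    by rewrite opprB; lra.
  - move=> u up; apply: g0.
    have := le_lt_trans (Im_le_normc _) up; rewrite ImD ImN /= ltr_norml => /andP[+ _].
    by lra.
  - rewrite -(ltr_pXn2r (_ : (0 < 2)%N)) ?nnegrE ?normc_ge0 ?(ltW L0)// sqr_normc'.
    rewrite ReD ImD ReN ImN /= -/v.
    have Le : L * e = e ^+ 2 + (v - 1) ^+ 2 + e by rewrite /L mulrDl mul1r divfK// gt_eqF.
    have -> : complex.Re z - (alpha - L) = L - e by rewrite /e; ring.
    have -> : (L - e) ^+ 2 = L ^+ 2 - 2 * (L * e) + e ^+ 2 by ring.
    rewrite Le; have := sqr_ge0 e; have := sqr_ge0 (v - 1); lra.
move=> z /slit_planeP[zi|]; last exact: left.
have [zlt|zgt] := ltP (complex.Im z) 0; last first.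
  by apply: g0; rewrite lt_neqAle eq_sym zi.
pose e := - complex.Im z; pose v := complex.Re z - (alpha - 1).
have e0 : 0 < e by rewrite oppr_gt0.
pose L := (e ^+ 2 + v ^+ 2) / e + 1.
have L0 : 0 < L.
    apply: ltr_wpDl => //; apply: divr_ge0; last exact: ltW.
    by apply: addr_ge0; exact: sqr_ge0.
pose p : C := (alpha - 1) +i* (- L).
apply: (@identity_disc g p L 1) => //.
- move=> u up; apply: dg; apply/slit_planeP; left.
  have := le_lt_trans (Im_le_normc _) up; rewrite ImD ImN /= opprK ltr_norml => /andP[_].
  by move=> h; rewrite lt_eqF//; lra.
- move=> u up; apply: left.
  have := le_lt_trans (Re_le_normc _) up; rewrite ReD ReN /= ltr_norml => /andP[_].
  by lra.
- rewrite -(ltr_pXn2r (_ : (0 < 2)%N)) ?nnegrE ?normc_ge0 ?(ltW L0)// sqr_normc'.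
  rewrite ReD ImD ReN ImN /= -/v opprK.
  have Le : L * e = e ^+ 2 + v ^+ 2 + e by rewrite /L mulrDl mul1r divfK// gt_eqF.
  have -> : complex.Im z + L = L - e by rewrite /e; ring.
  have -> : (L - e) ^+ 2 = L ^+ 2 - 2 * (L * e) + e ^+ 2 by ring.
  rewrite Le; have := sqr_ge0 e; have := sqr_ge0 v; lra.
Qed.

End Identity.

(** * Stieltjes functions as Cauchy transforms *)
Section CauchyTransform.
Variable R : realType.
Local Notation C := R[i].
Local Notation normc := (@Normc.normc R).
Implicit Types (z w : C) (x y t : R).
Variables (alpha : R) (m : {measure set R -> \bar R}).
Hypothesis mfin : (m setT < +oo)%E.
Local Notation H := (@halfline R alpha).

Lemma measurable_halfline : measurable H.
Proof. exact: measurable_itv. Qed.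

Let mA_fin (A : set R) : measurable A -> (m A < +oo)%E.
Proof. by move=> mA; apply: le_lt_trans mfin; apply: le_measure; rewrite ?inE. Qed.

Lemma integrable_cst_fin (A : set R) (c : R) : measurable A ->
  m.-integrable A (EFin \o (fun=> c)).
Proof.
move=> mA; apply: measurable_bounded_integrable => //; first exact: mA_fin.
exact: bounded_cst.
Qed.

Lemma bounded_cintegrable (A : set R) (g : R -> C) (c : R) : measurable A ->
  cmeasurable A g -> (forall t, A t -> normc (g t) <= c) -> cintegrable m A g.
Proof.
by move=> mA mg gc; apply: (cintegrable_dom mA mg (integrable_cst_fin c mA)).
Qed.

Lemma cmeasurable_subset (A : set R) (g : R -> C) : measurable A ->
  cmeasurable setT g -> cmeasurable A g.
Proof. by move=> mA [gr gi]; split; exact: measurable_funTS. Qed.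

Let upper_integrable z : 0 < complex.Im z ->
  cintegrable m setT (fun t : R => 1 / (t%:C - z)).
Proof.
move=> z0; apply: (@bounded_cintegrable _ _ (complex.Im z)^-1) => //.
  exact: cmeasurable_cauchy.
by move=> t _; exact: normc_cauchy_le.
Qed.

Lemma Im_cauchy z t : complex.Im (1 / (t%:C - z)) =
  complex.Im z / ((t - complex.Re z) ^+ 2 + complex.Im z ^+ 2).
Proof. by rewrite div1r Im_inv sqr_normc' !ReD !ImD !ReN !ImN /= add0r opprK sqrrN. Qed.

(** On [[x - y, x + y]] the imaginary part of the Cauchy kernel at [x + i y] is at
    least [1 / (2 y)]. *)
Lemma mass_le_Im x y : 0 < y ->
  fine (m `]x - y, x + y]%classic) <=
  2 * y * complex.Im (cintegral m setT (fun t : R => 1 / (t%:C - (x +i* y)))).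
Proof.
move=> y0; rewrite /cintegral /=; set I := `]x - y, x + y]%classic.
have mI : measurable I by exact: measurable_itv.
have [_ iIm] : cintegrable m setT (fun t : R => 1 / (t%:C - (x +i* y))) by exact: upper_integrable.
have y2 : 0 < 2 * y by rewrite mulr_gt0.
rewrite -ler_pdivrMl// -Rintegral_cst//; apply: fine_le.
- by apply: integrable_fin_num => //; exact: integrable_cst_fin.
- exact: integrable_fin_num.
apply: (@le_trans _ _ (\int[m]_(t in I) (complex.Im (1 / (t%:C - (x +i* y))))%:E)%E).
  apply: ge0_le_integral => //.
  - by move=> t _; rewrite lee_fin invr_ge0 ltW.
  - apply/measurable_EFinP/measurable_funTS.
    by have [_] := cmeasurable_cauchy (x +i* y).
  - move=> t; rewrite /I /= in_itv /= => /andP[t1 t2]; rewrite lee_fin [leRHS](Im_cauchy (x +i* y) t) /=.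
    have d0 : 0 < (t - x) ^+ 2 + y ^+ 2 by rewrite ltr_wpDl ?sqr_ge0// exprn_gt0.
    rewrite ler_pdivlMr// mulrC ler_pdivrMr//.
    have : (t - x) ^+ 2 <= y ^+ 2.
      rewrite -subr_ge0 (_ : _ - _ = (y - (t - x)) * (y + (t - x))); last by ring.
      by apply: mulr_ge0; lra.
    by rewrite !expr2; lra.
apply: ge0_subset_integral => //; first by have /integrableP[] := iIm.
move=> t _; rewrite lee_fin [leRHS](Im_cauchy (x +i* y) t) /= divr_ge0 ?(ltW y0)//.
by rewrite addr_ge0 ?sqr_ge0.
Qed.

(** Where the boundary values are real there is no mass: by the previous bound
    the distribution function has derivative zero there. *)
Lemma support_halfline (f : C -> C) :
  (forall z, 0 < complex.Im z ->
     f z = cintegral m setT (fun t : R => 1 / (t%:C - z))) ->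
  (forall x, x < alpha -> complex.Im (f x%:C) = 0 /\ ccont f x%:C) ->
  m (~` H) = 0%E.
Proof.
move=> fm fx.
(* bisection turns the local bound [mass <= e * length] into a global one *)
have null a b : a <= b -> b < alpha -> m `]a, b]%classic = 0%E.
  move=> ab ba.
  have fin c d : m `]c, d]%classic \is a fin_num.
    by rewrite ge0_fin_numE ?measure_ge0//; apply: mA_fin; exact: measurable_itv.
  suff small e : 0 < e -> fine (m `]a, b]%classic) <= e * (b - a).
    rewrite -(fineK (fin a b)); congr _%:E; apply/le_anti; rewrite fine_ge0 ?measure_ge0// andbT.
    apply/ler_addgt0Pl => e e0; rewrite addr0.
    have k0 : 0 < b - a + 1 by rewrite ltr_wpDl// subr_ge0.
    apply: (le_trans (small _ (divr_gt0 e0 k0))).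
    rewrite mulrAC ler_pdivrMr// ler_pM2l// lerDl; lra.
  move=> e0.
  apply: (@bisection2 R (fun _ _ c d => fine (m `]c, d]%classic) <= e * (d - c)) 0 0 a b) => //.
    move=> a' b' c d _ _ _ _ cd _ h1 _ h2 _.
    have /andP[cm md] : c <= (c + d) / 2 <= d by rewrite !midf_le.
    rewrite (@itv_bndbnd_setU _ _ _ (BRight ((c + d) / 2))) ?bnd_simp//.
    rewrite measureU//; last first.
      apply/seteqP; split => // t [/=]; rewrite !in_itv/= => /andP[_ yx] /andP[].
      by rewrite ltNge yx.
    rewrite fineD ?fin//; apply: (le_trans (lerD h1 h2)).
    by rewrite -mulrDr ler_pM2l//; lra.
  move=> x0 x _ /andP[ax xb]; have xa : x < alpha by exact: le_lt_trans ba.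
  have [f0 cf] := fx _ xa; have [d d0 hd] := cf _ (divr_gt0 e0 (ltr0Sn R 1)).
  exists d => // a' b' c' d' _ _ _ _ _ cy yd _ _ dc.
  have [->|cd] := eqVneq c' d'.
    by rewrite set_itv_ge ?bnd_simp -?leNgt// measure0 subrr mulr0.
  have y0 : 0 < d' - c' by rewrite subr_gt0 lt_neqAle cd (le_trans cy yd).
  have := mass_le_Im x y0; rewrite -fm// => hm.
  have Imf : complex.Im (f (x +i* (d' - c'))) <= e / 2.
    apply: ltW; apply: le_lt_trans (hd (x +i* (d' - c')) _); last first.
      rewrite (_ : _ - _ = 'i%C * (d' - c')%:C); last first.
        by apply: eqC; rewrite ?ReD ?ImD ?ReM ?ImM ?ReN ?ImN /=; ring.
      by rewrite normcM normci mul1r normcR gtr0_norm.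
    by apply: le_trans (Im_le_normc _); rewrite ImD ImN f0 subr0 ler_norm.
  apply: (@le_trans _ _ (fine (m `]x - (d' - c'), x + (d' - c')]%classic))).
    apply: fine_le; rewrite ?fin//; apply: le_measure; rewrite ?inE//.
    by apply: subset_itv; rewrite bnd_simp; lra.
  apply: (le_trans hm); rewrite [e * _]mulrC -mulrA [X in X <= _]mulrCA.
  by rewrite ler_pM2l// mulrC -ler_pdivlMr.
have -> : ~` H = \bigcup_n `]alpha - n.+2%:R, alpha - n.+1%:R^-1]%classic.
  apply/seteqP; split => x /=.
    rewrite /halfline /= in_itv /= andbT => /negP; rewrite -ltNge => xa.
    have ax : 0 < alpha - x by rewrite subr_gt0.
    pose n := maxn (Num.truncn (alpha - x)) (Num.truncn (alpha - x)^-1).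
    exists n => //=; rewrite in_itv /=; apply/andP; split.
      have : alpha - x < n.+2%:R.
        apply: (lt_trans (truncnS_gt _)); rewrite ltr_nat ltnS ltnS.
        exact: leq_maxl.
      by rewrite ltrBlDr -ltrBlDl.
    have : (alpha - x)^-1 <= n.+1%:R.
      by apply: ltW; apply: (lt_le_trans (truncnS_gt _)); rewrite ler_nat ltnS leq_maxr.
    rewrite -[X in _ <= X]invrK lef_pV2 ?posrE ?invr_gt0// => h.
    by rewrite lerBrDr -lerBrDl.
  move=> [n _] /=; rewrite in_itv /= /halfline /= in_itv /= andbT => /andP[_ xn].
  apply/negP; rewrite -ltNge.
  by apply: (le_lt_trans xn); rewrite gtrBl invr_gt0.
apply/eqP; rewrite eq_le measure_ge0 andbT.
apply: (@le_trans _ _ (\sum_(n <oo) m `](alpha - n.+2%:R)%R, (alpha - n.+1%:R^-1)%R]%classic)%E).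
  apply: measure_sigma_subadditive => //.
  by apply: bigcup_measurable => k _; exact: measurable_itv.
rewrite eseries0// => n _ _.
have n1 : n.+1%:R^-1 <= 1 :> R by rewrite invf_le1// ler1n.
have n2 : (1 : R) <= n.+2%:R by rewrite ler1n.
have n0 : 0 < n.+1%:R^-1 :> R by rewrite invr_gt0.
apply: null; last by rewrite gtrBl.
by rewrite lerB// (le_trans n1).
Qed.

Lemma cintegral_halfline (g : R -> C) : m (~` H) = 0%E -> cintegrable m setT g ->
  cintegral m setT g = cintegral m H g.
Proof.
move=> m0 [gr gi]; have mH := measurable_halfline; have mC := measurableC mH.
have HE : setT `\` ~` H = H by rewrite setDE setCK setTI.
by rewrite /cintegral /Rintegral; congr (_ +i* _); congr fine;
  rewrite (negligible_integral mC measurableT _ m0) ?HE.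
Qed.

Lemma slit_dist z : slit_plane alpha z ->
  exists2 d, 0 < d & forall t, alpha <= t -> d <= normc (t%:C - z).
Proof.
move=> /slit_planeP[zi|zr].
  exists `|complex.Im z|; first by rewrite normr_gt0.
  by move=> t _; apply: le_trans (Im_le_normc _); rewrite ImD ImN /= add0r normrN.
exists (alpha - complex.Re z); first by rewrite subr_gt0.
move=> t at_; apply: le_trans (Re_le_normc _); rewrite ReD ReN /=.
by apply: le_trans (ler_norm _); lra.
Qed.

Definition cauchy_transform z : C := cintegral m H (fun t : R => 1 / (t%:C - z)).

Lemma cauchy_slit_integrable z : slit_plane alpha z ->
  cintegrable m H (fun t : R => 1 / (t%:C - z)).
Proof.
move=> /slit_dist[d d0 hd]; have mH := measurable_halfline.
apply: (@bounded_cintegrable _ _ d^-1) => //.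
  exact: cmeasurable_subset (cmeasurable_cauchy z).
move=> t; rewrite /halfline /= in_itv /= andbT => /hd ht.
by rewrite div1r normcV lef_pV2// posrE (lt_le_trans d0).
Qed.

(** The difference quotient of the Cauchy kernel is uniformly close to its
    derivative over the half-line, as [z] has a positive distance to it. *)
Lemma cauchy_transform_holo z : slit_plane alpha z -> derivable cauchy_transform z 1.
Proof.
move=> zs; have [d d0 hd] := slit_dist zs; have mH := measurable_halfline.
have tz t : H t -> d <= normc (t%:C - z).
  by rewrite /halfline /= in_itv /= andbT => /hd.
have i2 : cintegrable m H (fun t : R => (1 / (t%:C - z)) * (1 / (t%:C - z))).
  apply: (@bounded_cintegrable _ _ (d^-1 * d^-1)) => //.
    apply: cmeasurableM; exact: cmeasurable_subset (cmeasurable_cauchy z).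
  move=> t /tz ht; rewrite normcM div1r normcV.
  have nt : 0 < normc (t%:C - z) by exact: lt_le_trans ht.
  by apply: ler_pM; rewrite ?invr_ge0 ?normc_ge0// lef_pV2.
pose K := \int[m]_(t in H) (2 * d^-1 ^+ 3).
have K0 : 0 <= K.
  by apply: Rintegral_ge0 => t _; rewrite mulr_ge0// exprn_ge0// invr_ge0 ltW.
apply/derivable_normcP; exists (cintegral m H (fun t : R => (1 / (t%:C - z)) * (1 / (t%:C - z)))).
move=> e e0; have K1 : 0 < K + 1 by rewrite ltr_wpDl.
exists (Num.min (d / 2) (e / (K + 1))); first by rewrite lt_min !divr_gt0.
move=> w; rewrite lt_min => /andP[wd we].
have tw t : H t -> d / 2 <= normc (t%:C - w).
  move=> /tz ht; have : normc (t%:C - z) <= normc (t%:C - w) + normc (w - z).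
    by rewrite (_ : t%:C - z = (t%:C - w) + (w - z)) ?normcD//; ring.
  by move: ht wd; lra.
have iw : cintegrable m H (fun t : R => 1 / (t%:C - w)).
  apply: (@bounded_cintegrable _ _ (d / 2)^-1) => //.
    exact: cmeasurable_subset (cmeasurable_cauchy w).
  move=> t /tw ht; rewrite div1r normcV lef_pV2// posrE ?divr_gt0//.
  by apply: lt_le_trans ht; rewrite divr_gt0.
have iz := cauchy_slit_integrable zs.
rewrite /cauchy_transform mulrC -cintegralZl// -!cintegralB//; last 2 first.
- exact: cintegrableB.
- exact: cintegrableZl.
have bnd t : H t -> normc (1 / (t%:C - w) - 1 / (t%:C - z) -
    (w - z) * (1 / (t%:C - z) * (1 / (t%:C - z)))) <=
    normc (w - z) ^+ 2 * (2 * d^-1 ^+ 3).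
  move=> Ht; have h1 := tz _ Ht; have h2 := tw _ Ht.
  have nz : 0 < normc (t%:C - z) by exact: lt_le_trans h1.
  have d2 : 0 < d / 2 by rewrite divr_gt0.
  have nw : 0 < normc (t%:C - w) by exact: lt_le_trans h2.
  have z0 : t%:C - z != 0 by rewrite -normc_gt0.
  have w0 : t%:C - w != 0 by rewrite -normc_gt0.
  have -> : 1 / (t%:C - w) - 1 / (t%:C - z) -
      (w - z) * (1 / (t%:C - z) * (1 / (t%:C - z))) =
      (w - z) ^+ 2 * ((t%:C - w)^-1 * ((t%:C - z)^-1 * (t%:C - z)^-1)).
    by field; rewrite z0 w0.
  rewrite normcM normcX ler_wpM2l ?sqr_ge0//.
  rewrite !normcM !normcV.
  have -> : 2 * d^-1 ^+ 3 = (d / 2)^-1 * (d^-1 * d^-1) by field; rewrite gt_eqF.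
  by do 2?[apply: ler_pM; rewrite ?mulr_ge0 ?invr_ge0 ?normc_ge0 ?lef_pV2//].
have ib : m.-integrable H (EFin \o (fun=> normc (w - z) ^+ 2 * (2 * d^-1 ^+ 3))).
  exact: integrable_cst_fin.
apply: (le_trans (normc_cintegral_le mH _ ib bnd)).
  by apply: cintegrableB => //; [exact: cintegrableB|exact: cintegrableZl].
rewrite RintegralZl//; last exact: integrable_cst_fin.
rewrite -/K expr2 mulrAC -mulrA [X in _ <= X]mulrC ler_wpM2l ?normc_ge0//.
have := ltW we; rewrite ler_pdivlMr//; have := normc_ge0 (w - z).
rewrite mulrDr mulr1 [K * _]mulrC; lra.
Qed.

End CauchyTransform.

Section ScalarStieltjes.
Variable R : realType.
Local Notation C := R[i].
Local Notation normc := (@Normc.normc R).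
Implicit Types (f g : C -> C) (z : C).
Variable alpha : R.

(** The scalar functions [v^* F v] for [F] in the class [classS]; of the
    nonnegativity below [alpha] only reality is kept. *)
Definition scalar_class f :=
  [/\ forall z, slit_plane alpha z -> derivable f z 1,
      forall z, 0 < complex.Im z -> 0 <= complex.Im (f z) &
      forall x : R, x < alpha -> complex.Im (f x%:C) = 0].

Lemma upper_slit z : 0 < complex.Im z -> slit_plane alpha z.
Proof. by move=> z0; apply/slit_planeP; left; rewrite gt_eqF. Qed.

Lemma scalar_nevanlinna f : scalar_class f -> nevanlinna f.
Proof. by move=> [df f0 _]; split => // z /upper_slit/df. Qed.

(** The representation on the upper half-plane extends to the slit plane by the
    identity theorem, once the measure is known to be carried by the half-line. *)
Theorem scalar_representation f (nf : nevanlinna f) : scalar_class f -> decays f ->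
  spectral nf (~` @halfline R alpha) = 0%E /\
  forall z, slit_plane alpha z -> f z = cauchy_transform alpha (spectral nf) z.
Proof.
move=> [df f0 fr] dc; have fu := spectral_upper nf dc.
have mfin := spectral_finite nf dc.
have s0 : spectral nf (~` @halfline R alpha) = 0%E.
  apply: (@support_halfline R alpha _ mfin f fu) => x xa; split; first exact: fr.
  by apply: derivable_ccont; apply: df; apply/slit_planeP; right.
split => // z zs; set g := cauchy_transform alpha _.
have dg u : slit_plane alpha u -> derivable g u 1 by exact: cauchy_transform_holo.
have gu u : 0 < complex.Im u -> f u - g u = 0.
  move=> u0; have ui := cauchy_integrable nf dc u0.
  by rewrite (fu u u0) (cintegral_halfline s0 ui) subrr.
have dD u : slit_plane alpha u -> derivable (fun z => f z - g z) u 1.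
  by move=> us; apply: holoB; [exact: df|exact: dg].
by apply/eqP; rewrite -subr_eq0; apply/eqP; exact: (identity_slit dD gu zs).
Qed.

End ScalarStieltjes.

(** * Moments and asymptotic expansions *)
Section CauchyExpansion.
Variable R : realType.
Local Notation C := R[i].
Local Notation normc := (@Normc.normc R).
Implicit Types (z : C) (t y : R).

(** The expansion of the Cauchy kernel in a finite geometric sum, with its exact
    remainder [t^k / (t - z)]. *)
Lemma cauchy_expansion (mu : {measure set R -> \bar R}) (D : set R) (W : R -> C) k z :
  measurable D -> z != 0 -> (forall t, D t -> t%:C - z != 0) ->
  cintegrable mu D (fun t => 1 / (t%:C - z) * W t) ->
  (forall j, (j < k)%N -> cintegrable mu D (fun t => t%:C ^+ j * W t)) ->
  cintegrable mu D (fun t => t%:C ^+ k * (1 / (t%:C - z) * W t)) /\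
  cintegral mu D (fun t => t%:C ^+ k * (1 / (t%:C - z) * W t)) =
    z ^+ k * (cintegral mu D (fun t => 1 / (t%:C - z) * W t) +
      \sum_(j < k) z ^- j.+1 * cintegral mu D (fun t => t%:C ^+ j * W t)).
Proof.
move=> mD z0 tz i0; elim: k => [|k IHk] ij.
  rewrite big_ord0 addr0 expr0 mul1r.
  by under eq_fun do rewrite expr0 mul1r.
have [|ik Ik] := IHk; first by move=> j jk; apply: ij; rewrite ltnS ltnW.
have E t : D t -> t%:C ^+ k.+1 * (1 / (t%:C - z) * W t) =
    t%:C ^+ k * W t + z * (t%:C ^+ k * (1 / (t%:C - z) * W t)).
  by move=> Dt; rewrite exprS; field; exact: tz.
have iz : cintegrable mu D (fun t => z * (t%:C ^+ k * (1 / (t%:C - z) * W t))).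
  exact: cintegrableZl.
have iw := ij k (ltnSn k).
split.
  apply: (eq_cintegrable mD (f := fun t => t%:C ^+ k * W t + z * (t%:C ^+ k * (1 / (t%:C - z) * W t)))).
    by move=> t Dt; rewrite E.
  exact: cintegrableD.
rewrite (eq_cintegral _ E) (cintegralD mD iw iz) cintegralZl// Ik big_ord_recr /=.
set S := \sum_(j < k) _; set J := cintegral _ _ _; set L := cintegral _ _ _.
rewrite addrA [in RHS]mulrDr [X in _ = _ + X]mulrA (divff (expf_neq0 _ z0)) mul1r.
by rewrite [LHS]addrC exprS !mulrA.
Qed.

(** Bounds [|t / (t - i y)|] for all [y >= n + 1]. Sequential dominated
    convergence for it thus gives limits over real [y]. *)
Definition truncation n t : R := Num.min 1 (`|t| / n.+1%:R).

Lemma dominated_small (mu : {measure set R -> \bar R}) (D : set R) (h : R -> R) :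
  measurable D -> mu.-integrable D (EFin \o h) -> (forall t, D t -> 0 <= h t) ->
  forall e, 0 < e -> exists n, 
    mu.-integrable D (EFin \o (fun t => h t * truncation n t)) /\
    \int[mu]_(t in D) (h t * truncation n t) < e.
Proof.
move=> mD ih h0 e e0.
have tr01 n t : 0 <= truncation n t <= 1.
  by rewrite /truncation le_min ler01 divr_ge0//= ge_min lexx.
have mt n : measurable_fun D (truncation n).
  apply: measurable_minr; first exact: measurable_cst.
  by apply: measurable_funM => //; exact: measurable_funTS.
have mh : measurable_fun D h by apply/measurable_EFinP; exact: measurable_int ih.
have mf n : measurable_fun D (fun t => (h t * truncation n t)%:E).
  by apply/measurable_EFinP; exact: measurable_funM.
have cf t : D t -> (fun n => (h t * truncation n t)%:E) @ \oo --> 0%E.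
  move=> Dt; apply: cvg_EFin; first by apply: nearW.
  rewrite -[X in _ --> X](mulr0 (h t)); apply: cvgM; first exact: cvg_cst.
  apply: (@squeeze_cvgr _ _ _ _ (cst 0) (fun n => `|t| * n.+1%:R^-1)).
  - by apply: nearW => n; have /andP[-> _] := tr01 n t; rewrite ge_min lexx orbT.
  - exact: cvg_cst.
  - rewrite -[X in _ --> X](mulr0 `|t|); apply: cvgM; first exact: cvg_cst.
    exact: cvg_harmonic.
have bd n t : D t -> (`| (h t * truncation n t)%:E | <= (h t)%:E)%E.
  move=> Dt; rewrite lee_fin; have /andP[u0 u1] := tr01 n t.
  by rewrite ger0_norm ?mulr_ge0 ?h0// ler_piMr ?h0.
have ii n : mu.-integrable D (EFin \o (fun t => h t * truncation n t)).
  apply: (le_integrable mD (mf n) _ ih) => t Dt.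
  have := bd n t Dt; rewrite !lee_fin /= => /le_trans; apply.
  by rewrite ler_norm.
have hfin t : D t -> (h t)%:E \is a fin_num by [].
have cv := @dominated_cvg _ _ _ mu D mD _ _ _ mf cf hfin ih bd.
rewrite integral0 in cv.
move/fine_cvgP : cv => [_ /cvgr0Pnorm_lt/(_ _ e0)[n _ /(_ n (leqnn n))]] /=.
move=> hn; exists n; split => //.
by apply: le_lt_trans hn; exact: ler_norm.
Qed.

Definition vanishes (g : R -> C) := forall e : R, 0 < e ->
  exists Y : R, forall y, Y <= y -> 0 < y -> normc (g y) < e.

Lemma le_truncation n t y (u : R) : n.+1%:R <= y -> 0 < y -> 0 <= u ->
  u ^+ 2 * (t ^+ 2 + y ^+ 2) <= t ^+ 2 -> u <= truncation n t.
Proof.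
move=> ny y0 u0 h; rewrite /truncation le_min; apply/andP; split.
  have d0 : 0 < t ^+ 2 + y ^+ 2 by rewrite ltr_wpDl ?sqr_ge0// exprn_gt0.
  rewrite -(@ler_pXn2r _ 2)// ?nnegrE// expr1n.
  rewrite -(ler_pM2r d0) mul1r; apply: (le_trans h).
  by rewrite lerDl sqr_ge0.
apply: (@le_trans _ _ (`|t| / y)); last first.
  by rewrite ler_wpM2l// lef_pV2// posrE.
rewrite ler_pdivlMr// -(@ler_pXn2r _ 2)// ?nnegrE ?mulr_ge0 ?(ltW y0)//.
rewrite real_normK ?num_real// exprMn; apply: le_trans h.
by rewrite ler_wpM2l ?sqr_ge0// lerDr sqr_ge0.
Qed.

Lemma iy_neq0 y : 0 < y -> 0 +i* y != 0 :> C.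
Proof. by move=> y0; rewrite -normc_gt0 (lt_le_trans _ (Im_le_normc _))//= normr_gt0 gt_eqF. Qed.

Lemma subiy_neq0 t y : 0 < y -> t%:C - (0 +i* y) != 0.
Proof.
move=> y0; rewrite -normc_gt0 (lt_le_trans _ (Im_le_normc _))//.
by rewrite ImD ImN /= add0r normrN normr_gt0 gt_eqF.
Qed.

Lemma remainder_vanishes (mu : {measure set R -> \bar R}) (D : set R) (V : R -> C) :
  measurable D -> cintegrable mu D V ->
  vanishes (fun y => cintegral mu D (fun t => t%:C * (1 / (t%:C - (0 +i* y)) * V t))).
Proof.
move=> mD iV e e0; have iN := cintegrable_normc mD iV.
have [n [inn hn]] := dominated_small mD iN (fun t _ => normc_ge0 (V t)) e0.
exists n.+1%:R => y ny y0.
have bd t : D t -> normc (t%:C * (1 / (t%:C - (0 +i* y)) * V t)) <= normc (V t) * truncation n t.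
  move=> _; rewrite mulrA normcM mulrC ler_wpM2l ?normc_ge0//.
  apply: (le_truncation ny y0); first exact: normc_ge0.
  rewrite normcM div1r normcV normcR exprMn exprVn real_normK ?num_real//.
  rewrite sqr_normc' ReD ReN ImD ImN /= subr0 add0r sqrrN -mulrA mulVf ?mulr1//.
  by rewrite gt_eqF// ltr_wpDl ?sqr_ge0// exprn_gt0.
apply: (le_lt_trans _ hn); apply: normc_cintegral_le => //.
apply: (cintegrable_dom mD _ inn bd).
apply: cmeasurableM => //.
  by apply: cmeasurable_real; exact: measurable_id.
apply: cmeasurableM => //; last exact: cintegrable_cmeasurable iV.
exact: cmeasurable_subset (cmeasurable_cauchy _).
Qed.

Lemma vanishes_scale_iV g : vanishes g -> vanishes (fun y => (0 +i* y)^-1 * g y).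
Proof.
move=> vg e e0; have [Y hY] := vg e e0.
exists (Num.max Y 1) => y; rewrite ge_max => /andP[Yy y1] y0.
rewrite normcM normcV; apply: le_lt_trans (hY y Yy y0).
rewrite ler_piMl ?normc_ge0// invf_le1 ?normc_gt0 ?iy_neq0//.
by apply: (le_trans y1); apply: (le_trans _ (Im_le_normc _)) => /=; exact: ler_norm.
Qed.

Lemma vanishes_iV (c : C) : vanishes (fun y => (0 +i* y)^-1 * c).
Proof.
move=> e e0; exists ((normc c + 1) / e) => y; rewrite ler_pdivrMr// => h y0.
have ny : y <= normc (0 +i* y).
  by apply: (le_trans _ (Im_le_normc _)) => /=; exact: ler_norm.
rewrite normcM normcV mulrC ltr_pdivrMr ?normc_gt0 ?iy_neq0//.
have : y * e <= e * normc (0 +i* y) by rewrite mulrC ler_pM2l.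
by lra.
Qed.

Lemma vanishesB g h : vanishes g -> vanishes h -> vanishes (fun y => g y - h y).
Proof.
move=> vg vh e e0; have e2 : 0 < e / 2 by rewrite divr_gt0.
have [Y hY] := vg _ e2; have [Z hZ] := vh _ e2.
exists (Num.max Y Z) => y; rewrite ge_max => /andP[Yy Zy] y0.
apply: le_lt_trans (normcD _ _) _; rewrite normcN'.
by have := hY y Yy y0; have := hZ y Zy y0; lra.
Qed.

Definition expansion_error (f : C -> C) (s : nat -> C) k y : C :=
  (0 +i* y) ^+ k.+1 *
    (f (0 +i* y) + \sum_(j < k.+1) (0 +i* y) ^- j.+1 * s j).

(** Dividing by [i y] turns the leading coefficient of the longer expansion into a
    vanishing term. *)
Lemma expansion_error_pred f s k : vanishes (expansion_error f s k.+1) ->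
  vanishes (expansion_error f s k).
Proof.
move=> v e e0.
have [Y hY] := vanishesB (vanishes_scale_iV v) (vanishes_iV (s k.+1)) e0.
exists Y => y Yy y0; apply: le_lt_trans (hY y Yy y0); rewrite le_eqVlt; apply/orP; left.
apply/eqP; congr (Normc.normc _).
rewrite /expansion_error [in RHS]big_ord_recr /=.
have z0 := iy_neq0 y0; set z := _ +i* _ in z0 *; set S := \sum_(j < _) _.
set a := f z; set b := s _; rewrite (exprS z k.+1).
have zk : z ^+ k.+1 != 0 by rewrite expf_neq0.
by set w := z ^+ _ in zk *; field; rewrite z0 zk.
Qed.

Lemma expansion_error_le f s k N : (k <= N)%N -> vanishes (expansion_error f s N) ->
  vanishes (expansion_error f s k).
Proof.
move=> /subnK <-; elim: (N - k)%N => [|n IHn] //= v.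
by apply: IHn; apply: expansion_error_pred.
Qed.

Lemma vanishes_decays f s k : vanishes (expansion_error f s k) -> decays f.
Proof.
move=> /(expansion_error_le (leq0n k)) /(_ 1 ltr01)[Y hY].
exists (1 + normc (s 0%N)), Y => y Yy y0.
have := hY y Yy y0; rewrite /expansion_error big_ord1 expr1 => h.
have z0 := iy_neq0 y0.
have -> : y * normc (f (0 +i* y)) = normc ((0 +i* y) * f (0 +i* y)).
  rewrite normcM; congr (_ * _); rewrite /= expr0n /= add0r.
  by rewrite sqrtr_sqr ger0_norm// ltW.
have -> : (0 +i* y) * f (0 +i* y) =
    (0 +i* y) * (f (0 +i* y) + (0 +i* y)^-1 * s 0%N) - s 0%N.
  by rewrite mulrDr mulVKf// addrK.
by apply: (le_trans (normcD _ _)); rewrite normcN' lerD2r ltW.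
Qed.

End CauchyExpansion.

Section HamburgerNevanlinna.
Variable R : realType.
Local Notation C := R[i].
Local Notation normc := (@Normc.normc R).
Implicit Types (z : C) (t y : R).
Variables (alpha : R) (m : {measure set R -> \bar R}).
Hypothesis mfin : (m setT < +oo)%E.
Local Notation H := (@halfline R alpha).
Variable s : nat -> R.

(** Minus the real part of [z / (t - z)] at [z = i y]; it increases to [1] with
    [y]. *)
Definition moment_kernel y t : R := y ^+ 2 / (t ^+ 2 + y ^+ 2).

Let mH : measurable H := measurable_halfline alpha.

Let den_gt0 y t : 0 < y -> 0 < t ^+ 2 + y ^+ 2.
Proof. by move=> y0; rewrite ltr_wpDl ?sqr_ge0// exprn_gt0. Qed.

Let moment_kernel_ge0 y t : 0 <= moment_kernel y t.
Proof. by rewrite /moment_kernel divr_ge0 ?addr_ge0 ?sqr_ge0. Qed.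

Let Re_cauchy_iy y t : complex.Re ((0 +i* y) * (1 / (t%:C - (0 +i* y)))) = - moment_kernel y t.
Proof.
rewrite ReM (Im_cauchy (0 +i* y) t) /= mul0r sub0r subr0 /moment_kernel expr2.
by rewrite -mulrA.
Qed.

Let measurable_moment_kernel y : measurable_fun setT (moment_kernel y).
Proof.
have [mr _] := @cmeasurableM _ _ R setT (fun=> - (0 +i* y))
  (fun t : R => 1 / (t%:C - (0 +i* y))) (cmeasurable_cst _ _) (cmeasurable_cauchy (0 +i* y)).
by apply: eq_measurable_fun mr => t _; rewrite mulNr ReN Re_cauchy_iy opprK.
Qed.

Let measurable_pow k : measurable_fun setT (fun t : R => t ^+ k).
Proof. exact: exprn_measurable. Qed.

(** When the moments of order below [k] are known, the expansion of order [k] says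
    that [z] times the integral of [t^k / (t - z)] tends to [- s k]; its real part
    only involves a positive kernel. *)
Lemma moment_step k :
  (forall j, (j < k)%N -> m.-integrable H (EFin \o (fun t => t ^+ j)) /\
     \int[m]_(t in H) t ^+ j = s j) ->
  vanishes (expansion_error (cauchy_transform alpha m) (fun j => (s j)%:C) k) ->
  forall e, 0 < e -> exists Y : R, forall y, Y <= y -> 0 < y ->
    m.-integrable H (EFin \o (fun t => t ^+ k * moment_kernel y t)) /\
    `|s k - \int[m]_(t in H) (t ^+ k * moment_kernel y t)| < e.
Proof.
move=> ij v e e0; have [Y hY] := v e e0; exists Y => y Yy y0.
have := hY y Yy y0; rewrite /expansion_error; set z := 0 +i* y => h.
have z0 : z != 0 by exact: iy_neq0.
have zs : slit_plane alpha z by apply: upper_slit.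
have i1 : cintegrable m H (fun t : R => 1 / (t%:C - z) * 1).
  by under eq_fun do rewrite mulr1; exact: cauchy_slit_integrable.
have i2 j : (j < k)%N -> cintegrable m H (fun t : R => t%:C ^+ j * 1).
  move=> /ij[ir _]; apply: (eq_cintegrable mH (f := fun t => (t ^+ j)%:C)).
    by move=> t _; rewrite rmorphXn mulr1.
  exact: cintegrable_real.
have [ik Ik] := cauchy_expansion mH z0 (fun t _ => subiy_neq0 t y0) i1 i2.
have E1 : cintegral m H (fun t : R => 1 / (t%:C - z) * 1) = cauchy_transform alpha m z.
  by apply: eq_cintegral => t _; rewrite mulr1.
have E2 : \sum_(j < k) z ^- j.+1 * cintegral m H (fun t : R => t%:C ^+ j * 1) =
    \sum_(j < k) z ^- j.+1 * (s j)%:C.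
  apply: eq_bigr => j _; congr (_ * _).
  rewrite -(ij j (ltn_ord j)).2 -cintegral_real.
  by apply: eq_cintegral => t _; rewrite rmorphXn mulr1.
rewrite E1 E2 in Ik.
have iz := cintegrableZl mH z ik.
have EP t : complex.Re (z * (t%:C ^+ k * (1 / (t%:C - z) * 1))) =
    - (t ^+ k * moment_kernel y t).
  rewrite mulr1 mulrCA -rmorphXn ReM [complex.Re (z * _)](Re_cauchy_iy y t) /=.
  by rewrite mul0r subr0 mulrN.
have ip : m.-integrable H (EFin \o (fun t => t ^+ k * moment_kernel y t)).
  have [ir _] := iz.
  have := integrable_RZl mH (-1) ir.
  apply: eq_integrable => // t _; rewrite /= EP mulN1r.
  by rewrite opprK.
split=> //.
have EI : complex.Re (z * cintegral m H (fun t : R => t%:C ^+ k * (1 / (t%:C - z) * 1))) =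
    - \int[m]_(t in H) (t ^+ k * moment_kernel y t).
  rewrite -cintegralZl// /cintegral /=.
  rewrite -[RHS]mulN1r -RintegralZl//.
  by apply: eq_Rintegral => t _; rewrite EP mulN1r.
apply: le_lt_trans h.
apply: le_trans (Re_le_normc _); rewrite big_ord_recr /=.
have -> : z ^+ k.+1 * (cauchy_transform alpha m z +
    (\sum_(i < k) z ^- i.+1 * (s i)%:C + z ^- k.+1 * (s k)%:C)) =
   z * cintegral m H (fun t : R => t%:C ^+ k * (1 / (t%:C - z) * 1)) + (s k)%:C.
  rewrite Ik; set f := cauchy_transform _ _ _; set S := \sum_(j < _) _.
  rewrite addrA mulrDr [X in _ + X = _]mulrA (divff (expf_neq0 _ z0)) mul1r.
  by rewrite exprS mulrA.
by rewrite ReD EI /= addrC.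
Qed.

(** The powers of [t] are bounded below on the half-line, so monotone convergence
    turns a bound on the Poisson averages into integrability. *)
Lemma integrable_of_averages k (B Y : R) :
  (forall y, Y <= y -> 0 < y ->
    m.-integrable H (EFin \o (fun t => t ^+ k * moment_kernel y t)) /\
    \int[m]_(t in H) (t ^+ k * moment_kernel y t) <= B) ->
  m.-integrable H (EFin \o (fun t => t ^+ k)).
Proof.
move=> hB; pose c := `|alpha| ^+ k.
have c0 t : H t -> 0 <= t ^+ k + c.
  rewrite /halfline /= in_itv /= andbT => ta.
  have [t0|t0] := leP 0 t; first by rewrite addr_ge0 ?exprn_ge0.
  rewrite -lerBlDr sub0r; apply: lerNnormlW; rewrite normrX.
  apply: lerXn2r; rewrite ?nnegrE// (ltr0_norm t0) ler0_norm ?lerN2//.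
  exact: le_trans ta (ltW t0).
have ic : m.-integrable H (EFin \o (fun=> c)) by exact: integrable_cst_fin.
pose g n t : \bar R := ((t ^+ k + c) * moment_kernel n.+1%:R t)%:E.
have g0 n t : H t -> (0 <= g n t)%E.
  by move=> Ht; rewrite lee_fin mulr_ge0 ?c0.
have mg n : measurable_fun H (g n).
  apply/measurable_EFinP/measurable_funTS; apply: measurable_funM => //.
  by apply: measurable_funD.
have ndg t : H t -> {homo g^~ t : n n' / (n <= n')%N >-> (n <= n')%E}.
  move=> Ht n n' nn'; rewrite lee_fin ler_wpM2l ?c0// /moment_kernel.
  rewrite ler_pdivrMr ?den_gt0// mulrAC ler_pdivlMr ?den_gt0//.
  have : n.+1%:R ^+ 2 <= n'.+1%:R ^+ 2 :> R by rewrite ler_pXn2r ?nnegrE// ler_nat.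
  set a := n.+1%:R ^+ 2; set b := n'.+1%:R ^+ 2 => ab.
  rewrite !mulrDr [b * a]mulrC lerD2r ler_wpM2r ?sqr_ge0//.
have lg t : H t -> limn (g^~ t) = (t ^+ k + c)%:E.
  move=> Ht; apply/cvg_lim => //; apply: cvg_EFin; first by apply: nearW.
  rewrite -[X in _ --> X]mulr1; apply: cvgM; first exact: cvg_cst.
  have pE n : moment_kernel n.+1%:R t = 1 - t ^+ 2 * (t ^+ 2 + n.+1%:R ^+ 2)^-1.
    rewrite /moment_kernel; have := den_gt0 t (ltr0Sn R n); set a := n.+1%:R => /lt0r_neq0 d.
    by rewrite -(divff d) -mulrBl [t ^+ 2 + _]addrC addrK.
  have -> : (fun n => moment_kernel n.+1%:R t) =
      (fun n => 1 - t ^+ 2 * (t ^+ 2 + n.+1%:R ^+ 2)^-1) by apply/funext.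
  rewrite -[X in _ --> X]subr0 -(mulr0 (t ^+ 2)).
  apply: cvgB; first exact: cvg_cst.
  apply: cvgM; first exact: cvg_cst.
  apply: (@squeeze_cvgr _ _ _ _ (cst 0) (fun n => n.+1%:R^-1)).
  - apply: nearW => n; rewrite invr_ge0 ltW ?den_gt0//=.
    rewrite lef_pV2 ?posrE ?den_gt0//.
    apply: (@le_trans _ _ (n.+1%:R ^+ 2)); last by rewrite lerDr sqr_ge0.
    by rewrite -natrX ler_nat expnS leq_pmulr// expn_gt0.
  - exact: cvg_cst.
  - exact: cvg_harmonic.
have Bg n : Y <= n.+1%:R -> (\int[m]_(t in H) g n t <= (B + c * fine (m H))%:E)%E.
  move=> Yn; have [ip pB] := hB _ Yn (ltr0Sn R n).
  have icp : m.-integrable H (EFin \o (fun t => c * moment_kernel n.+1%:R t)).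
    apply: (le_integrable mH _ _ ic).
      by apply/measurable_EFinP/measurable_funTS; exact: measurable_funM.
    move=> t Ht; rewrite lee_fin normrM ler_piMr// ger0_norm//.
    by rewrite /moment_kernel ler_pdivrMr ?den_gt0// mul1r lerDr sqr_ge0.
  have c00 : 0 <= c by rewrite exprn_ge0.
  have -> : (\int[m]_(t in H) g n t)%E = (\int[m]_(t in H) (t ^+ k * moment_kernel n.+1%:R t) +
      \int[m]_(t in H) (c * moment_kernel n.+1%:R t))%:E.
    rewrite -RintegralD// /Rintegral fineK.
      by apply: eq_integral => t _; rewrite /g mulrDl.
    apply: integrable_fin_num => //.
    exact: (integrable_RD mH ip icp).
  rewrite lee_fin lerD// -Rintegral_cst//.
  apply: le_Rintegral => // t Ht; rewrite ler_piMr//.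
  by rewrite /moment_kernel ler_pdivrMr ?den_gt0// mul1r lerDr sqr_ge0.
have ib : m.-integrable H (EFin \o (fun t => t ^+ k + c)).
  apply/integrableP; split.
    by apply/measurable_EFinP/measurable_funTS/measurable_funD.
  have -> : (\int[m]_(x in H) `|(EFin \o (fun t => (t ^+ k + c)%R)) x| =
      \int[m]_(x in H) limn (g^~ x))%E.
    by apply: eq_integral => t; rewrite inE => Ht; rewrite lg//= ger0_norm ?c0.
  apply: (@le_lt_trans _ _ (B + c * fine (m H))%:E); last exact: ltry.
  have cv := @cvg_monotone_convergence _ _ _ m _ mH g mg g0 ndg.
  rewrite -(cvg_lim _ cv)//; apply: lime_le; first by apply/cvg_ex; eexists; exact: cv.
  exists (Num.truncn Y) => // n /= nY; apply: Bg.
  by apply: ltW; apply: (lt_le_trans (truncnS_gt _)); rewrite ler_nat ltnS.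
have inc := integrable_RZl mH (-1) ic.
have := integrable_RD mH ib inc; apply: eq_integrable => // t _ /=.
by rewrite mulN1r addrK.
Qed.

(** The moments are obtained one after the other: the averages of [t^k] converge,
    so [t^k] is integrable, and then dominated convergence identifies the limit of
    the averages as the moment. *)
Theorem hamburger_nevanlinna N :
  vanishes (expansion_error (cauchy_transform alpha m) (fun j => (s j)%:C) N) ->
  forall k, (k <= N)%N -> m.-integrable H (EFin \o (fun t => t ^+ k)) /\
    \int[m]_(t in H) t ^+ k = s k.
Proof.
move=> v k; have [n kn] := ubnP k; elim: n k kn => // n IHn k kn kN.
have lower j : (j < k)%N -> m.-integrable H (EFin \o (fun t => t ^+ j)) /\
    \int[m]_(t in H) t ^+ j = s j.
  move=> jk; apply: IHn; first exact: leq_trans jk _.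
  exact: leq_trans (ltnW jk) kN.
have step := moment_step lower (expansion_error_le kN v).
have ik : m.-integrable H (EFin \o (fun t => t ^+ k)).
  have [Y hY] := step 1 ltr01.
  apply: (@integrable_of_averages k (s k + 1) Y) => y Yy y0.
  have [ip lp] := hY y Yy y0; split => //.
  by move: lp; rewrite distrC ltr_norml => /andP[_]; lra.
split=> //; apply/eqP; rewrite -subr_eq0 -normr_eq0; apply/eqP/le_anti.
rewrite normr_ge0 andbT; apply/ler_addgt0Pl => e e0; rewrite addr0.
have e2 : 0 < e / 2 by rewrite divr_gt0.
have [Y hY] := step _ e2.
have ia := integrable_Rnorm ik.
(* [1 - moment_kernel y t] is at most the truncation [|t| / y] *)
have [l [il hl]] := dominated_small mH ia (fun t _ => normr_ge0 (t ^+ k)) e2.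
pose y := Num.max Y l.+1%:R.
have yl : l.+1%:R <= y by rewrite le_max lexx orbT.
have y0 : 0 < y by apply: lt_le_trans yl.
have [ip lp] := hY y ltac:(by rewrite le_max lexx) y0.
suff : `|\int[m]_(t in H) t ^+ k - \int[m]_(t in H) (t ^+ k * moment_kernel y t)| < e / 2.
  move=> h2; rewrite (_ : _ - s k = (\int[m]_(t in H) t ^+ k -
    \int[m]_(t in H) (t ^+ k * moment_kernel y t)) -
    (s k - \int[m]_(t in H) (t ^+ k * moment_kernel y t))); last by ring.
  by apply: (le_trans (ler_normB _ _)); move: h2 lp; lra.
have iB : m.-integrable H (EFin \o (fun t => t ^+ k - t ^+ k * moment_kernel y t)).
  have := integrable_RD mH ik (integrable_RZl mH (-1) ip).
  by apply: eq_integrable => // t _ /=; rewrite mulN1r.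
rewrite -RintegralB//; apply: le_lt_trans hl.
apply: (le_trans (le_normr_Rintegral mH iB)).
apply: le_Rintegral => //; first exact: (integrable_Rnorm iB).
move=> t _; rewrite -[X in `|X - _|]mulr1 -mulrBr normrM ler_wpM2l//.
have d0 := den_gt0 t y0; have dn : t ^+ 2 + y ^+ 2 != 0 by rewrite gt_eqF.
have -> : 1 - moment_kernel y t = t ^+ 2 / (t ^+ 2 + y ^+ 2) by rewrite /moment_kernel; field.
apply: (le_truncation yl y0) => //; rewrite real_normK ?num_real//.
have -> : (t ^+ 2 / (t ^+ 2 + y ^+ 2)) ^+ 2 * (t ^+ 2 + y ^+ 2) =
    t ^+ 2 * (t ^+ 2 / (t ^+ 2 + y ^+ 2)) by field.
by rewrite ler_piMr ?sqr_ge0// ler_pdivrMr// mul1r lerDl sqr_ge0.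
Qed.

End HamburgerNevanlinna.

(** * Linear relations between spectral measures *)

Section SpectralRelations.
Variable R : realType.
Local Notation C := R[i].
Implicit Types (f g h : C -> C) (z : C).

Lemma nevanlinna0 : nevanlinna (fun=> 0 : C).
Proof. by split=> [z _|z _]; [exact: holo_cst|]. Qed.

Lemma nevanlinnaD f g : nevanlinna f -> nevanlinna g ->
  nevanlinna (fun z => f z + g z).
Proof.
move=> [df f0] [dg g0]; split=> z z0; first by apply: holoD; [exact: df|exact: dg].
by rewrite ImD addr_ge0 ?f0 ?g0.
Qed.

Lemma nevanlinnaZ (c : R) f : 0 <= c -> nevanlinna f ->
  nevanlinna (fun z => c%:C * f z).
Proof.
move=> c0 [df f0]; split=> z z0; first by apply: holoM; [exact: holo_cst|exact: df].
by rewrite ImM /= mul0r addr0 mulr_ge0 ?f0.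
Qed.

Lemma nevanlinna_sum (I : Type) (r : seq I) (a : I -> R) (f : I -> C -> C) :
  (forall i, 0 <= a i) -> (forall i, nevanlinna (f i)) ->
  nevanlinna (fun z => \sum_(i <- r) (a i)%:C * f i z).
Proof.
move=> a0 nf; elim: r => [|i r IHr].
  by under eq_fun do rewrite big_nil; exact: nevanlinna0.
under eq_fun do rewrite big_cons.
by apply: nevanlinnaD => //; exact: nevanlinnaZ.
Qed.

Lemma spectral_sum (I : Type) (r : seq I) (a : I -> R) (f : I -> C -> C)
  (nf : forall i, nevanlinna (f i)) g (ng : nevanlinna g) :
  (forall i, 0 <= a i) ->
  (forall z, 0 < complex.Im z -> g z = \sum_(i <- r) (a i)%:C * f i z) ->
  forall A, measurable A ->
    spectral ng A = (\sum_(i <- r) (a i)%:E * spectral (nf i) A)%E.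
Proof.
move=> a0; elim: r g ng => [|i r IHr] g ng gE A mA.
  rewrite big_nil (@spectralZ R g g 0 ng ng) ?mul0e// => z z0.
  by rewrite gE// big_nil mul0r.
have nr := nevanlinna_sum r a0 nf.
have ni := nevanlinnaZ (a0 i) (nf i).
rewrite big_cons (@spectralD R _ _ _ ni nr ng)//; last first.
  by move=> z z0; rewrite gE// big_cons.
by rewrite (@spectralZ R _ _ _ (nf i) ni (a0 i))// (IHr _ nr).
Qed.

(** The sign of the coefficients can be arbitrary: the negative ones are moved
    to the other side, where additivity applies. *)
Lemma spectral_relation (I : finType) (a : I -> R) (f : I -> C -> C)
  (nf : forall i, nevanlinna (f i)) g (ng : nevanlinna g) :
  (forall i, decays (f i)) -> decays g ->
  (forall z, 0 < complex.Im z -> g z = \sum_i (a i)%:C * f i z) ->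
  forall A, measurable A ->
    fine (spectral ng A) = \sum_i a i * fine (spectral (nf i) A).
Proof.
move=> df dg gE A mA.
have fin h (nh : nevanlinna h) : decays h -> spectral nh A \is a fin_num.
  move=> dh; rewrite ge0_fin_numE ?measure_ge0//.
  apply: le_lt_trans (spectral_finite nh dh).
  by apply: le_measure; rewrite ?inE.
(* positive and negative parts of the coefficients *)
pose b i := Num.max (a i) 0; pose c i := Num.max (- a i) 0.
have b0 i : 0 <= b i by rewrite le_max lexx orbT.
have c0 i : 0 <= c i by rewrite le_max lexx orbT.
have abc i : a i = b i - c i.
  rewrite /b /c; have [a0|a0] := leP (a i) 0; last by rewrite max_r ?subr0// oppr_le0 ltW.
  by rewrite max_l ?oppr_ge0// sub0r opprK.
have nb := nevanlinna_sum (index_enum I) b0 nf.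
have nc := nevanlinna_sum (index_enum I) c0 nf.
have sb := spectral_sum nf nb b0 (fun z _ => erefl) mA.
have sc := spectral_sum nf nc c0 (fun z _ => erefl) mA.
have bgc z : 0 < complex.Im z ->
    \sum_i (b i)%:C * f i z = g z + \sum_i (c i)%:C * f i z.
  move=> z0; rewrite gE// -big_split /=.
  by apply: eq_bigr => i _; rewrite -mulrDl -rmorphD abc subrK.
have sg := spectralD ng nc nb bgc mA.
have E (d : I -> R) : (\sum_i (d i)%:E * spectral (nf i) A)%E =
    (\sum_i d i * fine (spectral (nf i) A))%:E.
  by rewrite -sumEFin; apply: eq_bigr => i _; rewrite EFinM fineK ?fin.
move: sg; rewrite sb sc !E -(fineK (fin _ ng dg)) -EFinD => -[e].
under eq_bigr do rewrite abc mulrBl.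
by rewrite sumrB e addrK.
Qed.

End SpectralRelations.

(** * Quadratic forms and polarization *)

Section QuadraticForms.
Variable R : realType.
Local Notation C := R[i].
Local Notation normc := (@Normc.normc R).
Variable q : nat.
Implicit Types (A B : 'M[C]_q) (u v : 'cV[C]_q) (i j : 'I_q).
Local Open Scope sesquilinear_scope.

Definition qform v A : C := (v ^t* *m A *m v) 0 0.

Lemma qformE v A : qform v A = \sum_j \sum_i (v i 0)^*%C * A i j * v j 0.
Proof.
rewrite /qform mxE; apply: eq_bigr => j _; rewrite mxE mulr_suml.
by apply: eq_bigr => i _; rewrite !mxE.
Qed.

Lemma qformD v A B : qform v (A + B) = qform v A + qform v B.
Proof. by rewrite /qform mulmxDr mulmxDl mxE. Qed.

Lemma qformZ v (c : C) A : qform v (c *: A) = c * qform v A.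
Proof. by rewrite /qform -scalemxAr -scalemxAl mxE. Qed.

Lemma qform_adj v A : qform v (A ^t*) = (qform v A)^*%C.
Proof.
rewrite !qformE rmorph_sum exchange_big /=; apply: eq_bigr => i _.
rewrite rmorph_sum; apply: eq_bigr => j _.
rewrite !rmorphM /= conjcK !mxE mulrAC -mulrA mulrC -!mulrA; congr (_ * _).
Qed.

(** All four phases are needed: signs alone would only recover the real part of
    [A i j] for Hermitian [A]. *)
Definition polar i j (k : 'I_4) : 'cV[C]_q :=
  delta_mx j 0 + ('i%C ^+ k) *: delta_mx i 0.

Lemma delta_star i : (delta_mx i 0 : 'cV[C]_q) ^t* = delta_mx 0 i.
Proof. by rewrite trmx_delta map_delta_mx. Qed.

Lemma qform_delta i A : qform (delta_mx i 0) A = A i i.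
Proof. by rewrite /qform delta_star -rowE -colE !mxE. Qed.

Lemma qform_polar i j k A : qform (polar i j k) A =
  A j j + A i i + 'i%C ^+ k * A j i + (- 'i%C) ^+ k * A i j.
Proof.
have star : (polar i j k) ^t* = (delta_mx 0 j : 'rV[C]_q) +
    (- 'i%C) ^+ k *: (delta_mx 0 i : 'rV[C]_q).
  have ci : - 'i%C = Num.conj ('i%C : C) by apply: eqC; rewrite /= ?oppr0.
  rewrite -!delta_star ci.
  by apply/matrixP => a b; rewrite !mxE rmorphD rmorphM rmorphXn.
rewrite /qform star /polar !mulmxDl !mulmxDr -!scalemxAl -!scalemxAr.
rewrite -!rowE -!colE !mxE.
have ik : (- 'i%C) ^+ k * 'i%C ^+ k = 1 :> C.
  rewrite -exprMn; suff -> : (- 'i%C * 'i%C : C) = 1 by rewrite expr1n.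
  by apply: eqC; rewrite ?ReM ?ImM /=; ring.
rewrite mulrA ik mul1r; set x := A i i; set y := A j j.
by set p := _ * A j i; set r := _ * A i j; ring.
Qed.

Definition polar_weight (k : 'I_4) : C := 'i%C ^+ k / 4%:R.

(** Averaging over the fourth roots of unity kills all terms of [qform_polar] but
    the last. Unlike the real polarization identity, it applies to matrices that
    are not Hermitian, such as the values of [F]. *)
Lemma polarization i j A :
  A i j = \sum_k polar_weight k * qform (polar i j k) A.
Proof.
under eq_bigr do rewrite qform_polar.
rewrite !big_ord_recl big_ord0 /polar_weight /=.
have I2 : ('i%C : C) ^+ 2 = -1 by exact: sqr_i.
rewrite /bump /= [in LHS](_ : A i j = 4 * A i j / 4); last by field.
set x := A j j; set y := A i i; set p := A j i; set r := A i j.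
move: I2; set I := 'i%C => I2.
have I3 : I ^+ 3 = - I by rewrite exprS I2 mulrN1.
have N2 : (- I) ^+ 2 = -1 by rewrite sqrrN.
have N3 : (- I) ^+ 3 = I by rewrite exprS N2 mulrN1 opprK.
rewrite !expr0 !expr1 N2 N3 I2 I3.
have E2 : I * I = -1 by rewrite -expr2.
have -> : 1 / 4 * (x + y + 1 * p + 1 * r) + (I / 4 * (x + y + I * p + - I * r) +
   (- 1 / 4 * (x + y + -1 * p + -1 * r) + (- I / 4 * (x + y + - I * p + I * r) + 0))) =
   (2 * p + 2 * r + (I * I) * (2 * p - 2 * r)) / 4 by field.
by rewrite E2; field.
Qed.

Definition polar_index := ('I_q * 'I_q * 'I_4)%type.

Definition polar_vec (t : polar_index) := polar t.1.1 t.1.2 t.2.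

Definition polar_coef v (t : polar_index) : C :=
  (v t.1.1 0)^*%C * v t.1.2 0 * polar_weight t.2.

Lemma sum_polar v (G : 'I_q -> 'I_q -> 'I_4 -> C) :
  \sum_j \sum_i (v i 0)^*%C * (\sum_k polar_weight k * G i j k) * v j 0 =
  \sum_(t : polar_index) polar_coef v t * G t.1.1 t.1.2 t.2.
Proof.
rewrite exchange_big /=.
rewrite (pair_bigA _ (fun i j => (v i 0)^*%C * (\sum_k polar_weight k * G i j k) * v j 0)) /=.
transitivity (\sum_p \sum_k polar_coef v (p, k) * G p.1 p.2 k).
  apply: eq_bigr => p _; rewrite mulrAC mulr_sumr; apply: eq_bigr => k _.
  by rewrite mulrA.
by rewrite (pair_bigA _ (fun p k => polar_coef v (p, k) * G p.1 p.2 k)).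
Qed.

Lemma qform_expand v A :
  qform v A = \sum_t polar_coef v t * qform (polar_vec t) A.
Proof.
rewrite -(sum_polar v (fun i j k => qform (polar i j k) A)) qformE.
by apply: eq_bigr => j _; apply: eq_bigr => i _; rewrite -polarization.
Qed.

(** Applied to [A] and to its adjoint, the expansion has its coefficients
    conjugated; hence their real parts suffice. *)
Lemma qform_expand_conj v A :
  qform v A = \sum_t (polar_coef v t)^*%C * qform (polar_vec t) A.
Proof.
have := qform_expand v (A ^t*); rewrite qform_adj => /(congr1 (@conjc R)).
rewrite conjcK => ->; rewrite rmorph_sum; apply: eq_bigr => t _.
by rewrite rmorphM /= qform_adj conjcK.
Qed.

Lemma qform_expand_Re v A :
  qform v A = \sum_t (complex.Re (polar_coef v t))%:C * qform (polar_vec t) A.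
Proof.
have -> : qform v A = (qform v A + qform v A) / 2 by field.
rewrite {1}qform_expand qform_expand_conj -big_split /= mulr_suml.
apply: eq_bigr => t _; rewrite -mulrDl mulrAC; congr (_ * _).
by case: (polar_coef v t) => x y; apply: eqC; rewrite ?ReM ?ImM ?ReD ?ImD /=;
  rewrite ?Re_inv ?Im_inv ?sqr_normc' /=; field.
Qed.

Lemma qform_expand_Im v A :
  \sum_t (complex.Im (polar_coef v t))%:C * qform (polar_vec t) A = 0.
Proof.
have /eqP := qform_expand v A; rewrite {1}qform_expand_Re eq_sym -subr_eq0 -sumrB.
have -> : \sum_t (polar_coef v t * qform (polar_vec t) A -
    (complex.Re (polar_coef v t))%:C * qform (polar_vec t) A) =
    'i%C * \sum_t (complex.Im (polar_coef v t))%:C * qform (polar_vec t) A.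
  rewrite mulr_sumr; apply: eq_bigr => t _; rewrite -mulrBl mulrA; congr (_ * _).
  by case: (polar_coef v t) => x y; apply: eqC; rewrite ?ReM ?ImM ?ReD ?ImD ?ReN ?ImN /=; ring.
by rewrite mulf_eq0 => /orP[|/eqP//]; rewrite -normc_eq0 normci oner_eq0.
Qed.

Lemma hermitian_of_real A : (forall v, complex.Im (qform v A) = 0) ->
  A \is hermsymmx.
Proof.
move=> h; apply/is_hermitianmxP; rewrite expr0 scale1r; apply/matrixP => i j.
rewrite [LHS]polarization [RHS]polarization; apply: eq_bigr => k _.
rewrite qform_adj; congr (_ * _); apply: eqC; first by case: (qform _ _).
by move: (h (polar i j k)); case: (qform _ _) => x y /= ->; rewrite oppr0.
Qed.

Lemma Im_qform_hermitian v A : A \is hermsymmx -> complex.Im (qform v A) = 0.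
Proof.
move/is_hermitianmxP; rewrite expr0 scale1r => AE.
have := qform_adj v A; rewrite -AE; case: (qform v A) => x y /= [] /eqP.
by rewrite -addr_eq0 -mulr2n mulrn_eq0 => /eqP.
Qed.

Lemma nnhermitianP A : nnhermitian A <->
  forall v, complex.Im (qform v A) = 0 /\ 0 <= complex.Re (qform v A).
Proof.
split=> [[hA A0] v|h].
  by have := A0 v; rewrite -/(qform v A) lecE /= => /andP[/eqP].
split; first by apply: hermitian_of_real => v; have [] := h v.
by move=> v; rewrite -/(qform v A) lecE /=; have [-> ->] := h v; rewrite eqxx.
Qed.

Lemma qform_immx v A : qform v (immx A) = (complex.Im (qform v A))%:C.
Proof.
rewrite /immx qformZ qformD -scaleN1r qformZ qform_adj.
have I0 : 2 * 'i%C != 0 :> C by rewrite mulf_neq0 ?pnatr_eq0// -normc_eq0 normci oner_eq0.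
apply: (mulfI I0); rewrite mulVKf//.
by case: (qform v A) => x y; apply: eqC; rewrite ?ReM ?ImM ?ReD ?ImD ?ReM ?ImM /=; ring.
Qed.

End QuadraticForms.

(** * Spectral measures as finite measures *)
Section FiniteSpectral.
Variable R : realType.
Local Notation C := R[i].

(** The decay, which makes the measure finite, is an argument so that the finite
    measure structure can be attached to the function. *)
Definition spectral_fin (f : C -> C) (nf : nevanlinna f) (df : decays f) :
  set R -> \bar R := spectral nf.

HB.instance Definition _ f (nf : nevanlinna f) (df : decays f) :=
  Measure.on (spectral_fin nf df).

Let spectral_fin_fin f (nf : nevanlinna f) (df : decays f) :
  fin_num_fun (spectral_fin nf df).
Proof.
move=> A mA; rewrite ge0_fin_numE ?measure_ge0//.
apply: le_lt_trans (spectral_finite nf df).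
by apply: le_measure; rewrite ?inE.
Qed.

HB.instance Definition _ f (nf : nevanlinna f) (df : decays f) :=
  @Measure_isFinite.Build _ _ _ (spectral_fin nf df) (spectral_fin_fin nf df).

End FiniteSpectral.

(** * Densities of one measure with respect to another *)
Section Density.
Variable R : realType.
Local Notation C := R[i].
Variables (nu mu : {finite_measure set R -> \bar R}).
Hypothesis numu : nu `<< mu.

Local Notation rn := (Radon_Nikodym_SigmaFinite.f nu mu).

Definition density t : R := fine (rn t).

Let densityE t : (density t)%:E = rn t.
Proof. by rewrite fineK ?Radon_Nikodym_SigmaFinite.f_fin_num. Qed.

Let density_mul_ge0 (D : set R) (h : R -> R) : measurable D -> (forall t, 0 <= h t) ->
  nu.-integrable D (EFin \o h) ->
  mu.-integrable D (EFin \o (fun t => h t * density t)) /\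
  \int[mu]_(t in D) (h t * density t) = \int[nu]_(t in D) h t.
Proof.
move=> mD h0 ih; have h0' t : (0 <= (EFin \o h) t)%E by rewrite lee_fin.
have E : EFin \o (fun t => h t * density t) = ((EFin \o h) \* rn)%E.
  by apply/funext => t; rewrite /= EFinM densityE.
split; first by rewrite E; exact: Radon_Nikodym_SigmaFinite.integrableM.
congr fine; have mh := measurable_int _ ih.
rewrite -(Radon_Nikodym_SigmaFinite.change_of_variables numu h0' mD mh).
by apply: eq_integral => t _; rewrite /= EFinM densityE.
Qed.

Let density_mul_real (D : set R) (h : R -> R) : measurable D ->
  nu.-integrable D (EFin \o h) ->
  mu.-integrable D (EFin \o (fun t => h t * density t)) /\
  \int[mu]_(t in D) (h t * density t) = \int[nu]_(t in D) h t.
Proof.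
move=> mD ih.
pose p t := Num.max (h t) 0; pose n t := Num.max (- h t) 0.
have hpn t : h t = p t + -1 * n t.
  rewrite /p /n mulN1r; have [a0|a0] := leP (h t) 0.
    by rewrite max_l ?oppr_ge0// add0r opprK.
  by rewrite max_r ?subr0// oppr_le0 ltW.
have mh : measurable_fun D h by apply/measurable_EFinP; exact: measurable_int ih.
have ip : nu.-integrable D (EFin \o p).
  apply: (le_integrable mD _ _ ih).
    by apply/measurable_EFinP; apply: measurable_maxr => //.
  move=> t _; rewrite lee_fin ger0_norm ?le_max ?lexx ?orbT//.
  by rewrite /p ge_max ler_norm normr_ge0.
have iN : nu.-integrable D (EFin \o n).
  apply: (le_integrable mD _ _ ih).
    apply/measurable_EFinP; apply: measurable_maxr => //.
    exact: measurableT_comp.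
  move=> t _; rewrite lee_fin ger0_norm ?le_max ?lexx ?orbT//.
  by rewrite /n ge_max -normrN ler_norm normr_ge0.
have [mp pE] := density_mul_ge0 mD (fun t => (ltac:(by rewrite /p le_max lexx orbT) : 0 <= p t)) ip.
have [mn nE] := density_mul_ge0 mD (fun t => (ltac:(by rewrite /n le_max lexx orbT) : 0 <= n t)) iN.
have mn' := integrable_RZl mD (-1) mn.
have iN' := integrable_RZl mD (-1) iN.
split.
  have := integrable_RD mD mp mn'; apply: eq_integrable => // t _ /=.
  by rewrite (hpn t) mulrDl mulrA.
transitivity (\int[mu]_(t in D) (p t * density t + -1 * (n t * density t))).
  by apply: eq_Rintegral => t _; rewrite {1}(hpn t) mulrDl mulrA.
rewrite RintegralD// RintegralZl// pE nE -RintegralZl// -RintegralD//.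
by apply: eq_Rintegral => t _; rewrite -hpn.
Qed.

(** Integrals of [g] with respect to [nu] are integrals of [g] times the density;
    reduced to nonnegative functions. *)
Lemma density_mul (D : set R) (g : R -> C) : measurable D -> cintegrable nu D g ->
  cintegrable mu D (fun t => g t * (density t)%:C) /\
  cintegral mu D (fun t => g t * (density t)%:C) = cintegral nu D g.
Proof.
move=> mD [gr gi].
have [ir Er] := density_mul_real mD gr; have [ii Ei] := density_mul_real mD gi.
have Re_mul t : complex.Re (g t * (density t)%:C) = complex.Re (g t) * density t.
  by rewrite ReM /= mulr0 subr0.
have Im_mul t : complex.Im (g t * (density t)%:C) = complex.Im (g t) * density t.
  by rewrite ImM /= mulr0 add0r.
split; first by split; [under eq_fun do rewrite Re_mul|under eq_fun do rewrite Im_mul].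
rewrite /cintegral -Er -Ei; congr (_ +i* _); apply: eq_Rintegral => t _.
  exact: Re_mul.
exact: Im_mul.
Qed.

End Density.

(** * Entrywise convergence of matrices *)
Section MatrixConvergence.
Variable R : realType.
Local Notation C := R[i].
Local Notation normc := (@Normc.normc R).
Variable q : nat.

Lemma cvg_mx_normc (T : Type) (G : set_system T) {FG : Filter G} (M : T -> 'M[C]_q)
    (L : 'M[C]_q) :
  M @ G --> L <-> forall i j (e : R), 0 < e ->
    \forall x \near G, normc (L i j - M x i j) < e.
Proof.
split=> [cv i j e e0|h].
  have /cvg_ballP cij : (fun x => M x i j) @ G --> L i j.
    apply: (@cvg_comp _ _ _ M (fun A : 'M[C]_q => A i j) _ _ _ cv).
    exact: coord_continuous.
  have e0' : 0 < e%:C by rewrite ltcR.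
  apply: filterS (cij _ e0') => x; rewrite /ball /= /ball_ normcE' ltcR.
  by [].
apply/cvg_ballP => e e0.
have er : e = (complex.Re e)%:C by move: e0; rewrite ltcE /= => /andP[/eqP h0 _]; apply: eqC.
have e0' : 0 < complex.Re e by move: e0; rewrite er ltcR.
have H : \forall x \near G, forall i j, normc (L i j - M x i j) < complex.Re e.
  apply: filter_forall => i; apply: filter_forall => j; exact: h.
apply: filterS H => x hx; split=> // i j.
by rewrite /ball /= /ball_ normcE' er ltcR; exact: hx.
Qed.

End MatrixConvergence.

Section PolarBounds.
Variable R : realType.
Local Notation C := R[i].
Local Notation normc := (@Normc.normc R).
Variable q : nat.
Local Open Scope sesquilinear_scope.

Lemma normc_sum (I : Type) (r : seq I) (g : I -> C) :
  normc (\sum_(k <- r) g k) <= \sum_(k <- r) normc (g k).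
Proof.
elim: r => [|k r IHr]; first by rewrite !big_nil normc0.
by rewrite !big_cons (le_trans (normcD _ _))// lerD2l.
Qed.

Lemma normc_polar_weight k : normc (polar_weight R k) = 4^-1.
Proof.
rewrite normcM normcX normci expr1n mul1r normcV; congr (_^-1).
by rewrite -[X in Normc.normc X](rmorph_nat (real_complex R)) normcR ger0_norm.
Qed.

Lemma parallelogram (x y : 'cV[C]_q) A :
  qform (x + y) A + qform (x - y) A = 2 * qform x A + 2 * qform y A.
Proof.
have starD (u w : 'cV[C]_q) : (u + w) ^t* = u ^t* + w ^t*.
  by rewrite linearD /= map_mxD.
have starN (u : 'cV[C]_q) : (- u) ^t* = - u ^t*.
  by rewrite linearN /= map_mxN.
have [f fE] : exists f : 'rV[C]_q -> 'cV[C]_q -> C, forall u w, (u *m A *m w) 0 0 = f u w.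
  by exists (fun u w => (u *m A *m w) 0 0).
have fDl u v w : f (u + v) w = f u w + f v w by rewrite -!fE !mulmxDl [LHS]mxE.
have fDr u v w : f w (u + v) = f w u + f w v by rewrite -!fE mulmxDr [LHS]mxE.
have fNl u w : f (- u) w = - f u w by rewrite -!fE !mulNmx [LHS]mxE.
have fNr u w : f u (- w) = - f u w by rewrite -!fE mulmxN [LHS]mxE.
rewrite /qform starD starD starN !fE !fDl !fDr !fNl !fNr.
by set a := f _ _; set b := f _ _; set c := f _ _; set d := f _ _; ring.
Qed.

Lemma qform_scale (c : C) (x : 'cV[C]_q) A : qform (c *: x) A = c * c^*%C * qform x A.
Proof.
rewrite /qform; have -> : (c *: x) ^t* = c^*%C *: x ^t*.
  by rewrite linearZ /= map_mxZ.
by rewrite -!scalemxAl -scalemxAr !mxE mulrA [c * _]mulrC.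
Qed.

End PolarBounds.

(** * The matrix measure *)

Section MatrixMeasure.
Variable R : realType.
Local Notation C := R[i].
Local Notation normc := (@Normc.normc R).
Variable q : nat.
Implicit Types (A B : set R) (v : 'cV[C]_q) (i j : 'I_q) (z : C).
Variables (alpha : R) (F : C -> 'M[C]_q).
Hypothesis FS : classS alpha F.
Local Notation H := (@halfline R alpha).

Definition qform_fun v z : C := qform v (F z).

Lemma entry_derivable z i j : derivable F z 1 -> derivable (fun z => F z i j) z 1.
Proof.
move/derivable1_diffP => h; apply/derivable1_diffP.
apply: (@differentiable_comp _ _ _ _ F (fun M : 'M[C]_q => M i j)) => //.
exact: differentiable_coord.
Qed.

Lemma scalar_class_qform v : scalar_class alpha (qform_fun v).
Proof.
have [dF imF rF] := FS; split.
- move=> z zs; rewrite /qform_fun; under eq_fun do rewrite qformE.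
  apply: holo_sum => j; apply: holo_sum => i.
  apply: holoM; last exact: holo_cst.
  by apply: holoM; [exact: holo_cst|apply: entry_derivable; exact: dF].
- move=> z z0; have /nnhermitianP/(_ v)[_] := imF z z0.
  by rewrite qform_immx.
- by move=> x xa; have /nnhermitianP/(_ v)[] := rF x xa.
Qed.

Lemma decays_sum (I : Type) (r : seq I) (f : I -> C -> C) :
  (forall k, decays (f k)) -> decays (fun z => \sum_(k <- r) f k z).
Proof.
move=> df; elim: r => [|k r [K [Y hY]]].
  by exists 0, 0 => y _ _; rewrite big_nil normc0 mulr0.
have [K' [Y' hY']] := df k.
exists (K' + K), (Num.max Y' Y) => y; rewrite ge_max => /andP[y1 y2] y0.
rewrite big_cons; apply: (@le_trans _ _ (y * (normc (f k (0 +i* y)) +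
  normc (\sum_(k <- r) f k (0 +i* y))))).
  by rewrite ler_wpM2l ?normcD// ltW.
by rewrite mulrDr lerD ?hY ?hY'.
Qed.

Hypothesis dc : forall v, decays (qform_fun v).

Let nfq v : nevanlinna (qform_fun v) := scalar_nevanlinna (scalar_class_qform v).

(** Its spectral measure is the trace measure of the matrix measure, again by the
    linearity of spectral measures. *)
Definition trace_fun z : C := \sum_i qform_fun (delta_mx i 0) z.

Let ntr : nevanlinna trace_fun.
Proof.
have := @nevanlinna_sum R _ (index_enum 'I_q) (fun=> 1) (fun i => qform_fun (delta_mx i 0))
  (fun=> ler01) (fun i => nfq _).
rewrite (_ : (fun z => _) = trace_fun)//; apply/funext => z.
by apply: eq_bigr => i _; rewrite mul1r.
Qed.

Let dtr : decays trace_fun.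
Proof. by apply: decays_sum => i; exact: dc. Qed.

Definition vector_measure v : {finite_measure set R -> \bar R} :=
  spectral_fin (nfq v) (dc v).

Definition trace_measure : {finite_measure set R -> \bar R} := spectral_fin ntr dtr.

Local Notation mu := vector_measure.
Local Notation tau := trace_measure.

(** The polarization of the scalar measures of the functions [v^* F v]. *)
Definition matrix_measure A : 'M[C]_q :=
  \matrix_(i, j) \sum_k polar_weight R k * (fine (mu (polar R i j k) A))%:C.

(** Every relation with real coefficients between the forms [v^* M v], for
    arbitrary matrices [M], holds between the functions [v^* F v] and therefore
    between their spectral measures. *)
Lemma qform_matrix_measure v A : measurable A ->
  qform v (matrix_measure A) = (fine (mu v A))%:C.
Proof.
move=> mA.
have [m mE] : exists m : 'cV[C]_q -> R, forall w, m w = fine (mu w A).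
  by exists (fun w => fine (mu w A)).
have ME i j : matrix_measure A i j = \sum_k polar_weight R k * (m (polar R i j k))%:C.
  by rewrite mxE; apply: eq_bigr => k _; rewrite mE.
have rel (a : polar_index q -> R) :
    (forall M, qform v M = \sum_t (a t)%:C * qform (polar_vec R t) M) ->
    m v = \sum_t a t * m (polar_vec R t).
  move=> h; rewrite mE; under eq_bigr do rewrite mE.
  apply: (spectral_relation (fun t => nfq (polar_vec R t)) (nfq v)) => //.
  by move=> z _; rewrite /qform_fun h.
rewrite -mE; clear mE.
have -> : qform v (matrix_measure A) = \sum_t polar_coef v t * (m (polar_vec R t))%:C.
  rewrite -(sum_polar v (fun i j k => (m (polar R i j k))%:C)) qformE.
  by apply: eq_bigr => j _; apply: eq_bigr => i _; rewrite ME.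
have Re_rel := rel _ (qform_expand_Re v).
(* the relation for the imaginary parts alone has no function on the left-hand
   side; adding the real parts supplies one *)
have Im_rel : m v = \sum_t (complex.Re (polar_coef v t) +
    complex.Im (polar_coef v t)) * m (polar_vec R t).
  apply: rel => M; transitivity (\sum_t (complex.Re (polar_coef v t))%:C * qform (polar_vec R t) M +
      \sum_t (complex.Im (polar_coef v t))%:C * qform (polar_vec R t) M).
    by rewrite qform_expand_Im addr0 -qform_expand_Re.
  rewrite -big_split.
  by apply: eq_bigr => t _; rewrite rmorphD mulrDl.
have split_sum (S : polar_index q -> C) : \sum_t S t =
    (\sum_t complex.Re (S t)) +i* (\sum_t complex.Im (S t)).
  elim/big_rec3: _ => [|t x y z _ ->]; first by [].
  by apply: eqC; rewrite ?ReD ?ImD.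
rewrite split_sum; apply: eqC => /=.
  by rewrite Re_rel; apply: eq_bigr => t _; rewrite ReM /= mulr0 subr0.
under eq_bigr do rewrite ImM /= mulr0 add0r.
move: Im_rel; under [X in _ = X -> _]eq_bigr do rewrite mulrDl; rewrite big_split /= -Re_rel => /eqP.
by rewrite addrC -subr_eq subrr eq_sym => /eqP.
Qed.

Lemma nnhermitian_matrix_measure A : measurable A -> nnhermitian (matrix_measure A).
Proof.
move=> mA; apply/nnhermitianP => v; rewrite qform_matrix_measure//=.
by rewrite fine_ge0 ?measure_ge0.
Qed.

Lemma trace_matrix_measure A : measurable A ->
  \tr (matrix_measure A) = (fine (tau A))%:C.
Proof.
move=> mA; rewrite /mxtrace.
have -> : fine (tau A) = \sum_i 1 * fine (mu (delta_mx i 0) A).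
  apply: (spectral_relation (fun i => nfq (delta_mx i 0)) ntr) => //.
  by move=> z _; apply: eq_bigr => i _; rewrite mul1r.
rewrite rmorph_sum; apply: eq_bigr => i _.
by rewrite -qform_delta qform_matrix_measure// mul1r.
Qed.

Lemma matrix_measure_sigma_additive (A : nat -> set R) :
  (forall n, measurable (A n)) -> trivIset setT A ->
  (fun n => \sum_(k < n) matrix_measure (A k)) @ \oo --> matrix_measure (\bigcup_n A n).
Proof.
move=> mA tA; apply/cvg_mx_normc => i j e e0.
have cv k : (fun n => \sum_(l < n) fine (mu (polar R i j k) (A l))) @ \oo -->
    fine (mu (polar R i j k) (\bigcup_n A n)).
  have mU : measurable (\bigcup_n A n) by apply: bigcup_measurable.
  have /fine_cvgP[_] : (\sum_(0 <= l < n) mu (polar R i j k) (A l))%E @[n --> \oo] -->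
      (fine (mu (polar R i j k) (\bigcup_n A n)))%:E.
    rewrite fineK; last exact: fin_num_measure.
    exact: (@measure_sigma_additive _ _ _ (mu (polar R i j k)) A mA tA).
  apply: cvg_trans; apply: near_eq_cvg; apply: nearW => n /=.
  by rewrite big_mkord -sum_fine// => l _; exact: fin_num_measure.
have h : \forall n \near \oo, forall k, `|fine (mu (polar R i j k) (\bigcup_n A n)) -
    \sum_(l < n) fine (mu (polar R i j k) (A l))| < e / 2.
  apply: filter_forall => k; move/cvgrPdist_lt: (cv k); apply.
  by rewrite divr_gt0.
apply: filterS h => n hn; rewrite mxE summxE.
under [X in _ - X]eq_bigr do rewrite mxE.
rewrite exchange_big -sumrB /=.
under eq_bigr do rewrite -mulr_sumr -mulrBr -rmorph_sum -rmorphB.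
apply: (@le_lt_trans _ _ (\sum_(k < 4) 4^-1 * (e / 2))); last first.
  by rewrite sumr_const card_ord -mulr_natl; lra.
apply: (le_trans (normc_sum _ _)); apply: ler_sum => k _.
rewrite normcM normc_polar_weight normcR ler_wpM2l ?invr_ge0//.
exact/ltW/hn.
Qed.

(** The parallelogram identity bounds the measure of [e_j + i^k e_i] by twice the
    sum of two diagonal measures. *)
Lemma vector_measure_dominated i j k : mu (polar R i j k) `<< tau.
Proof.
apply/null_content_dominatesP => A mA tA.
have fin (nu : {finite_measure set R -> \bar R}) : nu A \is a fin_num by exact: fin_num_measure.
have d0 l : qform (delta_mx l 0) (matrix_measure A) = 0.
  have tr0 : \sum_l fine (mu (delta_mx l 0) A) = 0.
    apply: (@complexI R); rewrite rmorph_sum /=.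
    transitivity (\tr (matrix_measure A)).
      by apply: eq_bigr => p _; rewrite -qform_matrix_measure// qform_delta.
    by rewrite trace_matrix_measure// tA.
  rewrite qform_matrix_measure//; congr (_%:C).
  have := tr0 => /eqP; rewrite psumr_eq0; last by move=> p _; rewrite fine_ge0 ?measure_ge0.
  by move=> /allP/(_ l); rewrite mem_index_enum => /(_ isT)/eqP.
have nnM := (nnhermitianP (matrix_measure A)).1 (nnhermitian_matrix_measure mA).
have qM := qform_matrix_measure (polar R i j k) mA.
move: nnM d0 qM; move: (matrix_measure A) => M nnM d0 qM.
have y0 : qform (('i%C ^+ k) *: delta_mx i 0) M = 0 by rewrite qform_scale d0 mulr0.
have := parallelogram (delta_mx j 0) (('i%C ^+ k) *: delta_mx i 0) M.
rewrite y0 d0 !mulr0 addr0 -/(polar R i j k) qM => /(congr1 (@complex.Re R)).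
rewrite ReD /= => h; have [_ nn] := nnM (delta_mx j 0 - ('i%C ^+ k) *: delta_mx i 0).
move: h nn; set r := complex.Re _ => h nn.
rewrite -(fineK (fin _)); congr _%:E.
have mu0 : 0 <= fine (mu (polar R i j k) A) by rewrite fine_ge0 ?measure_ge0.
by apply/le_anti; rewrite mu0 andbT -h lerDl.
Qed.

Definition matrix_density (t : R) : 'M[C]_q :=
  \matrix_(i, j) \sum_k polar_weight R k * (density (mu (polar R i j k)) tau t)%:C.

Lemma cintegral_lin (m : {measure set R -> \bar R}) (D : set R) (I : Type) (r : seq I)
    (c : I -> C) (g : I -> R -> C) : measurable D -> (forall k, cintegrable m D (g k)) ->
  cintegrable m D (fun t => \sum_(k <- r) c k * g k t) /\
  cintegral m D (fun t => \sum_(k <- r) c k * g k t) =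
    \sum_(k <- r) c k * cintegral m D (g k).
Proof.
move=> mD ig; elim: r => [|k r [ir Er]].
  under eq_fun do rewrite big_nil; rewrite big_nil; split.
    by split; exact: integrable0.
  by rewrite /cintegral /Rintegral /= !integral0.
under eq_fun do rewrite big_cons; rewrite big_cons.
have ik := cintegrableZl mD (c k) (ig k).
split; first exact: cintegrableD.
by rewrite (cintegralD mD ik ir) cintegralZl// Er.
Qed.

Lemma matrix_density_integral (D : set R) (g : R -> C) i j : measurable D ->
  (forall v, cintegrable (mu v) D g) ->
  cintegrable tau D (fun t => g t * matrix_density t i j) /\
  cintegral tau D (fun t => g t * matrix_density t i j) =
    \sum_k polar_weight R k * cintegral (mu (polar R i j k)) D g.
Proof.
move=> mD ig.
have E t : \sum_k polar_weight R k * (g t * (density (mu (polar R i j k)) tau t)%:C) =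
    g t * matrix_density t i j.
  by rewrite mxE mulr_sumr; apply: eq_bigr => k _; rewrite mulrCA.
have dm k := density_mul (@vector_measure_dominated i j k) mD (ig (polar R i j k)).
have [il El] := cintegral_lin (index_enum 'I_4) (polar_weight R) mD (fun k => (dm k).1).
split; first by apply: (eq_cintegrable mD _ il) => t _; exact: E.
have E' t : D t -> g t * matrix_density t i j =
   \sum_k polar_weight R k * (g t * (density (mu (polar R i j k)) tau t)%:C) by rewrite E.
have E2 := @eq_cintegral _ _ _ tau D _ _ E'.
apply: (etrans E2); apply: (etrans El).
by apply: eq_bigr => k _; exact: (congr1 (fun x => polar_weight R k * x) (dm k).2).
Qed.

Lemma vector_cst_integrable v A (c : C) : measurable A -> cintegrable (mu v) A (fun=> c).
Proof.
move=> mA; apply: (@bounded_cintegrable R (mu v) _ A (fun=> c) (normc c)) => //.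
exact: spectral_finite.
Qed.

Lemma trace_density_matrix_measure :
  trace_density alpha matrix_measure tau matrix_density.
Proof.
have ones A : measurable A -> forall i j,
    cintegrable tau A (fun t => matrix_density t i j) /\
    cintegral tau A (fun t => matrix_density t i j) = matrix_measure A i j.
  move=> mA i j.
  have [h1 h2] := matrix_density_integral i j mA (fun v => vector_cst_integrable v 1 mA).
  split; first by apply: (eq_cintegrable mA _ h1) => t _; rewrite mul1r.
  transitivity (cintegral tau A (fun t => 1 * matrix_density t i j)).
    by apply: eq_cintegral => t _; rewrite mul1r.
  rewrite h2 mxE; apply: eq_bigr => k _; congr (_ * _).
  rewrite (@cintegral_real _ _ R (mu (polar R i j k)) A (fun=> 1)) Rintegral_cst//.
  by rewrite mul1r.
split; [|split].
- by move=> A mA _; rewrite trace_matrix_measure//= fineK// fin_num_measure.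
- by move=> i j; have [] := ones H (measurable_halfline alpha) i j.
- by move=> A mA _ i j; have [_ ->] := ones A mA i j.
Qed.

(** A matrix is determined by its quadratic form, so integrals against the matrix
    measure may be computed one direction at a time. *)
Lemma has_integral_matrix_measure (g : R -> C) (M : 'M[C]_q) :
  (forall v, cintegrable (mu v) H g /\ cintegral (mu v) H g = qform v M) ->
  has_integral alpha matrix_measure g M.
Proof.
move=> h; exists tau, matrix_density; split; first exact: trace_density_matrix_measure.
move=> i j; have [h1 h2] := matrix_density_integral i j (measurable_halfline alpha) (fun v => (h v).1).
split=> //; rewrite h2 polarization; apply: eq_bigr => k _.
by rewrite (h _).2.
Qed.

Lemma stieltjes_measure_matrix_measure : stieltjes_measure alpha F matrix_measure.
Proof.
split.
  split=> [A mA _|A mA _ tA]; first exact: nnhermitian_matrix_measure.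
  exact: matrix_measure_sigma_additive.
move=> z zs; apply: has_integral_matrix_measure => v.
have [_ rep] := scalar_representation (nfq v) (scalar_class_qform v) (dc v).
split; last exact: esym (rep z zs).
by apply: cauchy_slit_integrable => //; exact: (spectral_finite (nfq v) (dc v)).
Qed.

Lemma has_moment_matrix_measure m (s : nat -> 'M[C]_q) :
  (forall k, (k <= m)%N -> s k \is hermsymmx) ->
  (forall v, vanishes (expansion_error (qform_fun v) (fun k => qform v (s k)) m)) ->
  forall k, (k <= m)%N -> has_integral alpha matrix_measure (fun t => t%:C ^+ k) (s k).
Proof.
move=> hs vs k km; apply: has_integral_matrix_measure => v.
have [_ rep] := scalar_representation (nfq v) (scalar_class_qform v) (dc v).
have mH := measurable_halfline alpha.
have vs' : vanishes (expansion_error (cauchy_transform alpha (mu v))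
    (fun k => (complex.Re (qform v (s k)))%:C) m).
  move=> e e0; have [Y hY] := vs v e e0; exists Y => y Yy y0.
  move: (hY y Yy y0); rewrite /expansion_error => h.
  apply: le_lt_trans h; rewrite le_eqVlt; apply/orP; left; apply/eqP; congr (normc (_ * (_ + _))).
    by rewrite rep//; exact: upper_slit.
  apply: eq_bigr => l _; congr (_ * _); apply: eqC => //=.
  by rewrite Im_qform_hermitian// hs// -ltnS.
have [ik Ik] := hamburger_nevanlinna (spectral_finite (nfq v) (dc v)) vs' km.
have tE t : H t -> (t ^+ k)%:C = t%:C ^+ k by rewrite rmorphXn.
split; first exact: (eq_cintegrable mH tE (cintegrable_real ik)).
rewrite -(eq_cintegral _ tE) cintegral_real.
apply: eqC; first exact: Ik.
by rewrite Im_qform_hermitian// hs.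
Qed.

End MatrixMeasure.

(** * Uniqueness of the trace density *)

Section TraceDensityUnique.
Variable R : realType.
Local Notation C := R[i].
Implicit Types (D N : set R).

Lemma integrable_agree (m m' : {measure set R -> \bar R}) D (h : R -> R) :
  (forall A, measurable A -> A `<=` D -> m A = m' A) ->
  m'.-integrable D (EFin \o h) -> m.-integrable D (EFin \o h).
Proof.
move=> mm /integrableP[mh ih]; apply/integrableP; split => //.
by rewrite (eq_measure_integral m').
Qed.

Lemma integrable_off (m : {measure set R -> \bar R}) D N (h k : R -> R) :
  measurable D -> measurable N -> m N = 0%E -> measurable_fun D h ->
  (forall t, D t -> ~ N t -> h t = k t) ->
  m.-integrable D (EFin \o k) -> m.-integrable D (EFin \o h).
Proof.
move=> mD mN N0 mh hk /integrableP[mk ik]; apply/integrableP; split.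
  exact/measurable_EFinP.
apply: le_lt_trans ik; rewrite le_eqVlt; apply/orP; left; apply/eqP.
have mh' : measurable_fun D (EFin \o h) by exact/measurable_EFinP.
apply: ae_eq_integral => //; try exact: measurableT_comp.
exists N; split => // x /= /not_implyP[Dx hkx]; apply: contrapT => Nx; apply: hkx.
by rewrite hk.
Qed.

Lemma cintegrable_transfer (m m' : {measure set R -> \bar R}) D N (f f' : R -> C) :
  measurable D -> (forall A, measurable A -> A `<=` D -> m A = m' A) ->
  measurable N -> m N = 0%E -> cmeasurable D f ->
  (forall t, D t -> ~ N t -> f t = f' t) -> cintegrable m' D f' ->
  cintegrable m D f /\ cintegral m D f = cintegral m' D f'.
Proof.
move=> mD mm mN N0 mf ff [ir ii].
have ir' := integrable_agree mm ir; have ii' := integrable_agree mm ii.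
have mf' : cmeasurable D f' by exact: (cintegrable_cmeasurable (conj ir ii)).
split.
  by case: mf => mr mi; split; [apply: (integrable_off mD mN N0 mr _ ir')|
    apply: (integrable_off mD mN N0 mi _ ii')] => t Dt Nt; rewrite ff.
rewrite (eq_cintegral_off mD mN N0 mf mf' ff) /cintegral /Rintegral.
by congr (fine _ +i* fine _); apply: eq_measure_integral.
Qed.

Lemma cintegral_ae_eq (m m' : {measure set R -> \bar R}) D (f f' : R -> C) :
  measurable D -> (forall A, measurable A -> A `<=` D -> m A = m' A) ->
  cintegrable m D f -> cintegrable m' D f' ->
  (forall A, measurable A -> A `<=` D -> cintegral m A f = cintegral m' A f') ->
  exists N, [/\ measurable N, m N = 0%E & forall t, D t -> ~ N t -> f t = f' t].
Proof.
move=> mD mm [ir ii] [ir' ii'] ff.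
have jr' := integrable_agree mm ir'; have ji' := integrable_agree mm ii'.
have key (h h' : R -> R) : m.-integrable D (EFin \o h) -> m.-integrable D (EFin \o h') ->
    m'.-integrable D (EFin \o h') ->
    (forall A, measurable A -> A `<=` D ->
       \int[m]_(t in A) h t = \int[m']_(t in A) h' t) ->
    ae_eq m D (EFin \o h) (EFin \o h').
  move=> ih jh' ih' hh; apply: integral_ae_eq => //; first exact: measurable_int jh'.
  move=> E ED mE.
  have f1 : (\int[m]_(t in E) (EFin \o h) t)%E \is a fin_num.
    by apply: integrable_fin_num => //; exact: integrableS ED ih.
  have f2 : (\int[m']_(t in E) (EFin \o h') t)%E \is a fin_num.
    by apply: integrable_fin_num => //; exact: integrableS ED ih'.
  have := hh E mE ED; rewrite /Rintegral => e.
  transitivity (\int[m']_(t in E) (EFin \o h') t)%E.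
    by rewrite -(fineK f1) -(fineK f2); congr _%:E.
  apply/esym/eq_measure_integral => A mA AE; apply: mm => //.
  exact: subset_trans ED.
have [N1 [mN1 N10 h1]] : ae_eq m D (EFin \o (fun t => complex.Re (f t)))
    (EFin \o (fun t => complex.Re (f' t))).
  by apply: key => // A mA AD; have := ff A mA AD => /(congr1 (@complex.Re R)).
have [N2 [mN2 N20 h2]] : ae_eq m D (EFin \o (fun t => complex.Im (f t)))
    (EFin \o (fun t => complex.Im (f' t))).
  by apply: key => // A mA AD; have := ff A mA AD => /(congr1 (@complex.Im R)).
exists (N1 `|` N2); split; first exact: measurableU.
  by rewrite measureU0.
move=> t Dt N12; apply: eqC.
  apply: contrapT => ne; apply: N12; left; apply: h1 => /= /(_ Dt) [].
  exact: ne.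
apply: contrapT => ne; apply: N12; right; apply: h2 => /= /(_ Dt) [].
exact: ne.
Qed.

Variables (q : nat) (alpha : R) (sigma : set R -> 'M[C]_q).
Local Notation H := (@halfline R alpha).

(** Two trace densities of one measure agree almost everywhere on the half-line,
    where their trace measures coincide; hence the various integrals required by
    the moment class may all be taken with a single density. *)
Lemma trace_density_transfer (tau tau' : {finite_measure set R -> \bar R}) W W' (g : R -> C) i j :
  trace_density alpha sigma tau W -> trace_density alpha sigma tau' W' ->
  cmeasurable setT g ->
  cintegrable tau' H (fun t => g t * W' t i j) ->
  cintegrable tau H (fun t => g t * W t i j) /\
  cintegral tau H (fun t => g t * W t i j) = cintegral tau' H (fun t => g t * W' t i j).
Proof.
move=> [t1 [iW sW]] [t1' [iW' sW']] mg ig.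
have mH := measurable_halfline alpha.
have mm A : measurable A -> A `<=` H -> tau A = tau' A.
  by move=> mA AH; rewrite t1// t1'.
have WW A : measurable A -> A `<=` H -> cintegral tau A (fun t => W t i j) =
    cintegral tau' A (fun t => W' t i j).
  by move=> mA AH; rewrite -sW// -sW'.
have [N [mN N0 hN]] := cintegral_ae_eq mH mm (iW i j) (iW' i j) WW.
apply: (cintegrable_transfer mH mm mN N0 _ _ ig).
  apply: cmeasurableM; first exact: cmeasurable_subset.
  exact: cintegrable_cmeasurable (iW i j).
by move=> t Ht Nt; rewrite hN.
Qed.

End TraceDensityUnique.

(** * From moments to the asymptotic expansion *)

Section Expansion.
Variable R : realType.
Local Notation C := R[i].
Local Notation normc := (@Normc.normc R).
Variables (q : nat) (alpha : R).
Local Notation H := (@halfline R alpha).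

Lemma cmeasurable_power k : cmeasurable setT (fun t : R => t%:C ^+ k).
Proof.
under eq_fun do rewrite -rmorphXn.
by apply: cmeasurable_real; exact: exprn_measurable.
Qed.

(** The error term is the remainder of the finite geometric expansion,
    [t / (t - i y)] integrated against the integrable function [t^m W]. *)
Lemma moments_expansion (F : C -> 'M[C]_q) sigma m (s : nat -> 'M[C]_q) :
  stieltjes_measure alpha F sigma ->
  (forall k, (k <= m)%N -> has_integral alpha sigma (fun t => t%:C ^+ k) (s k)) ->
  forall i j, vanishes (expansion_error (fun z => F z i j) (fun k => s k i j) m).
Proof.
move=> [_ rep] mom i j; have mH := measurable_halfline alpha.
have [tau [W [tW _]]] := mom 0%N (leq0n m).
have hk k : (k <= m)%N -> cintegrable tau H (fun t => t%:C ^+ k * W t i j) /\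
    s k i j = cintegral tau H (fun t => t%:C ^+ k * W t i j).
  move=> km; have [tau' [W' [tW' h]]] := mom k km; have [ik ->] := h i j.
  have [h1 h2] := trace_density_transfer tW tW' (cmeasurable_power k) ik.
  by split; [exact: h1|exact: esym h2].
have hz z : slit_plane alpha z -> cintegrable tau H (fun t => 1 / (t%:C - z) * W t i j) /\
    F z i j = cintegral tau H (fun t => 1 / (t%:C - z) * W t i j).
  move=> zs; have [tau' [W' [tW' h]]] := rep z zs; have [ik ->] := h i j.
  have [h1 h2] := trace_density_transfer tW tW' (cmeasurable_cauchy z) ik.
  by split; [exact: h1|exact: esym h2].
have [im _] := hk m (leqnn m).
move=> e e0; have [Y hY] := remainder_vanishes mH im e0.
exists Y => y Yy y0; apply: le_lt_trans (hY y Yy y0).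
have zs : slit_plane alpha (0 +i* y) by exact: upper_slit.
have [iz Fz] := hz _ zs.
have im' k : (k < m.+1)%N -> cintegrable tau H (fun t => t%:C ^+ k * W t i j).
  by move=> km; exact: (hk k km).1.
have [_ E] := cauchy_expansion mH (iy_neq0 y0) (fun t _ => subiy_neq0 t y0) iz im'.
rewrite /expansion_error Fz.
have -> : \sum_(k < m.+1) (0 +i* y) ^- k.+1 * s k i j = \sum_(k < m.+1)
    (0 +i* y) ^- k.+1 * cintegral tau H (fun t => t%:C ^+ k * W t i j).
  by apply: eq_bigr => k _; congr (_ * _); exact: (hk k (ltn_ord k)).2.
rewrite -E le_eqVlt; apply/orP; left; apply/eqP; congr (normc _).
apply: eq_cintegral => t _; rewrite exprS -mulrA; congr (_ * _).
by rewrite mulrCA.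
Qed.

End Expansion.

(** * Growth along the imaginary axis *)

Section Growth.
Variable R : realType.
Local Notation C := R[i].
Local Notation normc := (@Normc.normc R).
Variables (q : nat) (alpha : R).

Lemma iyE (y : R) : 'i%C * y%:C = 0 +i* y :> C.
Proof. by apply: eqC; rewrite ?ReM ?ImM /=; ring. Qed.

Lemma frobenius_le (A : 'M[C]_q) : frobenius A <= \sum_i \sum_j normc (A i j).
Proof.
have S0 : 0 <= \sum_i \sum_j normc (A i j).
  by apply: sumr_ge0 => i _; apply: sumr_ge0 => j _; exact: normc_ge0.
rewrite /frobenius -[leRHS](ger0_norm S0) -sqrtr_sqr ler_wsqrtr//.
have sq (I : Type) (r : seq I) (a : I -> R) : (forall k, 0 <= a k) ->
    \sum_(k <- r) a k ^+ 2 <= (\sum_(k <- r) a k) ^+ 2.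
  move=> a0; elim: r => [|k r IHr]; first by rewrite !big_nil expr0n.
  rewrite !big_cons sqrrD -addrA lerD2l (le_trans IHr)// lerDr.
  by rewrite mulrn_wge0// mulr_ge0// sumr_ge0.
apply: le_trans (sq _ _ _ _); last first.
  by move=> i; apply: sumr_ge0 => j _; exact: normc_ge0.
by apply: ler_sum => i _; apply: sq => j; exact: normc_ge0.
Qed.

Lemma cauchy_transform_bound (m : {measure set R -> \bar R}) y :
  (m setT < +oo)%E -> 0 < y ->
  y * normc (cauchy_transform alpha m (0 +i* y)) <= fine (m (halfline alpha)).
Proof.
move=> mfin y0; have mH := measurable_halfline alpha.
have ic := integrable_cst_fin mfin y^-1 mH.
rewrite mulrC -ler_pdivlMr// mulrC -Rintegral_cst//.
apply: normc_cintegral_le => //.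
  by apply: cauchy_slit_integrable => //; exact: upper_slit.
by move=> t _; exact: (@normc_cauchy_le R (0 +i* y) t).
Qed.

(** Decay only concerns large [y]; the bound for all [y >= 1] comes back from the
    integral representation that it entails. *)
Lemma classS0_of_decays (F : C -> 'M[C]_q) : classS alpha F ->
  (forall v, decays (qform_fun F v)) -> classS0 alpha F.
Proof.
move=> FS dc; split=> //.
have bnd v : exists K : R, forall y, 0 < y -> y * normc (qform v (F (0 +i* y))) <= K.
  have nf := scalar_nevanlinna (scalar_class_qform FS v).
  have [_ rep] := scalar_representation nf (scalar_class_qform FS v) (dc v).
  exists (fine (spectral nf (halfline alpha))) => y y0.
  have := cauchy_transform_bound (spectral_finite nf (dc v)) y0.
  by rewrite -rep//; exact: upper_slit.
have [K hK] := choice bnd.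
pose B := \sum_(i < q) \sum_(j < q) \sum_(k < 4) 4^-1 * K (polar R i j k).
apply: (@le_lt_trans _ _ B%:E); last exact: ltry.
apply: ge_ereal_sup => _ [y /= + <-]; rewrite in_itv /= andbT => y1.
have y0 : 0 < y by exact: lt_le_trans y1.
rewrite lee_fin iyE; apply: (@le_trans _ _ (y * \sum_i \sum_j normc (F (0 +i* y) i j))).
  by rewrite ler_wpM2l ?frobenius_le// ltW.
rewrite mulr_sumr; apply: ler_sum => i _; rewrite mulr_sumr; apply: ler_sum => j _.
rewrite polarization; apply: (@le_trans _ _ (y * \sum_k normc (polar_weight R k *
    qform (polar R i j k) (F (0 +i* y))))).
  by rewrite ler_wpM2l ?normc_sum// ltW.
rewrite mulr_sumr; apply: ler_sum => k _.
by rewrite normcM normc_polar_weight mulrCA ler_wpM2l ?invr_ge0// hK.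
Qed.

End Growth.

Theorem theorem6p6 (R : realType) (q : nat) (hq : (0 < q)%N) (alpha : R)
    (m : nat) (s : 'I_m.+1 -> 'M[R[i]]_q)
    (hs : forall j, s j \is hermsymmx) :
  classS_moments alpha s =
  [set F : R[i] -> 'M[R[i]]_q | classS alpha F /\
    (fun y : R => ('i * y%:C) ^+ m.+1 *:
       (F ('i * y%:C) + \sum_(j < m.+1) ('i * y%:C) ^- j.+1 *: s j))
      @ +oo --> (0 : 'M[R[i]]_q)].
Proof.
(* the finite sequence of moments, indexed by natural numbers *)
pose s' k := s (inord k).
have s'E (k : 'I_m.+1) : s' k = s k by rewrite /s' inord_val.
have errE (F : R[i] -> 'M[R[i]]_q) (L : 'M[R[i]]_q -> R[i]) y :
    (forall A B, L (A + B) = L A + L B) -> (forall c A, L (c *: A) = c * L A) ->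
    L (('i * y%:C) ^+ m.+1 *:
       (F ('i * y%:C) + \sum_(j < m.+1) ('i * y%:C) ^- j.+1 *: s j)) =
    expansion_error (fun z => L (F z)) (fun k => L (s' k)) m y.
  move=> LD LZ; rewrite /expansion_error -iyE LZ LD; congr (_ * (_ + _)).
  rewrite (big_morph L LD (_ : L 0 = 0)).
    by apply: eq_bigr => j _; rewrite LZ s'E.
  by rewrite -(scale0r 0) LZ mul0r.
apply/seteqP; split=> F.
  move=> [[FS _] [sigma st mom]]; split=> //.
  have mom' k : (k <= m)%N -> has_integral alpha sigma (fun t => t%:C ^+ k) (s' k).
    by move=> km; have := mom (inord k); rewrite inordK.
  apply/cvg_mx_normc => i j e e0.
  have [Y hY] := moments_expansion st mom' i j e0.
  have hM : \forall y \near +oo, Num.max Y 1 <= y by apply: nbhs_pinfty_ge; exact: num_real.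
  apply: filterS hM => y; rewrite ge_max => /andP[Yy y1].
  rewrite mxE sub0r normcN' (errE F (fun A => A i j)); last 2 first.
  - by move=> A B; rewrite mxE.
  - by move=> c A; rewrite mxE.
  by apply: hY => //; exact: lt_le_trans y1.
move=> [FS lim].
have van v : vanishes (expansion_error (qform_fun F v) (fun k => qform v (s' k)) m).
  move=> e e0; pose K := \sum_j \sum_i Normc.normc ((v i 0)^*%C) * Normc.normc (v j 0).
  have K0 : 0 <= K.
    by apply: sumr_ge0 => j _; apply: sumr_ge0 => i _; rewrite mulr_ge0 ?normc_ge0.
  have K1 : 0 < K + 1 by rewrite ltr_wpDl.
  have [Y [_ hY]] : \forall y \near +oo, forall i j : 'I_q,
      Normc.normc ((0 : 'M[R[i]]_q) i j - (('i * y%:C) ^+ m.+1 *: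
       (F ('i * y%:C) + \sum_(j < m.+1) ('i * y%:C) ^- j.+1 *: s j)) i j) < e / (K + 1).
    apply: filter_forall => i; apply: filter_forall => j.
    by move/cvg_mx_normc: lim; apply; rewrite divr_gt0.
  exists (Y + 1) => y Yy y0; rewrite -(errE F (qform v)); last 2 first.
  - by move=> A B; rewrite qformD.
  - by move=> c A; rewrite qformZ.
  have Yy' : Y < y by rewrite (lt_le_trans _ Yy)// ltrDl.
  have := hY y Yy'; move: (_ *: _) => M hM.
  apply: (@le_lt_trans _ _ (K * (e / (K + 1)))); last first.
    by rewrite mulrA ltr_pdivrMr// mulrC ltr_pM2l// ltrDl.
  rewrite qformE (le_trans (normc_sum _ _))// mulr_suml; apply: ler_sum => j _.
  rewrite (le_trans (normc_sum _ _))// mulr_suml; apply: ler_sum => i _.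
  rewrite !normcM mulrAC ler_wpM2l ?mulr_ge0 ?normc_ge0//.
  by have := hM i j; rewrite mxE sub0r normcN' => /ltW.
have dc v : decays (qform_fun F v) by exact: vanishes_decays (van v).
split; first exact: classS0_of_decays.
exists (matrix_measure FS dc); first exact: stieltjes_measure_matrix_measure.
move=> j; have := @has_moment_matrix_measure R q alpha F FS dc m s' _ van j (leq_ord j).
by rewrite s'E; apply=> k km; exact: hs.
Qed.
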